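(* Let $d\ge3$. The degree of the toric surface $X_{A_d^{(2)}}\subset\mathbb{P}^d$ is $\binom{d+1}{3}$. Moreover, $X_{A_d^{(2)}}$ is a toric linear projection of its normalization $X_{\overline{A_d^{(2)}}}\subset\mathbb{P}^N$, where $N=\frac{1}{12}d(d^2+8)$ if $d$ is even and $N=\frac{1}{12}d(d^2+11)$ if $d$ is odd.
   Context: $\mathbb{P}^n$ is complex projective $n$-space. For an integer matrix $C$ with columns $(1,\mathbf{c}_0),\dots,(1,\mathbf{c}_n)$, $\mathbf{c}_j\in\mathbb{Z}^r$, the projective toric variety $X_C\subset\mathbb{P}^n$ is the Zariski closure of the image of the map $(\mathbb{C}^* )^r\to\mathbb{P}^n$, $\mathbf{t}\mapsto(\mathbf{t}^{\mathbf{c}_0}:\cdots:\mathbf{t}^{\mathbf{c}_n})$, where $\mathbf{t}^{\mathbf{c}}=\prod_i t_i^{c_i}$. $A_d^{(2)}$ is the $3\times(d+1)$ matrix with columns $(1,j,\binom{j}{2})$, $j=0,\dots,d$. Let $P(d)\subset\mathbb{R}^2$ be the convex hull of the points $(j,\binom{j}{2})$, $j=0,\dots,d$. $\overline{A_d^{(2)}}$ is the matrix whose columns are the vectors $(1,\mathbf{b})$ with $\mathbf{b}$ running over all lattice points of $P(d)\cap\mathbb{Z}^2$; $N+1$ is the number of these lattice points, and $X_{\overline{A_d^{(2)}}}\subset\mathbb{P}^N$. ''Toric linear projection'' means the map $X_{\overline{A_d^{(2)}}}\to X_{A_d^{(2)}}$ induced by the coordinate projection from $\mathbb{P}^N$ to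 $\mathbb{P}^d$ that keeps only the homogeneous coordinates indexed by the columns of $A_d^{(2)}$. *)

(* Defs.v *)
From HB Require Import structures.
From mathcomp Require Import all_boot all_order all_algebra.
From mathcomp Require Import classical_sets reals complex mpoly.

Set Implicit Arguments.
Unset Strict Implicit.
Unset Printing Implicit Defensive.

Import Order.TTheory GRing.Theory Num.Theory.

Local Open Scope classical_set_scope.
Local Open Scope ring_scope.

(* Varieties are handled as spaces with functions: a set of points, its       *)
(* Zariski open subsets and, for every open subset U, the regular functions   *)
(* on U.  A regular function on U is a total function of which only the       *)
(* values on U matter.                                                        *)
Section Spaces.
Variable C : fieldType.

Record space := Space {
  point : Type;
  carrier : set point;
  opens : set (set point);
  regular : set point -> set (point -> C) }.

Arguments carrier : clear implicits.

Definition restrict (S : space) (U : set (point S)) : space :=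
  Space U [set V | opens V /\ V `<=` U] (@regular S).

Definition preim (Y X : space) (f : point Y -> point X) (V : set (point X)) :
    set (point Y) :=
  carrier Y `&` f @^-1` V.

Definition morphism (Y X : space) (f : point Y -> point X) : Prop :=
  [/\ forall y, carrier Y y -> carrier X (f y),
      forall V, opens V -> opens (preim f V)
    & forall V g, opens V -> regular V g -> regular (preim f V) (g \o f)].

Definition isomorphism (Y X : space) (f : point Y -> point X) : Prop :=
  morphism f /\
  exists g : point X -> point Y,
    [/\ morphism g,
        forall y, carrier Y y -> g (f y) = y
      & forall x, carrier X x -> f (g x) = x].

Definition irreducible (S : space) : Prop :=
  carrier S !=set0 /\
  forall U V : set (point S), opens U -> opens V ->
    U !=set0 -> V !=set0 -> U `&` V !=set0.

(* The local ring at p is integrally closed in its fraction field.  An        *)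
(* element of the fraction field is a quotient a / b of germs at p with b     *)
(* nonzero; its integral equation a^m/b^m + sum_(i < m) c_i a^i/b^i = 0 is    *)
(* multiplied by b^m.  Finitely many germs at p have representatives on a     *)
(* common open neighbourhood U of p.                                          *)
Definition normal_at (S : space) (p : point S) : Prop :=
  forall (U : set (point S)) (a b : point S -> C)
         (m : nat) (c : 'I_m -> point S -> C),
    opens U -> U p -> regular U a -> regular U b ->
    (forall i, regular U (c i)) ->
    ~ (exists W, [/\ opens W, W p, W `<=` U & forall q, W q -> b q = 0]) ->
    (forall q, U q ->
       a q ^+ m + \sum_(i < m) c i q * a q ^+ i * b q ^+ (m - i) = 0) ->
    exists W g, [/\ opens W, W p, W `<=` U, regular W g
                  & forall q, W q -> a q = b q * g q].

Definition normal (S : space) : Prop :=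
  irreducible S /\ forall p, carrier S p -> normal_at p.

Definition locally (T : Type) (op : set (set T))
    (frac : set T -> set (T -> C)) (U : set T) : set (T -> C) :=
  [set f | forall p, U p ->
     exists V, [/\ op V, V p, V `<=` U & frac V f]].

Section Affine.
Variable m : nat.

Definition acoord (v : 'rV[C]_m) : 'I_m -> C := fun i => v 0 i.

Definition affine_closed (Z : set 'rV[C]_m) : Prop :=
  exists E : set {mpoly C[m]},
    Z = [set v | forall F, E F -> F.@[acoord v] = 0].

Definition affine_opens (X : set 'rV[C]_m) : set (set 'rV[C]_m) :=
  [set U | exists2 Z, affine_closed Z & U = X `\` Z].

Definition affine_frac (V : set 'rV[C]_m) : set ('rV[C]_m -> C) :=
  [set f | exists F G : {mpoly C[m]}, forall v, V v ->
     G.@[acoord v] != 0 /\ f v = F.@[acoord v] / G.@[acoord v]].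

Definition affine_variety (X : set 'rV[C]_m) : space :=
  Space X (affine_opens X) (locally (affine_opens X) affine_frac).

End Affine.

Definition affine (S : space) : Prop :=
  exists (m : nat) (Z : set 'rV[C]_m) (f : point S -> 'rV[C]_m),
    affine_closed Z /\ @isomorphism S (affine_variety Z) f.

Definition finite_sections (Y X : space) (f : point Y -> point X)
    (V : set (point X)) : Prop :=
  exists (m : nat) (g : 'I_m -> point Y -> C),
    (forall i, regular (preim f V) (g i)) /\
    forall h, regular (preim f V) h ->
      exists a : 'I_m -> point X -> C,
        (forall i, regular V (a i)) /\
        forall y, preim f V y -> h y = \sum_(i < m) a i (f y) * g i y.

Definition finite_morphism (Y X : space) (f : point Y -> point X) : Prop :=
  morphism f /\
  forall x, carrier X x ->
    exists V, [/\ opens V, V x, affine (restrict V),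
                  affine (restrict (preim f V)) & finite_sections f V].

Definition birational (Y X : space) (f : point Y -> point X) : Prop :=
  exists (U : set (point Y)) (V : set (point X)),
    [/\ opens U, opens V, U !=set0, V !=set0
      & @isomorphism (restrict U) (restrict V) f].

Definition normalization (Y X : space) (f : point Y -> point X) : Prop :=
  [/\ irreducible X, normal Y, finite_morphism f & birational f].

End Spaces.

(* A point of P^n is a line L of C^(n+1); its homogeneous coordinates are     *)
(* those of the nonzero vector [vpick L] of L.  The vanishing of a form, and  *)
(* the quotient of two forms of the same degree, do not depend on this choice.*)
Section Projective.
Variables (C : fieldType) (n : nat).
Notation points := {vspace 'rV[C]_n.+1}.

Definition proj_space : set points := [set L | \dim L = 1%N].

Definition hcoord (L : points) : 'I_n.+1 -> C := fun i => vpick L 0 i.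

Definition proj_closed (Z : set points) : Prop :=
  exists2 E : set {mpoly C[n.+1]},
    (forall F, E F -> exists k, F \is k.-homog) &
    Z = [set L | proj_space L /\ forall F, E F -> F.@[hcoord L] = 0].

Definition proj_closure (E : set points) : set points :=
  smallest proj_closed E.

Definition proj_opens (X : set points) : set (set points) :=
  [set U | exists2 Z, proj_closed Z & U = X `\` Z].

Definition proj_frac (V : set points) : set (points -> C) :=
  [set f | exists (k : nat) (F G : {mpoly C[n.+1]}),
     [/\ F \is k.-homog, G \is k.-homog & forall L, V L ->
       G.@[hcoord L] != 0 /\ f L = F.@[hcoord L] / G.@[hcoord L]]].

Definition proj_variety (X : set points) : space C :=
  Space X (proj_opens X) (locally (proj_opens X) proj_frac).

Definition vanishes (X : set points) (F : {mpoly C[n.+1]}) : Prop :=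
  forall L, X L -> F.@[hcoord L] = 0.

(* The degree k part of the homogeneous coordinate ring of X has dimension m: *)
(* the family e is a basis of it.                                             *)
Definition hilbert_function (X : set points) (k m : nat) : Prop :=
  exists e : 'I_m -> {mpoly C[n.+1]},
    (forall i, e i \is k.-homog) /\
    forall F, F \is k.-homog ->
      exists! c : 'rV[C]_m, vanishes X (F - \sum_(i < m) c 0 i *: e i).

Definition hilbert_polynomial (X : set points) (P : {poly rat}) : Prop :=
  exists k0, forall k, (k0 <= k)%N ->
    exists2 m, hilbert_function X k m & P.[k%:R] = m%:R.

Definition dimension_degree (X : set points) (r D : nat) : Prop :=
  exists P, [/\ hilbert_polynomial X P, size P = r.+1
              & D%:R = r`!%:R * lead_coef P].

End Projective.

(* The top row of A, which consists of ones, does not enter the map.          *)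
Definition monomial_map (C : fieldType) (r n : nat)
    (A : 'M[int]_(1 + r, n.+1)) (t : 'rV[C]_r) : 'rV[C]_n.+1 :=
  \row_j \prod_(i < r) t 0 i ^ dsubmx A i j.

Definition toric_variety (C : fieldType) (r n : nat)
    (A : 'M[int]_(1 + r, n.+1)) : set {vspace 'rV[C]_n.+1} :=
  proj_closure [set <[monomial_map A t]>%VS |
                t in [set t : 'rV[C]_r | forall i, t 0 i != 0]].

Arguments toric_variety C {r n} A.

(* The projection keeping the coordinates s 0, ..., s n, in this order.       *)
Definition coord_projection (C : fieldType) (m n : nat)
    (s : 'I_n.+1 -> 'I_m.+1) (L : {vspace 'rV[C]_m.+1}) :
    {vspace 'rV[C]_n.+1} :=
  (linfun (colsub s : 'rV[C]_m.+1 -> 'rV[C]_n.+1) @: L)%VS.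

Definition convex_hull (R : realType) (m n : nat) (A : 'M[R]_(m, n)) :
    set 'cV[R]_m :=
  [set \sum_j l 0 j *: col j A |
   l in [set l : 'rV[R]_n | (forall j, 0 <= l 0 j) /\ \sum_j l 0 j = 1]].

Definition osc_points (d : nat) : 'M[int]_(2, d.+1) :=
  \matrix_(i, j) (if i == 0 then j%:Z else 'C(j, 2)%:Z).

Definition osc_matrix (d : nat) : 'M[int]_(1 + 2, d.+1) :=
  col_mx (const_mx 1) (osc_points d).

Definition osc_polygon (R : realType) (d : nat) : set 'cV[R]_2 :=
  convex_hull (map_mx intr (osc_points d)).

(* The columns of B are the vectors (1, b), each taken once, with b running   *)
(* over the lattice points of the polygon; their order is irrelevant.         *)
Definition lattice_point_matrix (R : realType) (d N : nat)
    (B : 'M[int]_(1 + 2, N.+1)) : Prop :=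
  injective (fun j => col j B) /\
  range (fun j => col j B) =
    [set col_mx (const_mx 1) b | b in
       [set b : 'cV[int]_2 | osc_polygon d (map_mx intr b : 'cV[R]_2)]].

(* Main.v *)
(** The Hilbert function of the toric surface of a matrix at [k] is the number of
    points of the [k]-fold sumset of its columns.  For the points [(j, 'C(j, 2))]
    the cone over the polygon is cut into simplicial cones of indices
    ['C(j.+1, 2)], and in each coset of the corresponding lattices the sumsets form
    a nonempty up-closed subset of [nat ^ 3], which has [k ^ 2 / 2 + O(k)] points of
    degree [k], eventually a polynomial in [k]; the indices add up to ['C(d.+1, 3)].

    For the surface of all lattice points of the polygon, every lattice point of
    the [k]-fold dilate is a sum of [k] lattice points of the polygon.  Hence a
    quotient of forms integral over a local ring, which is a polynomial because
    [C[x, y]] is integrally closed, comes from a form, because its Newton polygon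
    satisfies the inequalities of the edges; this gives normality.  In the same way
    a function regular on a standard chart is seen to be a form divided by a power
    of the coordinate, without the Nullstellensatz.  A multiple of each lattice
    point of the polygon is a sum of points [(j, 'C(j, 2))], which gives finiteness
    of the projection; surjectivity is checked face by face, and the projection is
    an isomorphism of the dense tori because (0, 0), (1, 0), (2, 1) are among the
    points kept. *)

Require Import Defs.
From HB Require Import structures.
From mathcomp Require Import all_boot all_order all_algebra.
From mathcomp Require Import classical_sets reals complex mpoly.
From mathcomp Require Import boolp zify ring lra.

Set Implicit Arguments.
Unset Strict Implicit.
Unset Printing Implicit Defensive.

Import Order.TTheory GRing.Theory Num.Theory.
Local Open Scope classical_set_scope.
Local Open Scope ring_scope.

(** * Growth of up-closed sets *)

Section Counting.
Local Open Scope nat_scope.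

(** For [d >= 3] the points [(j, 'C(j, 2))] omit lattice points of their polygon, [(1, 1)] for
    instance, so the Hilbert function is not a lattice point count of dilates. What remains
    available is monotonicity: adding a column stays inside the sumsets. Hence the triangles are
    chosen with all vertices among the columns. The [j]-th one has twice the area [j 'C(j.+1, 2) -
    (j + 1) 'C(j, 2) = 'C(j.+1, 2)], the number of cosets, and the gaps of the sumsets affect only
    the linear term. The leading coefficient is half the number of cosets, and [2!] in the degree
    removes the half. Each edge of the polygon gives a monomial valuation of [C[x, y]], and lying in
    a dilate means bounding all these valuations. Normality and the chart functions then follow from
    additivity of valuations under products. The upper edge is the one edge whose interior may
    contain lattice points: only its endpoints are columns. It causes the parity case in the
    splitting of dilates and the root extraction in the surjectivity proof. *)

Definition ev_quadratic (l : rat) (f : nat -> nat) : Prop :=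
  exists (a b : rat) (k0 : nat), forall k, k0 <= k ->
    (f k)%:R = (l * k%:R ^+ 2 + a * k%:R + b)%R.

Lemma eq_ev_quadratic (l : rat) (f g : nat -> nat) :
  f =1 g -> ev_quadratic l f -> ev_quadratic l g.
Proof.
move=> fg [a [b [k0 h]]]; exists a, b, k0 => k hk; rewrite -fg; exact: h.
Qed.

Lemma ev_quadratic0 : ev_quadratic 0 (fun=> 0).
Proof. by exists 0%R, 0%R, 0 => k _; rewrite !mul0r !addr0. Qed.

Lemma ev_quadraticD (l m : rat) (f g : nat -> nat) :
  ev_quadratic l f -> ev_quadratic m g ->
  ev_quadratic (l + m)%R (fun k => f k + g k).
Proof.
move=> [a [b [k0 h]]] [a' [b' [k1 h']]].
exists (a + a')%R, (b + b')%R, (maxn k0 k1) => k; rewrite geq_max => /andP[? ?].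
by rewrite natrD h // h' //; ring.
Qed.

Lemma ev_quadratic_sum (I : Type) (s : seq I) (l : I -> rat)
    (f : I -> nat -> nat) :
  (forall i, ev_quadratic (l i) (f i)) ->
  ev_quadratic (\sum_(i <- s) l i)%R (fun k => \sum_(i <- s) f i k).
Proof.
move=> h; elim: s => [|i s IH].
  by rewrite big_nil; apply: eq_ev_quadratic ev_quadratic0 => k; rewrite big_nil.
rewrite big_cons; apply: eq_ev_quadratic (ev_quadraticD (h i) IH) => k.
by rewrite big_cons.
Qed.

Lemma ev_quadraticS (l : rat) (f : nat -> nat) :
  ev_quadratic l (fun k => f k.+1) -> ev_quadratic l f.
Proof.
move=> [a [b [k0 h]]].
exists (a - 2 * l)%R, (l - a + b)%R, k0.+1 => -[//|k] hk.
by rewrite h // -natr1; ring.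
Qed.

Lemma ev_quadratic_upset (e : nat -> bool) :
  (forall k, e k -> e k.+1) -> ev_quadratic 0 e.
Proof.
move=> up; have upD k m : e k -> e (k + m).
  by move=> ek; elim: m => [|m IH]; rewrite ?addn0 // addnS up.
have [[k0 ek0]|ne] := pselect (exists k, e k).
  exists 0%R, 1%R, k0 => k hk.
  by rewrite -(subnKC hk) upD // !mul0r !add0r.
apply: eq_ev_quadratic ev_quadratic0 => k.
by case ek: (e k) => //; case: ne; exists k.
Qed.

Definition count2 (E : nat -> nat -> bool) (k : nat) : nat :=
  \sum_(i < k.+1) E i (k - i).

(** The last coordinate is what remains of the total [k], so this counts the triples of [E] in
    degree [k]. *)
Definition count3 (E : nat -> nat -> nat -> bool) (k : nat) : nat :=
  \sum_(i < k.+1) count2 (E i) (k - i).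

Lemma count2_peel (E : nat -> nat -> bool) (k : nat) :
  count2 E k.+1 = E 0 k.+1 + count2 (fun i => E i.+1) k.
Proof.
rewrite /count2 big_ord_recl subn0.
by congr (_ + _); apply: eq_bigr => i _; rewrite /bump /= add1n subSS.
Qed.

Lemma count2_peel2 (E : nat -> nat -> bool) (k : nat) :
  count2 E k.+1 = E k.+1 0 + count2 (fun i j => E i j.+1) k.
Proof.
rewrite /count2 big_ord_recr /= subnn addnC; congr (_ + _).
by apply: eq_bigr => i _; rewrite subSn // -ltnS.
Qed.

(** Descent on the coordinates of a point of [E]: removing the row [i = 0] or [j = 0], itself an
    up-closed set of dimension one, shifts the point towards the origin. A set containing the origin
    is everything. *)
Lemma ev_quadratic_count2 (E : nat -> nat -> bool) :
  (forall i j, E i j -> E i.+1 j) -> (forall i j, E i j -> E i j.+1) ->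
  ev_quadratic 0 (count2 E).
Proof.
move=> up1 up2; have [[i [j Eij]]|ne] := pselect (exists i j, E i j); last first.
  apply: eq_ev_quadratic ev_quadratic0 => k.
  rewrite /count2 big1 // => i _; case Ei: (E _ _) => //.
  by case: ne; exists i, (k - i).
elim: i => [|i IH] in E up1 up2 Eij *.
  elim: j => [|j IH] in E up1 up2 Eij *.
    have Eall i j : E i j.
      by elim: i => [|i]; [elim: j => [|j]; [|exact: up2]|exact: up1].
    exists 1%R, 1%R, 0 => k _; rewrite /count2.
    under eq_bigr do rewrite Eall.
    by rewrite sum_nat_const card_ord muln1 -natr1; ring.
  apply: ev_quadraticS; rewrite -(addr0 0%R).
  apply: eq_ev_quadratic (fun k => esym (count2_peel2 _ k)) _.
  apply: ev_quadraticD; first by apply: ev_quadratic_upset => k; apply: up1.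
  by apply: IH => // *; [exact: up1|exact: up2].
apply: ev_quadraticS; rewrite -(addr0 0%R).
apply: eq_ev_quadratic (fun k => esym (count2_peel _ k)) _.
apply: ev_quadraticD; first by apply: ev_quadratic_upset => k; apply: up2.
by apply: IH => // *; [exact: up1|exact: up2].
Qed.

Lemma count3_peel1 (E : nat -> nat -> nat -> bool) (k : nat) :
  count3 E k.+1 = count2 (E 0) k.+1 + count3 (fun i => E i.+1) k.
Proof.
rewrite /count3 big_ord_recl subn0.
by congr (_ + _); apply: eq_bigr => i _; rewrite /bump /= add1n subSS.
Qed.

Lemma count3_peel2 (E : nat -> nat -> nat -> bool) (k : nat) :
  count3 E k.+1 =
  count2 (fun i => E i 0) k.+1 + count3 (fun i j => E i j.+1) k.
Proof.
rewrite /count3 /count2 big_ord_recr [in RHS]big_ord_recr /= subnn.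
rewrite big_ord1 addnAC; congr (_ + _).
rewrite -big_split; apply: eq_bigr => i _ /=.
have hi : i <= k by rewrite -ltnS.
rewrite subSn // big_ord_recl subn0.
by congr (_ + _); apply: eq_bigr => j _; rewrite /bump /= add1n subSS.
Qed.

Lemma count3_peel3 (E : nat -> nat -> nat -> bool) (k : nat) :
  count3 E k.+1 =
  count2 (fun i j => E i j 0) k.+1 + count3 (fun i j l => E i j l.+1) k.
Proof.
rewrite /count3 /count2 big_ord_recr [in RHS]big_ord_recr /= subnn.
rewrite big_ord1 addnAC; congr (_ + _).
rewrite -big_split; apply: eq_bigr => i _ /=.
have hi : i <= k by rewrite -ltnS.
rewrite subSn // big_ord_recr /= subnn addnC; congr (_ + _).
by apply: eq_bigr => j _; rewrite subSn // -ltnS.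
Qed.

(** The same descent one dimension higher: each removed slice is eventually affine in [k], so the
    quadratic coefficient is that of the whole of [nat ^ 3]. *)
Lemma ev_quadratic_count3 (E : nat -> nat -> nat -> bool) :
  (forall i j l, E i j l -> E i.+1 j l) ->
  (forall i j l, E i j l -> E i j.+1 l) ->
  (forall i j l, E i j l -> E i j l.+1) ->
  (exists i j l, E i j l) ->
  ev_quadratic (1 / 2%:R)%R (count3 E).
Proof.
move=> up1 up2 up3 [i [j [l Eijl]]].
elim: i => [|i IH] in E up1 up2 up3 Eijl *.
  elim: j => [|j IH] in E up1 up2 up3 Eijl *.
    elim: l => [|l IH] in E up1 up2 up3 Eijl *.
      have Eall i j l : E i j l.
        elim: i => [|i]; last exact: up1.
        by elim: j => [|j]; [elim: l => [|l]; [|exact: up3]|exact: up2].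
      (* All triples of total [k] number ['C(k + 2, 2) = k ^ 2 / 2 + 3 k / 2 + 1]. *)
      exists (3%:R / 2%:R)%R, 1%R, 0 => k _.
      have c2 m k' : count2 (E m) k' = k'.+1.
        rewrite /count2; under eq_bigr do rewrite Eall.
        by rewrite sum_nat_const card_ord muln1.
      elim: k => [|k IH]; first by rewrite /count3 big_ord_recl big_ord0 c2.
      rewrite count3_peel1 c2 natrD.
      have -> : count3 (fun i0 : nat => E i0.+1) k = count3 E k.
        apply: eq_bigr => i' _; rewrite /count2.
        by apply: eq_bigr => ? _; rewrite !Eall.
      by rewrite IH -!natr1; field.
    apply: ev_quadraticS; rewrite -(add0r (1 / 2%:R)%R).
    apply: eq_ev_quadratic (fun k => esym (count3_peel3 _ k)) _.
    apply: ev_quadraticD; last first.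
      by apply: IH => // *; [exact: up1|exact: up2|exact: up3].
    have [a [b [k0 h]]] : ev_quadratic 0 (count2 (fun i j => E i j 0)).
      by apply: ev_quadratic_count2 => *; [exact: up1|exact: up2].
    exists a, (a + b)%R, k0 => k hk; rewrite h; last exact: leqW.
    by rewrite -natr1; ring.
  apply: ev_quadraticS; rewrite -(add0r (1 / 2%:R)%R).
  apply: eq_ev_quadratic (fun k => esym (count3_peel2 _ k)) _.
  apply: ev_quadraticD; last first.
    by apply: IH => // *; [exact: up1|exact: up2|exact: up3].
  have [a [b [k0 h]]] : ev_quadratic 0 (count2 (fun i => E i 0)).
    by apply: ev_quadratic_count2 => *; [exact: up1|exact: up3].
  exists a, (a + b)%R, k0 => k hk; rewrite h; last exact: leqW.
  by rewrite -natr1; ring.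
apply: ev_quadraticS; rewrite -(add0r (1 / 2%:R)%R).
apply: eq_ev_quadratic (fun k => esym (count3_peel1 _ k)) _.
apply: ev_quadraticD; last first.
  by apply: IH => // *; [exact: up1|exact: up2|exact: up3].
have [a [b [k0 h]]] : ev_quadratic 0 (count2 (E 0)).
  by apply: ev_quadratic_count2 => *; [exact: up2|exact: up3].
exists a, (a + b)%R, k0 => k hk; rewrite h; last exact: leqW.
by rewrite -natr1; ring.
Qed.

End Counting.

(** * Sumsets of the points (j, binomial(j, 2)) *)

Section Sumset.
Local Open Scope nat_scope.

(** Repetitions are removed because the size is to be the Hilbert function at [k]. *)
Fixpoint sumset (s : seq (nat * nat)) (k : nat) : seq (nat * nat) :=
  if k is k'.+1 then
    undup [seq (p.1 + q.1, p.2 + q.2) | p <- s, q <- sumset s k']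
  else [:: (0, 0)].

Lemma sumset_uniq (s : seq (nat * nat)) (k : nat) : uniq (sumset s k).
Proof. by case: k => [|k] //=; exact: undup_uniq. Qed.

Lemma sumsetS (s : seq (nat * nat)) (k a b a' b' : nat) :
  (a, b) \in s -> (a', b') \in sumset s k ->
  (a + a', b + b') \in sumset s k.+1.
Proof.
move=> hs hk; rewrite /= mem_undup.
by apply/allpairsP; exists ((a, b), (a', b')).
Qed.

Lemma sumsetSE (s : seq (nat * nat)) (k : nat) (w : nat * nat) :
  w \in sumset s k.+1 ->
  exists p q, [/\ p \in s, q \in sumset s k & w = (p.1 + q.1, p.2 + q.2)].
Proof.
by rewrite /= mem_undup => /allpairsP[[p q] [? ? ->]]; exists p, q.
Qed.

Lemma sumsetD (s : seq (nat * nat)) (k l a b a' b' : nat) :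
  (a, b) \in sumset s k -> (a', b') \in sumset s l ->
  (a + a', b + b') \in sumset s (k + l).
Proof.
elim: k a b => [|k IH] a b; first by rewrite inE => /eqP[-> ->].
move/sumsetSE => [[c e] [[c' e'] [hc hk [-> ->]]]] hl.
by rewrite -!addnA addSn; apply: sumsetS hc (IH _ _ hk hl).
Qed.

Lemma sumsetMl (s : seq (nat * nat)) (n k a b a' b' : nat) :
  (a, b) \in s -> (a', b') \in sumset s k ->
  (n * a + a', n * b + b') \in sumset s (n + k).
Proof.
move=> hs hk; elim: n => [|n IH]; first by rewrite !mul0n !add0n.
by rewrite !mulSn -!addnA; apply: sumsetS.
Qed.

Definition oscs (d : nat) : seq (nat * nat) := [seq (j, 'C(j, 2)) | j <- iota 0 d.+1].

Lemma oscsP (d a b : nat) : reflect (a <= d /\ b = 'C(a, 2)) ((a, b) \in oscs d).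
Proof.
apply: (iffP mapP) => [[j] | [ad ->]].
  by rewrite mem_iota /= ltnS => jd [-> ->].
by exists a => //; rewrite mem_iota /= ltnS.
Qed.

Lemma double_bin2 (j : nat) : 2 * 'C(j, 2) = j * j.-1.
Proof. by rewrite bin2 mul2n even_halfK // oddM; case: j => //= j; case: odd. Qed.

Lemma double_bin2S (j : nat) : 2 * 'C(j.+1, 2) = j * j.+1.
Proof. by rewrite double_bin2 mulnC. Qed.

Lemma sumset_top (d k a b : nat) :
  (a, b) \in sumset (oscs d) k -> 2 * b <= a * d.-1.
Proof.
elim: k a b => [|k IH] a b; first by rewrite inE => /eqP[-> ->].
move/sumsetSE => [[i c] [[a' b'] [/oscsP[id ->] /IH /= h [-> ->]]]].
rewrite mulnDr mulnDl leq_add // double_bin2 leq_mul2l.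
by case: i d id {h IH} => [|i] [|d].
Qed.

(** The difference of the two sides is [(i - j) (i - j - 1)], a product of consecutive integers. It
    makes the line through the points [j] and [j + 1] a supporting line of all the points. *)
Lemma consec_square (i j : nat) : 2 * j * i <= i * i.-1 + j * j.+1.
Proof.
case: i => [|i]; first by rewrite muln0.
rewrite /=; case: (leqP i.+1 j) => h1.
  by rewrite -(subnKC h1); move: (j - i.+1) => t; nia.
by rewrite -(subnKC (ltnSE h1)); move: (i - j) => t; nia.
Qed.

Lemma sumset_edge (d k a b j : nat) :
  (a, b) \in sumset (oscs d) k -> 2 * j * a <= 2 * b + k * (j * j.+1).
Proof.
elim: k a b => [|k IH] a b; first by rewrite inE => /eqP[-> ->]; rewrite muln0.
move/sumsetSE => [[i c] [[a' b'] [/oscsP[id ->] /IH /= h [-> ->]]]].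
have := consec_square i j; rewrite -double_bin2.
by rewrite mulnDr mulnDr mulSn; lia.
Qed.

(* The cone over the polygon is cut from the vertex [(0, 0)] into the cones
   spanned by [(0, 0)], [(j, 'C(j, 2))] and [(j.+1, 'C(j.+1, 2))]; [piece] says
   which one contains [w], the common rays being attributed to one of them. *)
Definition piece (d : nat) (w : nat * nat) : nat :=
  if 2 * w.2 < w.1 * d.-1 then (2 * w.2 %/ w.1).+1 else d.-1.

(** On the ray of [(j, 'C(j, 2))] the ratio [2 b / a] is [j - 1], so its integer part selects the
    piece. The last piece also keeps its upper ray, and the origin with it. *)
Lemma pieceE (d a b j : nat) : 0 < j < d -> 2 * b <= a * d.-1 ->
  (piece d (a, b) == j) =
  [&& a * j.-1 <= 2 * b, 2 * b <= a * j & (2 * b < a * j) || (j == d.-1)].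
Proof.
move=> /andP[j0 jd] top; rewrite /piece /=; case: ltnP => h.
  have a0 : 0 < a by rewrite lt0n; apply: contraTneq h => ->.
  have := leq_divRL j.-1 (2 * b) a0; have := ltn_divLR (2 * b) j a0.
  rewrite [j * a]mulnC [j.-1 * a]mulnC; move: (2 * b %/ a) => q e1 e2.
  apply/eqP/and3P => [qj | [p1 p2 /orP[p3 | /eqP ej]]].
  - have lt : 2 * b < a * j by rewrite -e1 qj.
    by rewrite -e2 lt (ltnW lt) -qj.
  - by move: p1 p3; rewrite -e1 -e2; lia.
  - by move: h p1; rewrite -ej -e1 -e2; lia.
have E : 2 * b = a * d.-1 by apply/eqP; rewrite eqn_leq top.
rewrite E; have [<-|ne] := eqVneq d.-1 j; first by rewrite orbT leqnn leq_mul2l leq_pred orbT.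
apply/esym/negbTE/and3P => -[_ _]; rewrite orbF => h2.
move: h2; rewrite ltn_mul2l => /andP[_]; move: jd; case: (d) => // d' h2 h3.
by move: (leq_trans h2 h3); rewrite ltnn.
Qed.

Lemma mem_iota0 (q n : nat) : (q \in iota 0 n.+1) = (q <= n).
Proof. by rewrite mem_iota. Qed.

(* In the [j]-th piece the point [(a, b)] has barycentric coordinates [x / j] and
   [y / j.+1], where [x = a j - 2 b] and [y = 2 b - a (j - 1)]; the next
   definitions recover [x], [y], [a], [2 b] from the quotients [q1], [q2] and the
   remainders [r1], [r2] of [x] and [y]. *)
Definition cone_x (j r q : nat) := q * j + r.
Definition cone_y (j r q : nat) := q * j.+1 + r.
Definition cone_a (j r1 r2 q1 q2 : nat) := cone_x j r1 q1 + cone_y j r2 q2.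
Definition cone_2b (j r1 r2 q1 q2 : nat) :=
  cone_y j r2 q2 + cone_a j r1 r2 q1 q2 * j.-1.

(** One coset as a subset of [nat ^ 3]: incrementing [q1], [q2], [q0] adds [(j, 'C(j, 2))],
    [(j.+1, 'C(j.+1, 2))], [(0, 0)]. Evenness makes [b] an integer; the middle condition drops the
    ray shared with the next piece. *)
Definition cone_set (d j r1 r2 q1 q2 q0 : nat) : bool :=
  [&& ~~ odd (cone_2b j r1 r2 q1 q2), (0 < cone_x j r1 q1) || (j == d.-1)
    & (cone_a j r1 r2 q1 q2, (cone_2b j r1 r2 q1 q2)./2)
        \in sumset (oscs d) (q1 + q2 + q0)].

Definition residue1 (j : nat) (w : nat * nat) := (w.1 * j - 2 * w.2) %% j.
Definition residue2 (j : nat) (w : nat * nat) := (2 * w.2 - w.1 * j.-1) %% j.+1.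

Lemma count3_cone_set (d j r1 r2 k : nat) :
  0 < j < d -> r1 < j -> r2 < j.+1 ->
  count3 (cone_set d j r1 r2) k =
  \sum_(w <- sumset (oscs d) k |
         [&& piece d w == j, residue1 j w == r1 & residue2 j w == r2]) 1.
Proof.
move=> /andP[j0 jd] hr1 hr2.
rewrite sum1_count -size_filter.
pose L := [seq (cone_a j r1 r2 q1 q2, (cone_2b j r1 r2 q1 q2)./2) |
  q1 <- iota 0 k.+1,
  q2 <- [seq q <- iota 0 (k - q1).+1 | cone_set d j r1 r2 q1 q (k - q1 - q)]].
have -> : count3 (cone_set d j r1 r2) k = size L.
  rewrite size_allpairs_dep sumnE big_map -[iota 0 k.+1]/(index_iota 0 k.+1).
  rewrite big_mkord; apply: eq_bigr => q1 _.
  rewrite size_filter -sum1_count -[iota 0 (k - q1).+1]/(index_iota 0 (k - q1).+1) big_mkord.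
  by rewrite big_mkcond; apply: eq_bigr => q2 _; case: cone_set.
apply/perm_size/uniq_perm; last 2 first.
- exact/filter_uniq/sumset_uniq.
- case=> a b; rewrite mem_filter; apply/allpairsPdep/idP.
    move=> [q1 [q2 []]]; rewrite mem_iota0 => q1k.
    rewrite mem_filter mem_iota0 => /andP[/and3P[ev hx hm] q2k] [ea eb].
    have ek : q1 + q2 + (k - q1 - q2) = k by lia.
    rewrite ek -ea -eb in hm; rewrite hm andbT pieceE ?j0 //; last exact: sumset_top hm.
    have e2b : 2 * b = cone_2b j r1 r2 q1 q2 by rewrite eb mul2n even_halfK.
    rewrite /residue1 /residue2 /= e2b ea.
    have ex : cone_a j r1 r2 q1 q2 * j - cone_2b j r1 r2 q1 q2 = cone_x j r1 q1.
      by rewrite /cone_2b /cone_a; case: (j) j0 => //= j' _; rewrite mulnS; lia.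
    have ey : cone_2b j r1 r2 q1 q2 - cone_a j r1 r2 q1 q2 * j.-1 = cone_y j r2 q2.
      by rewrite addnK.
    rewrite ex ey /cone_x /cone_y !modnMDl !modn_small // !eqxx !andbT.
    have e : cone_a j r1 r2 q1 q2 * j = cone_2b j r1 r2 q1 q2 + cone_x j r1 q1.
      by rewrite /cone_2b /cone_a; case: (j) j0 => //= j' _; rewrite mulnS; lia.
    by rewrite e leq_addr /cone_2b leq_addl -[X in X < _]addn0 ltn_add2l hx.
  case/andP=> /and3P[hp /eqP h1 /eqP h2] hm.
  move: hp; rewrite pieceE ?j0 //; last exact: sumset_top hm.
  move=> /and3P[p1 p2 p3].
  rewrite /residue1 /residue2 /= in h1 h2.
  set x := a * j - 2 * b in h1; set y := 2 * b - a * j.-1 in h2.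
  have ex : cone_x j r1 (x %/ j) = x by rewrite /cone_x -h1 -divn_eq.
  have ey : cone_y j r2 (y %/ j.+1) = y by rewrite /cone_y -h2 -divn_eq.
  have ajE : a * j = a * j.-1 + a by case: (j) j0 => //= ? _; rewrite mulnS addnC.
  have ea : cone_a j r1 r2 (x %/ j) (y %/ j.+1) = a.
    by rewrite /cone_a ex ey /x /y; lia.
  have eb : cone_2b j r1 r2 (x %/ j) (y %/ j.+1) = 2 * b.
    by rewrite /cone_2b ea ey /y; lia.
  (* The inequality of the edge from [j] to [j.+1] says [x / j + y / j.+1 <= k]; this leaves a
     nonnegative [q0]. *)
  have hq : x %/ j + y %/ j.+1 <= k.
    have := sumset_edge j hm; have xj := leq_trunc_div x j; have yj := leq_trunc_div y j.+1.
    move: (x %/ j) (y %/ j.+1) xj yj => q1 q2 xj yj he.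
    have : (q1 + q2) * (j * j.+1) <= k * (j * j.+1).
      have hx : x + 2 * b = a * j by rewrite /x subnK.
      have hy : y + a * j.-1 = 2 * b by rewrite /y subnK.
      have := leq_mul xj (leqnn j.+1); have := leq_mul yj (leqnn j).
      have hxy : x + y = a by lia.
      have exy : x * j.+1 + y * j + 2 * b = 2 * j * a.
        have : (x + y) * j + (x + 2 * b) = a * j + a * j by rewrite hxy hx.
        by lia.
      lia.
    by rewrite leq_pmul2r // muln_gt0 j0.
  exists (x %/ j), (y %/ j.+1); split; rewrite ?ea ?eb ?mul2n ?doubleK //.
    by rewrite mem_iota0; apply: leq_trans hq; exact: leq_addr.
  rewrite mem_filter mem_iota0 leq_subRL; last first.
    by apply: leq_trans hq; exact: leq_addr.
  rewrite hq andbT /cone_set ea eb ex mul2n odd_double doubleK /=.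
  rewrite -subnDA subnKC // hm andbT.
  by case/orP: p3 => [p3|->]; rewrite ?orbT // /x subn_gt0 p3.
apply: allpairs_uniq_dep.
- exact: iota_uniq.
- by move=> q1 _; exact/filter_uniq/iota_uniq.
move=> z z' /allpairsPdep[u [v [_ hv ->]]] /allpairsPdep[u' [v' [_ hv' ->]]].
move: hv hv'; rewrite !mem_filter => /andP[/and3P[ev _ _] _] /andP[/and3P[ev' _ _] _].
move=> [ea eb].
have {}eb : cone_2b j r1 r2 u v = cone_2b j r1 r2 u' v'.
  by rewrite -(even_halfK ev) -(even_halfK ev') eb.
have ey : cone_y j r2 v = cone_y j r2 v' by move: eb; rewrite /cone_2b ea => /addIn.
have ex : cone_x j r1 u = cone_x j r1 u' by move: ea; rewrite /cone_a ey => /addIn.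
move: ex ey => /addIn/eqP; rewrite eqn_pmul2r // => /eqP ->.
by move=> /addIn/eqP; rewrite eqn_pmul2r // => /eqP ->.
Qed.

End Sumset.

(** * Cosets of the simplicial cones and growth of the sumsets *)

Section SumsetGrowth.
Local Open Scope nat_scope.

Lemma sumset0 (d k : nat) : (0, 0) \in sumset (oscs d) k.
Proof.
by elim: k => [|k IH] //; apply: (@sumsetS _ _ 0 0 0 0).
Qed.

Lemma sumset_pad (d m k a b : nat) :
  (a, b) \in sumset (oscs d) k -> (a, b) \in sumset (oscs d) (m + k).
Proof.
by move=> h; have := @sumsetMl (oscs d) m k 0 0 a b isT h; rewrite !muln0.
Qed.

Lemma mem_pair (s : seq (nat * nat)) (a b a' b' : nat) :
  (a, b) \in s -> a = a' -> b = b' -> (a', b') \in s.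
Proof. by move=> h <- <-. Qed.

(** The parity of [2 b = y + a (j - 1)] with [a = x + y] is that of [y], hence of [r2], for odd [j],
    and that of [x], hence of [r1], for even [j]. So integrality of [b] depends on the coset only,
    and half of the [j (j + 1)] residue pairs are good. *)
Definition good_residue (j r1 r2 : nat) : bool :=
  if odd j then ~~ odd r2 else ~~ odd r1.

Lemma odd_cone_2b (j r1 r2 q1 q2 : nat) : 0 < j ->
  odd (cone_2b j r1 r2 q1 q2) = ~~ good_residue j r1 r2.
Proof.
move=> j0; rewrite /cone_2b /cone_a /cone_x /cone_y /good_residue.
case: j j0 => // j _; rewrite /= !(oddD, oddM) /=.
by do ![case: (odd _) => //=].
Qed.

Lemma cone_set_up (d j r1 r2 q1 q2 q0 : nat) : 0 < j < d ->
  cone_set d j r1 r2 q1 q2 q0 ->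
  [/\ cone_set d j r1 r2 q1.+1 q2 q0, cone_set d j r1 r2 q1 q2.+1 q0
    & cone_set d j r1 r2 q1 q2 q0.+1].
Proof.
move=> /andP[j0 jd] /and3P[ev hx hm].
have gr : good_residue j r1 r2 by move: ev; rewrite odd_cone_2b // negbK.
have ev' q q' : ~~ odd (cone_2b j r1 r2 q q') by rewrite odd_cone_2b // negbK.
have half q q' : (cone_2b j r1 r2 q q')./2 * 2 = cone_2b j r1 r2 q q'.
  by rewrite muln2 even_halfK.
split; apply/and3P; split => //.
- by rewrite /cone_x mulSn -addnA addn_gt0 j0.
- have pj : (j, 'C(j, 2)) \in oscs d by apply/oscsP; split => //; exact: ltnW.
  rewrite addSn addSn; apply: mem_pair (sumsetS pj hm) _ _.
    by rewrite /cone_a /cone_x mulSn; lia.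
  apply/eqP; rewrite -(eqn_pmul2r (isT : 0 < 2)) mulnDl !half mulnC double_bin2.
  by apply/eqP; rewrite /cone_2b /cone_a /cone_x mulSn; case: (j) j0 => // i _ /=; nia.
- have pj : (j.+1, 'C(j.+1, 2)) \in oscs d by apply/oscsP; split.
  rewrite addnS addSn; apply: mem_pair (sumsetS pj hm) _ _.
    by rewrite /cone_a /cone_y mulSn; lia.
  apply/eqP; rewrite -(eqn_pmul2r (isT : 0 < 2)) mulnDl !half mulnC double_bin2.
  by apply/eqP; rewrite /cone_2b /cone_a /cone_y mulSn; case: (j) j0 => // i _ /=; nia.
- by rewrite addnS; exact: (@sumset_pad d 1).
Qed.

(** The base point is [(a0 - 2 b0) (1, 0) + b0 (2, 1)], possibly with a negative coefficient. It is
    repaired inside the coset by [(j + 1) (j, 'C(j, 2)) = (j + 1) (1, 0) + (j - 1) (j + 1, 'C(j + 1,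
    2))]. *)
Lemma cone_set_nonempty (d j r1 r2 : nat) : 0 < j < d ->
  good_residue j r1 r2 -> exists q1 q2 q0, cone_set d j r1 r2 q1 q2 q0.
Proof.
move=> /andP[j0 jd] gr.
have half q q' : (cone_2b j r1 r2 q q')./2 * 2 = cone_2b j r1 r2 q q'.
  by rewrite muln2 even_halfK // odd_cone_2b // negbK.
pose a0 := cone_a j r1 r2 0 0; pose b0 := (cone_2b j r1 r2 0 0)./2.
(* Applying the identity [m] times adds [q1] copies of [(1, 0)], more than [2 b0]. [K] counts the
   summands used, and the remaining degree [q1] is filled with [(0, 0)]. *)
pose m := (2 * b0).+1; pose q1 := j.+1 * m.
pose K := (a0 + q1 - 2 * b0) + (b0 + (m * j.-1 + 0)).
exists q1, 0, K; apply/and3P; split.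
- by rewrite odd_cone_2b // negbK.
- by rewrite /cone_x addn_gt0 muln_gt0 j0 /q1 muln_gt0.
have p1 : (1, 0) \in oscs d by apply/oscsP; split=> //; exact: leq_trans jd.
have p2 : (2, 1) \in oscs d by apply/oscsP; split=> //; exact: leq_trans jd.
have pj : (j.+1, 'C(j.+1, 2)) \in oscs d by apply/oscsP; split.
have h0 : (0, 0) \in sumset (oscs d) 0 by [].
rewrite addn0; apply: sumset_pad.
have hb0 : 2 * b0 = cone_2b j r1 r2 0 0 by rewrite mulnC half.
have hle : 2 * b0 <= a0 + q1 by rewrite /q1 /m; nia.
apply: mem_pair (sumsetMl (a0 + q1 - 2 * b0) p1 (sumsetMl b0 p2 (sumsetMl (m * j.-1) pj h0))) _ _.
  have -> : cone_a j r1 r2 q1 0 = a0 + q1 * j.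
    by rewrite /a0 /cone_a /cone_x; lia.
  rewrite muln1 addn0 [b0 * 2]mulnC addnA subnK // -addnA; congr (_ + _).
  by rewrite /q1; case: (j) j0 => // i _ /=; nia.
apply/eqP; rewrite -(eqn_pmul2r (isT : 0 < 2)) half muln0 muln1 addn0 add0n.
rewrite mulnDl [b0 * 2]mulnC hb0 -mulnA ['C(_, 2) * 2]mulnC double_bin2S.
apply/eqP; rewrite /cone_2b /cone_a /cone_x /q1.
by case: (j) j0 => // i _ /=; nia.
Qed.

Lemma sum_even (n : nat) : \sum_(r < n) ~~ odd r = uphalf n.
Proof.
elim: n => [|n IH]; first by rewrite big_ord0.
by rewrite big_ord_recr IH /= uphalf_half addnC addnA addn_negb.
Qed.

Lemma sum_good_residue (j : nat) :
  \sum_(r1 < j) \sum_(r2 < j.+1) good_residue j r1 r2 = 'C(j.+1, 2).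
Proof.
apply/eqP; rewrite -(eqn_pmul2l (isT : 0 < 2)) double_bin2S; apply/eqP.
have := odd_double_half j; rewrite /good_residue; case oj: (odd j); rewrite -muln2 => ej.
  rewrite big_const_ord iter_addn_0 sum_even /=; nia.
under eq_bigr do rewrite big_const_ord iter_addn_0.
rewrite -big_distrl /= sum_even uphalf_half oj; nia.
Qed.

Lemma sum_bin2 (d : nat) : \sum_(j < d) 'C(j.+1, 2) = 'C(d.+1, 3).
Proof.
elim: d => [|d IH]; first by rewrite big_ord0.
by rewrite big_ord_recr IH /= [in RHS]binS.
Qed.

Lemma piece_range (d : nat) (w : nat * nat) : 1 < d -> 0 < piece d w < d.
Proof.
move=> d1; rewrite /piece; case: ifP => h; last by case: d d1 {h} => [|[]] /=.
have w0 : 0 < w.1 by rewrite lt0n; apply: contraTneq h => ->.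
rewrite [w.1 * _]mulnC -ltn_divLR // in h; rewrite /=.
by rewrite -(prednK (ltnW d1)) ltnS.
Qed.

(* Every lattice coset of each cone contributes a nonempty up-closed subset of
   [nat ^ 3], hence a function growing like [k ^ 2 / 2]; the [j]-th cone has
   ['C(j.+1, 2)] cosets. *)
Lemma sumset_growth (d : nat) : 1 < d ->
  ev_quadratic (('C(d.+1, 3))%:R / 2%:R)%R (fun k => size (sumset (oscs d) k)).
Proof.
move=> d1.
(* One finite index type for all [(j, r1, r2)], although the ranges of the residues depend on [j];
   invalid triples contribute 0. *)
pose T := ('I_d.+1 * 'I_d.+1 * 'I_d.+1)%type.
pose valid (c : T) := [&& 0 < c.1.1 < d, c.1.2 < c.1.1 & c.2 < c.1.1.+1].
pose f (c : T) k :=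
  if valid c then count3 (cone_set d c.1.1 c.1.2 c.2) k else 0.
pose l (c : T) : rat :=
  (if valid c && good_residue c.1.1 c.1.2 c.2 then 1 / 2%:R else 0)%R.
have hf c : ev_quadratic (l c) (f c).
  rewrite /l /f; case hv: (valid c) => /=; last exact: ev_quadratic0.
  have /and3P[hj h1 h2] := hv.
  case: ifP => gr.
    apply: ev_quadratic_count3; first by move=> ? ? ? /(cone_set_up hj)[].
    - by move=> ? ? ? /(cone_set_up hj)[].
    - by move=> ? ? ? /(cone_set_up hj)[].
    - exact: cone_set_nonempty.
  apply: eq_ev_quadratic ev_quadratic0 => k.
  rewrite /count3 big1 // => i _; rewrite /count2 big1 // => i' _.
  rewrite /cone_set odd_cone_2b ?gr //=.
  by case/andP: hj.
have -> : (('C(d.+1, 3))%:R / 2%:R = \sum_c l c)%R.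
  have e1 (c : T) : (l c = (1 / 2%:R) * (valid c && good_residue c.1.1 c.1.2 c.2)%:R)%R.
    by rewrite /l; case: ifP; rewrite ?mulr1 ?mulr0.
  rewrite (eq_bigr _ (fun c _ => e1 c)) -big_distrr /= mul1r mulrC; congr (_ * _)%R.
  rewrite -natr_sum; congr (_%:R)%R.
  rewrite -(pair_bigA _ (fun u v => nat_of_bool
    (valid (u, v) && good_residue u.1 u.2 v))) /=.
  rewrite -(pair_bigA _ (fun j r1 => \sum_(r2 < d.+1) nat_of_bool
    (valid (j, r1, r2) && good_residue j r1 r2))) /=.
  rewrite -sum_bin2; transitivity (\sum_(j < d.+1) if 0 < j < d then 'C(j.+1, 2) else 0).
    rewrite big_ord_recr /= ltnn andbF addn0; apply: eq_bigr => j _.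
    by rewrite ltn_ord andbT; case: (nat_of_ord j).
  apply: eq_bigr => j _; rewrite /valid /=; case: ifP => hj; last first.
    by rewrite big1 // => r1 _; rewrite big1.
  have jd : j <= d.+1 by exact: ltnW.
  have jd' : j.+1 <= d.+1 by [].
  rewrite -sum_good_residue (big_ord_widen _ (fun r1 => \sum_(r2 < j.+1)
    nat_of_bool (good_residue j r1 r2)) jd) big_mkcond; apply: eq_bigr => r1 _.
  case: (r1 < j) => /=; last by rewrite big1.
  rewrite (big_ord_widen _ (fun r2 => nat_of_bool (good_residue j r1 r2)) jd').
  by rewrite big_mkcond; apply: eq_bigr => r2 _; case: (r2 < j.+1).
apply: eq_ev_quadratic (ev_quadratic_sum _ hf) => k.
pose code (w : nat * nat) : T :=
  (inord (piece d w), inord (residue1 (piece d w) w),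
   inord (residue2 (piece d w) w)).
rewrite -sum1_size (partition_big code xpredT) //=.
have hcode (w : nat * nat) :
    [/\ (code w).1.1 = piece d w :> nat,
        (code w).1.2 = residue1 (piece d w) w :> nat
      & (code w).2 = residue2 (piece d w) w :> nat].
  have /andP[p0 pd] := piece_range w d1.
  split; rewrite inordK // ltnS; first exact: ltnW.
    by apply: leq_trans (ltnW pd); apply: ltnW; rewrite /residue1 /residue2 ltn_mod.
  by apply: leq_trans pd; apply: ltnW; rewrite /residue1 /residue2 ltn_mod.
apply: eq_bigr => c _; rewrite /f; case: ifP => [/and3P[hj h1 h2] | hv].
  rewrite count3_cone_set //; apply: eq_bigl => w; have [e1 e2 e3] := hcode w.
  case: c hj h1 h2 => [[j r1] r2] /= hj h1 h2.
  rewrite -[code w == _]/[&& ((code w).1.1 == j) && ((code w).1.2 == r1) & (code w).2 == r2].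
  rewrite -!val_eqE /= e1 e2 e3 -andbA; by case: eqP => //= ->.
apply/esym/big1_seq => w /andP[/eqP ec _]; have [e1 e2 e3] := hcode w.
have /andP[p0 pd] := piece_range w d1.
move: hv; rewrite /valid -ec e1 e2 e3 p0 pd.
by rewrite /residue1 /residue2 !ltn_mod p0.
Qed.

End SumsetGrowth.

(** * Lattice points of the polygon and of its multiples *)

Section Polygon.
Local Open Scope nat_scope.

(* The lattice points [(a, b)] with ['C(a, 2) <= b <= a (d - 1) / 2]. *)
Definition in_polygon (d : nat) (w : nat * nat) : bool :=
  (w.1 <= d) && (w.1 * w.1.-1 <= 2 * w.2 <= w.1 * d.-1).

(* The inequalities of the upper edge and of the lower edges, which join
   [(j, 'C(j, 2))] to [(j.+1, 'C(j.+1, 2))], scaled by [k]. *)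
Definition in_dilate (d k : nat) (w : nat * nat) : Prop :=
  2 * w.2 <= w.1 * d.-1 /\
  forall j, j < d -> 2 * j * w.1 <= 2 * w.2 + k * (j * j.+1).

Definition polygon_seq (d : nat) : seq (nat * nat) :=
  [seq (a, b) | a <- iota 0 d.+1, b <- [seq b <- iota 0 (a * d.-1).+1 | in_polygon d (a, b)]].

Lemma polygon_seq_uniq (d : nat) : uniq (polygon_seq d).
Proof.
apply: allpairs_uniq_dep; first exact: iota_uniq.
  by move=> a _; exact/filter_uniq/iota_uniq.
by move=> [a b] [a' b'] _ _ /= [-> ->].
Qed.

Lemma mem_polygon_seq (d : nat) (w : nat * nat) :
  (w \in polygon_seq d) = in_polygon d w.
Proof.
case: w => a b; apply/allpairsPdep/idP.
  by move=> [u [v [_ +]]] => -[+ [-> ->]]; rewrite mem_filter => /andP[].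
move=> h; exists a, b; split => //; first by rewrite mem_iota0; case/andP: h.
rewrite mem_filter h mem_iota0; case/andP: h => _ /andP[_].
by apply: leq_trans; rewrite leq_pmull.
Qed.

(** A nonzero product [(i - j) (i - j - 1)] of consecutive integers is at least 2: points off the
    edge are strictly on its inner side. *)
Lemma consec_square_lt (i j : nat) : i != j -> i != j.+1 ->
  2 * j * i + 2 <= i * i.-1 + j * j.+1.
Proof.
move=> ne1 ne2; have [h1|h1] := ltnP i j.
  rewrite -(subnKC h1); move: (j - i.+1) => t.
  by case: (i) => [|u] /=; nia.
have h2 : j.+1 < i by rewrite ltn_neqAle eq_sym ne2 ltn_neqAle eq_sym ne1.
by rewrite -(subnKC h2) /=; move: (i - j.+2) => t; nia.
Qed.

Lemma in_polygon_dilate (d : nat) (w : nat * nat) :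
  in_polygon d w -> in_dilate d 1 w.
Proof.
case: w => a b /andP[_ /= /andP[h1 h2]]; split => // j _ /=.
by rewrite mul1n; apply: leq_trans (consec_square a j) _; rewrite leq_add2r.
Qed.

(** The lower boundary is convex, so over the columns from [k q] to [k (q + 1)] the line of the edge
    [q] is the highest of all. *)
Lemma low_window (k q j a b : nat) :
  k * q <= a <= k * q.+1 -> 2 * q * a <= 2 * b + k * (q * q.+1) ->
  2 * j * a <= 2 * b + k * (j * j.+1).
Proof.
move=> /andP[h1 h2] h3; have [jq|qj] := leqP j q.
  rewrite -(subnKC jq) in h1 h3 h2; case: (q - j) h1 h2 h3 => [|t] h1 h2 h3.
    by rewrite addn0 in h3.
  have : (k * (j + t.+1)) * t.+1 <= a * t.+1 by rewrite leq_mul2r h1 orbT.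
  have : 0 <= k * (t * t.+1) by [].
  by nia.
rewrite -(subnKC qj) in h1 h3 h2 *; move: (j - q.+1) h1 h2 h3 => t h1 h2 h3.
have : a * t.+1 <= k * q.+1 * t.+1 by rewrite leq_mul2r h2 orbT.
have : 0 <= k * (t * t.+1) by [].
by nia.
Qed.

(** For [2 j > e] the worst column is [a = k (e + 1)], where the right side exceeds the left by
    [k (e - j) (e - j + 1)]. *)
Lemma low_top (k e j a : nat) :
  a <= k * e.+1 -> 2 * j * a <= a * e + k * (j * j.+1).
Proof.
move=> h; have [je|ej] := leqP (2 * j) e.
  apply: leq_trans (leq_addr _ _); rewrite mulnC leq_mul2l je orbT //.
rewrite -(subnKC (ltnW ej)); move: (2 * j - e) (subnKC (ltnW ej)) => t et.
have : a * t <= k * e.+1 * t by rewrite leq_mul2r h orbT.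
have [jl|lj] := leqP j e.
  have [s es] : exists s, e = j + s by exists (e - j); rewrite subnKC.
  have : 0 <= k * (s * s.+1) by [].
  subst e; have [u eu] : exists u, j = s + u by exists t; lia.
  subst j; have -> : t = u by lia.
  by nia.
have [s es] : exists s, j = e.+1 + s by exists (j - e.+1); rewrite subnKC.
subst j; have -> : t = e.+2 + 2 * s by lia.
have : 0 <= k * (s * s.+1) by [].
by nia.
Qed.

(** The upper edge and the last lower edge meet in the column [k d]. *)
Lemma dilate_width (d k : nat) (w : nat * nat) : 1 < d ->
  in_dilate d k w -> w.1 <= k * d.
Proof.
case: w d => [a b] [//|e] e1 [/= top low].
have := low e (ltnSn _) => h; rewrite -(leq_pmul2l (e1 : 0 < e)); nia.
Qed.

(* A lattice polygon is normal.  Here the summand is found in a column next to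
   the average one; only on the upper edge can the parity of the column matter. *)
Lemma dilate_split (d k : nat) (w : nat * nat) : 1 < d ->
  in_dilate d k.+1 w -> exists u v,
    [/\ in_polygon d u, in_dilate d k v & w = (u.1 + v.1, u.2 + v.2)].
Proof.
move=> d1 hw; have wd := dilate_width d1 hw.
case: w hw wd => a b [/= top low] wd.
case: d d1 top low wd => // e e1 /= top low wd.
(* [u] is sought in the column [q], the rounded average; the column [k q + r] left to [v] is then in
   the window of the edge [q], which alone has to be checked from below. *)
pose q := a %/ k.+1; pose r := a %% k.+1.
have ea : a = k.+1 * q + r by rewrite [LHS](divn_eq a k.+1) mulnC.
have rk : r <= k by rewrite -ltnS ltn_mod.
have qd : q <= e.+1 by rewrite -(leq_pmul2l (isT : 0 < k.+1)); lia.
have lowq : 2 * q * a <= 2 * b + k.+1 * (q * q.+1).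
  have [qe | eq] := ltnP q e.+1; first exact: low.
  have {eq qd} eq : q = e.+1 by apply/eqP; rewrite eqn_leq qd.
  rewrite eq in ea *; have := low e (ltnSn _).
  have r0 : r = 0 by lia.
  by rewrite ea r0 addn0; nia.
pose a' := k * q + r; have {}ea : a = q + a' by rewrite ea /a' mulSn addnA.
have wind : k * q <= a' <= k * q.+1 by rewrite /a' leq_addr mulnS; lia.
have wa' : a' <= k * e.+1.
  have [qe | eq] := ltnP q e.+1.
    by apply: leq_trans (_ : k * q.+1 <= _); [case/andP: wind|rewrite leq_mul2l qe orbT].
  have {eq qd} eq : q = e.+1 by apply/eqP; rewrite eqn_leq qd.
  by rewrite -eq -(leq_add2l q) -ea eq -mulSn.
have lowq' : q * q.-1 + 2 * q * a' <= 2 * b + k * (q * q.+1).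
  by move: lowq; rewrite ea; case: (q) => //= u; nia.
(* If [w] is low enough, [u] is the lowest point of its column and [v] stays under the upper
   edge. *)
have [c1 | c2] := leqP (2 * b) (q * q.-1 + a' * e).
  have eC := double_bin2 q.
  have Cb : 'C(q, 2) <= b.
    have : k * q * (2 * q) <= a' * (2 * q) by rewrite leq_mul2r; case/andP: wind => ->; rewrite orbT.
    have : k * (q * q.+1) <= k * q * (2 * q).
      by rewrite mulnA; case: (q) => [|u]; rewrite ?muln0 // leq_mul2l; apply/orP; right; lia.
    lia.
  exists (q, 'C(q, 2)), (a', b - 'C(q, 2)); split.
  - rewrite /in_polygon /= qd eC leqnn /= leq_mul2l.
    by case: (q) qd => //= u; rewrite ltnS => ->; rewrite orbT.
  - split=> /=; first by rewrite mulnBr eC; lia.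
    move=> j _; apply: (@low_window k q) => //.
    by rewrite mulnBr eC; lia.
  - by rewrite /= -ea subnKC.
(* Otherwise [v] is the highest lattice point of its column. Rounding it down costs [u] a half,
   which is harmless unless [w] is on the upper edge. *)
have [c3 | c3] := boolP (~~ odd (a' * e) || (2 * b < a * e)).
  pose U := (a' * e)./2.
  have eU : 2 * U + odd (a' * e) = a' * e.
    by rewrite mul2n addnC odd_double_half.
  exists (q, b - U), (a', U); split => /=.
  - rewrite /in_polygon /= qd mulnBr; apply/andP; split; first by lia.
    case/orP: c3 => [/negbTE o|]; first by rewrite o in eU; lia.
    by case: odd eU => eU; lia.
  - split=> /=; first by lia.
    move=> j _; have := low_top j wa'; have [t ->] : exists t, j * j.+1 = 2 * t.
      by exists 'C(j.+1, 2); rewrite double_bin2S.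
    by case: odd eU => eU; lia.
  - by rewrite -ea subnK //; lia.
(* Now [w] is on the upper edge, so both summands must be, but the columns [q] and [a'] have no
   lattice point there. Both are odd, and moving to [q + 1] and [a' - 1] corrects both parities. *)
move: c3; rewrite negb_or negbK -leqNgt => /andP[o c3].
have {top} {}c3 : 2 * b = a * e by apply/eqP; rewrite eqn_leq top.
move: o; rewrite oddM => /andP[oa oe].
have oq : odd q.
  have : odd (2 * b) = false by rewrite mul2n odd_double.
  by rewrite c3 ea oddM oe oddD oa andbT; case: odd.
have qe : q < e.+1.
  rewrite ltn_neqAle qd andbT; apply: contraL oq => /eqP ->.
  by rewrite /= oe.
have k0 : 0 < k.
  by rewrite lt0n; apply: contraTneq oa => k0; move: wind; rewrite k0 !mul0n leqn0 => /andP[_ /eqP ->].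
have a'0 : 0 < a' by case: (a') oa.
have [B eB] : exists B, q.+1 * e = 2 * B.
  by exists (q.+1 * e)./2; rewrite mul2n even_halfK // oddM /= oq.
have [B' eB'] : exists B', a'.-1 * e = 2 * B'.
  exists (a'.-1 * e)./2; rewrite mul2n even_halfK // oddM.
  by case: (a') a'0 oa => //= u _ /negbTE ->.
exists (q.+1, B), (a'.-1, B'); split => /=.
- rewrite /in_polygon /= -eB leqnn andbT qe /= leq_mul2l //=.
- split=> /=; first by rewrite -eB'.
  move=> j _; rewrite -eB'; apply: low_top.
  by apply: leq_trans wa'; exact: leq_pred.
- congr (_, _); first by rewrite ea addSnnS prednK.
  by move: c3; rewrite ea; case: (a') a'0 eB' => //= u _ eB'; lia.
Qed.

Lemma in_dilate_sumset (d k : nat) (w : nat * nat) : 1 < d ->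
  in_dilate d k w -> w \in sumset (polygon_seq d) k.
Proof.
move=> d1; elim: k w => [|k IH] w hw.
  have := dilate_width d1 hw; rewrite mul0n leqn0.
  case: hw; case: w => a b /= top _ /eqP a0.
  by move: top; rewrite a0 mul0n leqn0 muln_eq0 => /eqP ->.
have [[a b] [[a' b'] [hu hv ->]]] := dilate_split d1 hw.
by apply: sumsetS (IH _ hv); rewrite mem_polygon_seq.
Qed.

Lemma in_dilateD (d k l : nat) (u v : nat * nat) :
  in_dilate d k u -> in_dilate d l v ->
  in_dilate d (k + l) (u.1 + v.1, u.2 + v.2).
Proof.
move=> [t1 l1] [t2 l2]; split=> /=; first by rewrite mulnDr mulnDl leq_add.
by move=> j jd; have := leq_add (l1 j jd) (l2 j jd); rewrite !mulnDr mulnDl; lia.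
Qed.

Lemma sumset_in_dilate (d k : nat) (w : nat * nat) :
  w \in sumset (polygon_seq d) k -> in_dilate d k w.
Proof.
elim: k w => [|k IH] w; first by rewrite inE => /eqP ->; split=> [|j] //=; rewrite muln0.
move/sumsetSE => [p [q [hp hq ->]]]; rewrite -add1n; apply: in_dilateD (IH _ hq).
by apply: in_polygon_dilate; rewrite -mem_polygon_seq.
Qed.

(** Within its column the point divides the segment from [(a, 'C(a, 2))] to the upper edge with
    weights [x] and [y], and the upper end is a combination of [(0, 0)] and [(d, 'C(d, 2))] with
    denominator [d]. Clearing denominators gives the multiple [d (x + y)]. *)
Lemma in_polygon_multiple (d : nat) (w : nat * nat) : 1 < d ->
  in_polygon d w ->
  exists2 M, 0 < M & (M * w.1, M * w.2) \in sumset (oscs d) M.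
Proof.
case: w => a b d1 /and3P[/= ad lo hi].
have osca : (a, 'C(a, 2)) \in oscs d by apply/oscsP.
have [e | ne] := eqVneq (2 * b) (a * a.-1).
  have -> : b = 'C(a, 2) by apply/eqP; rewrite -(eqn_pmul2l (isT : 0 < 2)) e double_bin2.
  exists 1 => //; rewrite !mul1n.
  by have := sumsetS osca (sumset0 d 0); rewrite !addn0.
pose y := 2 * b - a * a.-1; pose x := a * d.-1 - 2 * b.
have hx : x + 2 * b = a * d.-1 by rewrite subnK.
have hy : y + a * a.-1 = 2 * b by rewrite subnK.
have y0 : 0 < y by rewrite subn_gt0 ltn_neqAle eq_sym ne.
have dd : (d, 'C(d, 2)) \in oscs d by apply/oscsP.
have h := sumsetMl (d * x) osca (sumsetMl (a * y) dd (sumset0 d ((d - a) * y))).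
have eM : d * x + (a * y + (d - a) * y) = d * (x + y).
  by rewrite -mulnDl subnKC // mulnDr.
exists (d * (x + y)); first by rewrite muln_gt0 addn_gt0 y0 orbT (ltnW d1).
rewrite -{3}eM; apply: mem_pair h _ _; rewrite addn0 /=; first by lia.
apply/eqP; rewrite -(eqn_pmul2l (isT : 0 < 2)) mulnDr; apply/eqP.
have ea := double_bin2 a; have ed := double_bin2 d.
transitivity (d * (x * (2 * 'C(a, 2)) + y * (a * d.-1))).
  by rewrite ea; transitivity (d * x * (a * a.-1) + a * y * (d * d.-1)); [rewrite -ea -ed|]; lia.
transitivity (d * ((x + y) * (2 * b))); last by lia.
by congr (_ * _); rewrite ea; nia.
Qed.

Lemma polygon_multiple (d : nat) : 1 < d -> exists2 M, 0 < M &
  forall w, in_polygon d w -> (M * w.1, M * w.2) \in sumset (oscs d) M.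
Proof.
move=> d1; suff [M M0 hM] : exists2 M, 0 < M & forall w, w \in polygon_seq d ->
    (M * w.1, M * w.2) \in sumset (oscs d) M.
  by exists M => // w hw; apply: hM; rewrite mem_polygon_seq.
have : forall w, w \in polygon_seq d -> in_polygon d w by move=> w; rewrite mem_polygon_seq.
elim: (polygon_seq d) => [|u s IH] hs; first by exists 1.
have [w hw|M M0 hM] := IH; first by apply: hs; rewrite inE hw orbT.
have [K K0 hK] := in_polygon_multiple d1 (hs u (mem_head _ _)).
have z : (0, 0) \in sumset (oscs d) 0 by [].
have mult N L v : (N * v.1, N * v.2) \in sumset (oscs d) N ->
    (L * N * v.1, L * N * v.2) \in sumset (oscs d) (L * N).
  move=> h; elim: L => [|L IHL] //; rewrite !mulSn; apply: mem_pair (sumsetD h IHL) _ _.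
    by rewrite mulnDl.
  by rewrite mulnDl.
exists (K * M); first by rewrite muln_gt0 K0.
move=> w; rewrite inE => /predU1P[->|/hM hw]; last by apply: mult.
by rewrite [K * M]mulnC; apply: mult.
Qed.

(* The segment between the two points meets the interior of the polygon, so a
   multiple of their sum exceeds (0, 0) + (1, 0) + (2, 1) by a point of the cone. *)
Lemma far_points_interior (d i l : nat) : 2 < d -> i.+1 < l <= d ->
  ~~ ((i == 0) && (l == d)) ->
  exists M N k w, [/\ 0 < N, w \in sumset (oscs d) k, M * 2 = N * 3 + k,
    M * (i + l) = N * 3 + w.1 & M * ('C(i, 2) + 'C(l, 2)) = N + w.2].
Proof.
move=> d2 /andP[il ld] ne; have d1 : 1 < d by exact: ltnW.
(* The sum of the two points satisfies every edge inequality with slack at least 1, and 2 for the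
   lower edges, as they share no edge. Multiplied by [M] the slack outweighs what the subtraction of
   [(0, 0) + (1, 0) + (2, 1)] costs. *)
pose M := 2 * d * d.
have M2 : 2 < M by rewrite /M; nia.
pose w := (M * (i + l) - 3, M * ('C(i, 2) + 'C(l, 2)) - 1).
have ei := double_bin2 i; have el := double_bin2 l.
have w1 : w.1 + 3 = M * (i + l) by rewrite /w /= subnK //; nia.
have l0 : 0 < 'C(l, 2) by rewrite bin_gt0; apply: leq_ltn_trans il.
have w2 : w.2 + 1 = M * ('C(i, 2) + 'C(l, 2)).
  by rewrite /w /= subnK // muln_gt0 addn_gt0 l0 orbT andbT (ltn_trans _ M2).
have hw : in_dilate d (2 * M - 3) w.
  have M3 : 2 * M - 3 + 3 = 2 * M by rewrite subnK //; lia.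
  clearbody w; split.
    have hd : i * i.-1 + l * l.-1 + 1 <= (i + l) * d.-1.
      have [i0 | i0] := posnP i; last first.
        rewrite mulnDl; have : l * l.-1 <= l * d.-1 by rewrite leq_mul2l; lia.
        have : i * i.-1.+1 <= i * d.-1 by rewrite leq_mul2l; lia.
        lia.
      have lt : l < d by move: ne; rewrite i0 /= ltn_neqAle ld => ->.
      have : l * l.-1.+1 <= l * d.-1 by rewrite leq_mul2l; lia.
      lia.
    have := leq_mul (leqnn M) hd.
    have : 3 * d.-1 <= M by rewrite /M; nia.
    have : w.1 * d.-1 + 3 * d.-1 = M * ((i + l) * d.-1) by rewrite -mulnDl w1 mulnA.
    have : 2 * w.2 + 2 = M * (i * i.-1 + l * l.-1).
      by rewrite -ei -el -mulnDr mulnCA -w2; lia.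
    lia.
  move=> j jd; have hj : 2 * j * (i + l) + 2 <= i * i.-1 + l * l.-1 + 2 * (j * j.+1).
    have hi1 := consec_square i j; have hl1 := consec_square l j.
    have [e1|n1] := eqVneq i j.
      have : l != j by lia. have : l != j.+1 by lia.
      by move=> a1 a2; have := consec_square_lt a2 a1; lia.
    have [e2|n2] := eqVneq i j.+1.
      have : l != j by lia. have : l != j.+1 by lia.
      by move=> a1 a2; have := consec_square_lt a2 a1; lia.
    by have := consec_square_lt n1 n2; lia.
  have := leq_mul (leqnn M) hj.
  have : 3 * (j * j.+1) + 2 <= 2 * M by rewrite /M; nia.
  have : 2 * j * w.1 + 2 * j * 3 = M * (2 * j * (i + l)) by rewrite -mulnDr w1; lia.
  have : 2 * w.2 + 2 = M * (i * i.-1 + l * l.-1).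
    by rewrite -ei -el -mulnDr mulnCA -w2; lia.
  have : (2 * M - 3) * (j * j.+1) + 3 * (j * j.+1) = 2 * M * (j * j.+1) by rewrite -mulnDl M3.
  lia.
clearbody w.
(* [w] is a sum of arbitrary lattice points of the polygon; after multiplication by [K] each of them
   is a sum of the points [(j, 'C(j, 2))]. *)
have [K K0 hK] := polygon_multiple d1.
exists (K * M), K, (K * (2 * M - 3)), (K * w.1, K * w.2); split => //=.
- elim: (2 * M - 3) (w) (in_dilate_sumset d1 hw) => [|k IH] v.
    by rewrite inE muln0 => /eqP -> /=; rewrite !muln0.
  move/sumsetSE => [u [v' [hu hv ->]]]; rewrite mulnS /= !mulnDr.
  by apply: sumsetD (IH _ hv); apply: hK; rewrite -mem_polygon_seq.
- by rewrite mulnBr; nia.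
- by rewrite -mulnA -w1; lia.
- by rewrite -mulnA -w2; lia.
Qed.

End Polygon.

(** * Number of lattice points of the polygon *)

Section PolygonCount.

Lemma polygon_column (d a : nat) : (a <= d)%N ->
  (size [seq b <- iota 0 (a * d.-1).+1 | in_polygon d (a, b)] + 'C(a, 2) =
   (a * d.-1)./2.+1)%N.
Proof.
move=> ad; have ea := double_bin2 a.
have hi := odd_double_half (a * d.-1); rewrite -muln2 in hi.
have lh : ('C(a, 2) <= (a * d.-1)./2)%N.
  have : (a * a.-1 <= a * d.-1)%N by rewrite leq_mul2l; lia.
  by case: odd hi; lia.
rewrite (_ : size _ = size (iota 'C(a, 2) ((a * d.-1)./2.+1 - 'C(a, 2)))).
  by rewrite size_iota subnK // ltnW.
apply/perm_size/uniq_perm; first exact/filter_uniq/iota_uniq.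
  exact: iota_uniq.
move=> b; rewrite mem_filter mem_iota0 mem_iota subnKC; last exact: ltnW.
rewrite /in_polygon /= ad -ea leq_pmul2l // ltnS.
rewrite andbA; case: leqP => //= _; apply/andP/idP => [[]|h].
  by case: odd hi; lia.
by case: odd hi; lia.
Qed.

(** The two formulas differ by the rounding at the upper edge: [a (d - 1)] is odd only for [d] even
    and [a] odd. *)
Lemma size_polygon_seq (d : nat) : (0 < d)%N ->
  (size (polygon_seq d))%:R = (if odd d then d%:R * (d%:R ^+ 2 + 11) / 12
            else d%:R * (d%:R ^+ 2 + 8) / 12) + 1 :> rat.
Proof.
move=> d0.
have sz : (size (polygon_seq d))%:R = \sum_(a < d.+1)
    ((a%:R * d.-1%:R - (odd (a * d.-1))%:R) / 2 + 1 - a%:R * (a%:R - 1) / 2) :> rat.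
  rewrite size_allpairs_dep sumnE big_map -[iota 0 d.+1]/(index_iota 0 d.+1).
  rewrite big_mkord natr_sum; apply: eq_bigr => a _.
  have /polygon_column/(congr1 (fun n => n%:R : rat)) : (a <= d)%N by rewrite -ltnS.
  rewrite natrD -natr1 => hc.
  have := odd_double_half (a * d.-1) => /(congr1 (fun n => n%:R : rat)).
  rewrite natrD -muln2 !natrM => hi.
  have /(congr1 (fun n => n%:R : rat)) := double_bin2 a.
  have -> : (a * a.-1)%N%:R = a%:R * (a%:R - 1) :> rat.
    by case: (nat_of_ord a) => [|u]; rewrite ?mul0r // -natr1 natrM -natr1 addrK.
  rewrite natrM => hC; lra.
rewrite {}sz.
have s1 n : \sum_(a < n) (a%:R : rat) = n%:R * (n%:R - 1) / 2.
  elim: n => [|n IH]; first by rewrite big_ord0 !mul0r.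
  by rewrite big_ord_recr /= IH -natr1; field.
have s2 n : \sum_(a < n) (a%:R * (a%:R - 1) / 2 : rat) =
    n%:R * (n%:R - 1) * (n%:R - 2) / 6.
  elim: n => [|n IH]; first by rewrite big_ord0 !mul0r.
  by rewrite big_ord_recr /= IH -natr1; field.
have s3 n : \sum_(a < n) ((odd a)%:R : rat) = (n%:R - (odd n)%:R) / 2.
  elim: n => [|n IH]; first by rewrite big_ord0 subrr mul0r.
  by rewrite big_ord_recr /= IH -natr1; case: (odd n); rewrite /= ?mulr0n ?mulr1n; field.
rewrite big_split big_split /= sumrN -mulr_suml big_split /= -mulr_suml sumrN.
rewrite s1 s2 sumr_const card_ord.
have s4 : \sum_(a < d.+1) (odd (a * d.-1))%:R = (if odd d then 0 else d%:R / 2) :> rat.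
  have od : odd d.-1 = ~~ odd d by rewrite -[in RHS](prednK d0) /= negbK.
  have [o | /negbTE e] := boolP (odd d).
    by rewrite big1 // => a _; rewrite oddM od o andbF.
  transitivity (\sum_(a < d.+1) ((odd a)%:R : rat)).
    by apply: eq_bigr => a _; rewrite oddM od e andbT.
  by rewrite s3 /= e /= -natr1; lra.
have -> : d.-1%:R = d%:R - 1 :> rat by rewrite -[in RHS](prednK d0) -natr1 addrK.
by rewrite s4 -natr1; case: odd; field.
Qed.

End PolygonCount.

(** * Sumsets as weights of monomials; lattice points of the real polygon *)

Section SumsetMonomials.
Variables (n : nat) (p : 'I_n -> nat * nat).

Definition mexpw (m : 'X_{1..n}) : nat * nat :=
  (\sum_i m i * (p i).1, \sum_i m i * (p i).2)%N.

Lemma mexpw0 : mexpw 0%MM = (0, 0)%N.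
Proof. by congr (_, _); apply: big1 => i _; rewrite mnm0E. Qed.

Lemma mexpwD (m m' : 'X_{1..n}) :
  mexpw (m + m')%MM =
  ((mexpw m).1 + (mexpw m').1, (mexpw m).2 + (mexpw m').2)%N.
Proof.
by congr (_, _); rewrite -big_split; apply: eq_bigr => i _; rewrite mnmDE mulnDl.
Qed.

Lemma mexpwU (i : 'I_n) : mexpw U_(i)%MM = p i.
Proof.
rewrite /mexpw [RHS]surjective_pairing.
congr (_, _); rewrite (bigD1 i) //= big1 ?mnm1E ?eqxx ?mul1n ?addn0 // => j ji.
  by rewrite mnm1E eq_sym (negbTE ji).
by rewrite mnm1E eq_sym (negbTE ji).
Qed.

Lemma sumset_mexpw (s : seq (nat * nat)) (k : nat) (w : nat * nat) :
  (forall u, u \in s <-> exists i, p i = u) ->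
  w \in sumset s k <-> exists2 m, mdeg m = k & mexpw m = w.
Proof.
move=> hs; split.
  elim: k w => [|k IH] w.
    by rewrite inE => /eqP ->; exists 0%MM; rewrite ?mdeg0 ?mexpw0.
  move/sumsetSE => [u [v [/hs[i <-] /IH[m hm <-] ->]]].
  by exists (U_(i) + m)%MM; rewrite ?mdegD ?mdeg1 ?hm // mexpwD mexpwU.
move=> [m]; elim: k m w => [|k IH] m w hm <-.
  by move/eqP: hm; rewrite mdeg_eq0 => /eqP ->; rewrite mexpw0.
have [i mi] : exists i, (0 < m i)%N.
  apply/existsP; apply: contraPT hm => /existsPn hm.
  by rewrite mdegE big1 // => i _; apply/eqP; have := hm i; rewrite lt0n negbK.
have em : m = (U_(i) + (m - U_(i)))%MM.
  apply/mnmP => l; rewrite mnmDE mnmBE mnm1E; case: eqP => [<-|_]; last by rewrite subn0.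
  by rewrite subnKC.
have hm' : mdeg (m - U_(i))%MM = k.
  by move: hm; rewrite {1}em mdegD mdeg1 add1n => -[].
have := IH _ _ hm' erefl; rewrite em mexpwD mexpwU -em.
have : p i \in s by apply/hs; exists i.
by case: (p i) => a b; case: (mexpw _) => a' b'; apply: sumsetS.
Qed.

End SumsetMonomials.
Definition osc (d : nat) (j : 'I_d.+1) : nat * nat := (nat_of_ord j, 'C(j, 2)).

Lemma mem_oscs (d : nat) (w : nat * nat) :
  w \in oscs d <-> exists j : 'I_d.+1, osc j = w.
Proof.
case: w => a b; split=> [/oscsP[ad ->]|[j [<- <-]]].
  by exists (Ordinal (ad : (a < d.+1)%N)).
by apply/oscsP; rewrite -ltnS.
Qed.

Definition int_point (w : nat * nat) : 'cV[int]_2 :=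
  \col_i (if i == 0 then w.1%:Z else w.2%:Z).

Lemma int_point_inj : injective int_point.
Proof.
move=> [a b] [a' b'] /matrixP h; have := h 0 0; have := h 1 0.
by rewrite !mxE /= => -[->] [->].
Qed.

Lemma osc_polygonP (R : realType) (d : nat) (b : 'cV[int]_2) : (1 < d)%N ->
  osc_polygon d (map_mx intr b : 'cV[R]_2) <->
  exists2 w, in_polygon d w & b = int_point w.
Proof.
move=> d1; split; last first.
  move=> [w hw ->]; have [M M0 hM] := in_polygon_multiple d1 hw.
  have /(sumset_mexpw _ _ (@mem_oscs d))[m mM [e1 e2]] := hM.
  have M0' : M%:R != 0 :> R by rewrite pnatr_eq0 -lt0n.
  exists (\row_j ((m j)%:R / M%:R)).
    split=> [j|]; first by rewrite mxE divr_ge0.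
    under eq_bigr do rewrite mxE.
    by rewrite -mulr_suml -natr_sum -mdegE mM divff.
  apply/matrixP => i k; rewrite ord1 summxE !mxE.
  under eq_bigr do rewrite !mxE mulrAC.
  rewrite -mulr_suml; apply: (canLR (mulfK M0')).
  case: i => [[|[|//]] hi] /=; rewrite -[_%:~R * _]natrM mulnC.
    by rewrite -e1 natr_sum; apply: eq_bigr => j _; rewrite natrM.
  by rewrite -e2 natr_sum; apply: eq_bigr => j _; rewrite natrM.
move=> [l [l0 l1] /matrixP h].
have hA : \sum_j l 0 j * j%:R = (b 0 0)%:~R.
  by have := h 0 0; rewrite !mxE summxE => <-; apply: eq_bigr => i _; rewrite !mxE.
have hB : 2 * (b 1 0)%:~R = \sum_j l 0 j * (j%:R * (j%:R - 1)).
  have := h 1 0; rewrite !mxE summxE => <-; rewrite mulr_sumr.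
  apply: eq_bigr => j _; rewrite !mxE /= -[_%:~R]/('C(j, 2)%:R) mulrCA -natrM.
  congr (_ * _); rewrite double_bin2 natrM.
  by case: (nat_of_ord j) => [|u]; rewrite ?mul0r // -[in RHS]natr1 addrK natr1.
have jd (j : 'I_d.+1) : (j%:R <= d%:R :> R) by rewrite ler_nat -ltnS.
have A0 : 0 <= (b 0 0)%:~R :> R.
  by rewrite -hA sumr_ge0 // => j _; rewrite mulr_ge0.
have Ad : (b 0 0)%:~R <= d%:R :> R.
  rewrite -hA -[leRHS]mul1r -[X in _ <= X * _]l1 mulr_suml; apply: ler_sum => j _.
  by rewrite ler_wpM2l.
have low : (b 0 0)%:~R * ((b 0 0)%:~R - 1) <= 2 * (b 1 0)%:~R :> R.
  set A := (b 0 0)%:~R in hA *.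
  (* The variance of the abscissa under the weights [l] is nonnegative, which is Jensen's inequality
     for [j (j - 1)]. *)
  have : 0 <= \sum_j l 0 j * (j%:R - A) ^+ 2.
    by apply: sumr_ge0 => j _; rewrite mulr_ge0 ?sqr_ge0.
  have -> : \sum_j l 0 j * (j%:R - A) ^+ 2 =
      2 * (b 1 0)%:~R + (1 - 2 * A) * \sum_j l 0 j * j%:R + A ^+ 2 * \sum_j l 0 j.
    by rewrite hB !mulr_sumr -!big_split; apply: eq_bigr => j _ /=; ring.
  by rewrite hA l1; lra.
have top : 2 * (b 1 0)%:~R <= (b 0 0)%:~R * (d%:R - 1) :> R.
  rewrite hB -hA mulr_suml; apply: ler_sum => j _; rewrite -mulrA ler_wpM2l //.
  by rewrite ler_wpM2l // lerD2r.
have [a ea] : exists a : nat, b 0 0 = a%:Z.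
  by move: A0; rewrite ler0z; case: (b 0 0) => // a _; exists a.
rewrite ea -[_%:~R]/(a%:R) in Ad low top.
have aa : a%:R * (a%:R - 1) = (a * a.-1)%N%:R :> R.
  by case: (a) => [|u]; rewrite ?mul0r // natrM -[in LHS]natr1 addrK natr1.
have [c ec] : exists c : nat, b 1 0 = c%:Z.
  have : 0 <= 2 * (b 1 0)%:~R :> R by apply: le_trans low; rewrite aa.
  by rewrite pmulr_rge0 // ler0z; case: (b 1 0) => // c _; exists c.
rewrite ec -[_%:~R]/(c%:R) -natrM in low top.
exists (a, c).
  rewrite /in_polygon /= -(ler_nat R) Ad -!(ler_nat R) -aa low /=.
  apply: le_trans top _; rewrite natrM.
  by rewrite (_ : d.-1%:R = d%:R - 1) // -[in RHS](prednK (ltnW d1)) -natr1 addrK.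
apply/matrixP => i k; rewrite ord1 mxE; case: i => [[|[|//]] hi] /=.
  by rewrite -ea; congr (b _ _); apply: val_inj.
by rewrite -ec; congr (b _ _); apply: val_inj.
Qed.

(** * Polynomials in two variables *)

Section Bivariate.
Variable C : numClosedFieldType.
Notation bipoly := {poly {poly C}}.

Definition specialize (x : C) : bipoly -> {poly C} := map_poly (horner_eval x).

HB.instance Definition _ (x : C) := GRing.RMorphism.on (specialize x).

Lemma specializeC (x : C) (s : {poly C}) : specialize x s%:P = (s.[x])%:P.
Proof. exact: map_polyC. Qed.

Lemma specialize_eq0 (x : C) (f : bipoly) :
  specialize x f = 0 -> exists g, f = ('X - x%:P)%:P * g.
Proof.
move=> h; exists (map_poly (fun s : {poly C} => s %/ ('X - x%:P)) f).
apply/polyP => i; rewrite coefCM coef_map_id0 ?div0p //.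
rewrite mulrC divpK // dvdp_XsubCl /root.
by have := coef_map (horner_eval x) f i; rewrite [map_poly _ _]h coef0 => /esym/eqP.
Qed.

Lemma lin_neq0 (x : C) : ('X - x%:P)%:P != 0 :> bipoly.
Proof. by rewrite polyC_eq0 polyXsubC_eq0. Qed.

Lemma specialize_lin (x : C) : specialize x ('X - x%:P)%:P = 0.
Proof. by rewrite specializeC hornerXsubC subrr. Qed.

(* A fraction [f1 / f2] equal to [a / b] whose denominator has least degree in
   the second variable and then least leading coefficient is in lowest terms. *)
Lemma reduced_fraction (a b : bipoly) : b != 0 -> exists f1 f2 : bipoly,
  [/\ f2 != 0, a * f2 = b * f1 &
      forall F G, F * f2 = G * f1 -> exists h : bipoly, G = f2 * h].
Proof.
move=> b0.
pose frac (f : bipoly * bipoly) := f.2 != 0 /\ a * f.2 = b * f.1.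
pose P1 n := `[< exists2 f, frac f & size f.2 = n >].
have ex1 : exists n, P1 n by exists (size b); apply/asboolP; exists (a, b); split; rewrite // mulrC.
have [n /asboolP[fn frn szn] minn_] := ex_minnP ex1.
pose P2 m := `[< exists f, [/\ frac f, size f.2 = n & size (lead_coef f.2) = m] >].
have ex2 : exists m, P2 m by exists (size (lead_coef fn.2)); apply/asboolP; exists fn.
have [m /asboolP[[f1 f2] /= [[/= f20 af2] szf2 szl]] minm] := ex_minnP ex2.
exists f1, f2; split => // F G FG.
(* Gauss's lemma, one root of [s] at a time: its linear factor divides [q] or [f2]. If it divides
   [f2] but not [q], it divides [f1] as well and cancels, against the minimal leading
   coefficient. *)
have strip k (s : {poly C}) (q : bipoly) : (size s <= k)%N -> s != 0 ->
    s%:P * G = q * f2 -> exists h, G = f2 * h.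
  elim: k s q => [|k IH] s q; first by rewrite leqn0 size_poly_eq0 => ->.
  move=> sk s0 e.
  have [s1 | s1] := eqVneq (size s) 1%N.
    have /eqP/size_poly1P[c c0 es] := s1.
    exists ((c^-1)%:P%:P * q); rewrite mulrCA [f2 * q]mulrC -e es mulrA -!polyCM.
    by rewrite mulVf // mul1r.
  have [x sx] : exists x, root s x by apply/closed_rootP.
  have [s' es] : exists s', s = s' * ('X - x%:P) by apply/factor_theorem.
  have s'0 : s' != 0 by apply: contraNneq s0 => s'0; rewrite es s'0 mul0r.
  have szs' : (size s' <= k)%N.
    by move: sk; rewrite es size_Mmonic ?monicXsubC // size_XsubC addn2.
  have : specialize x (q * f2) = 0.
    by rewrite -e es polyCM 2!rmorphM /= specialize_lin mulr0 mul0r.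
  rewrite rmorphM => /eqP; rewrite mulf_eq0 => /orP[] /eqP/specialize_eq0[g eg].
    apply: (IH s' g) => //; apply: (mulfI (lin_neq0 x)).
    by rewrite mulrA -polyCM [_ * s']mulrC -es e eg mulrA.
  have [/specialize_eq0[g' eg']|qx] := eqVneq (specialize x q) 0.
    apply: (IH s' g') => //; apply: (mulfI (lin_neq0 x)).
    by rewrite mulrA -polyCM [_ * s']mulrC -es e eg' mulrA.
  have sF : s%:P * F = q * f1.
    by apply: (mulIf f20); rewrite -mulrA FG mulrA e mulrAC.
  have /eqP : specialize x (q * f1) = 0.
    by rewrite -sF es polyCM 2!rmorphM /= specialize_lin mulr0 mul0r.
  rewrite rmorphM mulf_eq0 (negbTE qx) /= => /eqP/specialize_eq0[g1 eg1].
  have g0 : g != 0 by apply: contraNneq f20 => g0; rewrite eg g0 mulr0.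
  have szg : size g = n by rewrite -szf2 eg size_Cmul // polyXsubC_eq0.
  have : (m <= size (lead_coef g))%N.
    apply: minm; apply/asboolP; exists (g1, g); split => //; split => //=.
    by apply: (mulfI (lin_neq0 x)); rewrite mulrCA -eg af2 eg1 mulrCA.
  rewrite -szl eg lead_coefM lead_coefC size_monicM ?monicXsubC ?lead_coef_eq0 //.
  by rewrite size_XsubC add2n ltnn.
(* The pseudo-remainder of [G] by [f2] would be another denominator of [a / b], of smaller degree,
   so it vanishes. *)
pose c := lead_coef f2 ^+ scalp G f2.
have c0 : c != 0 by rewrite expf_neq0 // lead_coef_eq0.
have eG : c%:P * G = (G %/ f2) * f2 + (G %% f2).
  by rewrite mul_polyC Pdiv.Idomain.divp_eq.
suff r0 : G %% f2 = 0 by apply: (strip _ c (G %/ f2)) => //; rewrite eG r0 addr0.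
apply/eqP/negP => /negP r0.
have : (n <= size (G %% f2)%R)%N.
  apply: minn_; apply/asboolP.
  exists (c%:P * F - (G %/ f2) * f1, (G %% f2)) => //; split => //=.
  have er : (G %% f2) = c%:P * G - (G %/ f2) * f2 by rewrite eG addrC addKr.
  apply: (mulIf f20); rewrite mulrAC af2 er.
  rewrite [LHS](_ : _ = b * (c%:P * (G * f1) - G %/ f2 * f1 * f2)); last by ring.
  by rewrite -FG; ring.
by rewrite -szf2 leqNgt Pdiv.Idomain.ltn_modp f20.
Qed.

(** The rational root argument: in lowest terms the equation makes [f2] divide [f1 ^+ m]. *)
Lemma integral_quotient (m : nat) (a b : bipoly) (c : 'I_m -> bipoly) : b != 0 ->
  a ^+ m + \sum_(i < m) c i * a ^+ i * b ^+ (m - i) = 0 -> exists q, a = b * q.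
Proof.
move=> b0 e; have [f1 [f2 [f20 ef red]]] := reduced_fraction a b0.
have {}e : f1 ^+ m = - (\sum_(i < m) c i * f1 ^+ i * f2 ^+ (m - i.+1)) * f2.
  apply: (mulfI (expf_neq0 m b0)); rewrite -exprMn -ef exprMn.
  apply/eqP; rewrite mulNr mulrN -addr_eq0; apply/eqP.
  rewrite -[RHS](mul0r (f2 ^+ m)) -[X in _ = X * _]e mulrDl; congr (_ + _).
    rewrite mulr_suml mulr_suml mulr_sumr; apply: eq_bigr => i _.
  have em : m = (i + (m - i.+1).+1)%N by rewrite -subSn // subSS subnKC // ltnW.
  rewrite -[in X in _ = X]mulrA.
  have -> : (m - i = (m - i.+1).+1)%N by rewrite -subSn.
  have -> : f2 ^+ m = f2 ^+ i * f2 ^+ (m - i.+1).+1 by rewrite -exprD -em.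
  rewrite {1}em exprD; move: (m - i.+1)%N => k.
  transitivity (c i * (b * f1) ^+ i * b ^+ k.+1 * (f2 ^+ k * f2)).
    by rewrite exprMn !exprS; ring.
  by rewrite -ef exprMn !exprS; ring.
(* [red] with [G = f1 ^+ k] lowers the power divisible by [f2] by one, down to [f1 ^+ 0]. *)
have unit_den k : (exists F, f1 ^+ k = F * f2) -> exists h, 1 = f2 * h.
  elim: k => [[F eF]|k IH [F eF]]; first by exists F; rewrite mulrC -eF.
  have [|h eh] := red F (f1 ^+ k); first by rewrite -eF exprSr.
  by apply: IH; exists h; rewrite mulrC.
have [h eh] := unit_den m (ex_intro _ _ e).
by exists (f1 * h); rewrite mulrA -ef -mulrA -eh mulr1.
Qed.

End Bivariate.

Section BivariateEval.
Variable C : numClosedFieldType.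
Notation bipoly := {poly {poly C}}.

Definition eval2 (x y : C) (f : bipoly) : C := (f.[y%:P]).[x].

Lemma eval2M (x y : C) (f g : bipoly) : eval2 x y (f * g) = eval2 x y f * eval2 x y g.
Proof. by rewrite /eval2 !hornerM. Qed.

Lemma nonroot_nat (D : idomainType) (h : C -> D) (p : {poly D}) :
  injective h -> p != 0 -> exists2 y, y != 0 & p.[h y] != 0.
Proof.
move=> hinj p0; pose s := [seq h i.+1%:R | i <- iota 0 (size p)].
have us : uniq s.
  rewrite map_inj_uniq ?iota_uniq // => i j /hinj/eqP.
  by rewrite eqr_nat eqSS => /eqP.
have : ~~ all (root p) s.
  by apply/negP => h1; have := max_poly_roots p0 h1 us; rewrite size_map size_iota ltnn.
case/allPn => _ /mapP[i _ ->] hi; exists i.+1%:R => //.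
by rewrite pnatr_eq0.
Qed.

Lemma eval2_nonzero (f : bipoly) : f != 0 ->
  exists x y, [/\ x != 0, y != 0 & eval2 x y f != 0].
Proof.
move=> f0; have [y y0 fy] := nonroot_nat (@polyC_inj C) f0.
by have [x x0 fx] := nonroot_nat (fun _ _ => id) fy; exists x, y.
Qed.

(* In [{poly {poly C}}] the coefficient of [x ^ i * y ^ j] is [f`_j`_i]. *)
Definition bimono (w : nat * nat) : bipoly := ('X^(w.1))%:P * 'X^(w.2).

Lemma eval2_bimono (x y : C) (w : nat * nat) :
  eval2 x y (bimono w) = x ^+ w.1 * y ^+ w.2.
Proof.
by rewrite /eval2 /bimono !(hornerM, hornerC, hornerXn, hornerX, horner_exp).
Qed.

Lemma coef_bimono (w : nat * nat) (i j : nat) :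
  (bimono w)`_j`_i = ((i, j) == w)%:R :> C.
Proof.
case: w => a b; rewrite /bimono coefCM coefXn /= -pair_eqE /=.
case: (j == b); first by rewrite mulr1 coefXn andbT.
by rewrite mulr0 coef0 andbF.
Qed.

(** Powers of [y] are removed first. If [y] still occurs, fix a nonzero [x] at which neither the
    leading nor the constant coefficient vanishes: a root in [y] exists and is nonzero, giving a
    zero on the torus. The remaining polynomial in [x] is treated alike. *)
Lemma no_torus_zero (f : bipoly) :
  (forall x y, x != 0 -> y != 0 -> eval2 x y f != 0) ->
  exists c w, c != 0 /\ f = c%:P%:P * bimono w.
Proof.
move=> hf; have f0 : f != 0.
  by apply: contraNneq (hf 1 1 (oner_neq0 _) (oner_neq0 _)) => ->; rewrite /eval2 !horner0.
have strip (D : idomainType) (p : {poly D}) : p != 0 ->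
    exists k q, p = q * 'X^k /\ q`_0 != 0.
  elim: {p}(size p) {-2}p (leqnn (size p)) => [|k IH] p sp p0.
    by move: sp; rewrite leqn0 size_poly_eq0 (negbTE p0).
  have [p00 | ne] := eqVneq p`_0 0; last by exists 0%N, p; rewrite mulr1.
  have : root p 0 by rewrite /root horner_coef0 p00.
  move/factor_theorem => [q]; rewrite subr0 => ep.
  have q0 : q != 0 by apply: contraNneq p0 => q0; rewrite ep q0 mul0r.
  have [|//|l [r [er r0]]] := IH q _ _.
    by move: sp; rewrite ep size_mulX.
  by exists l.+1, r; rewrite ep er -mulrA -exprSr.
have [b [q [ef q0]]] := strip _ _ f0.
have qn0 : q != 0 by apply: contraNneq q0 => ->; rewrite coef0.
have nz (x y : C) : x != 0 -> y != 0 -> q.[y%:P].[x] != 0.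
  move=> x0 y0; apply: contraNneq (hf x y x0 y0) => h.
  by rewrite ef eval2M /eval2 h mul0r.
have sq : (size q <= 1)%N.
  rewrite leqNgt; apply/negP => sq.
  have [x x0] : exists2 x : C, x != 0 & (lead_coef q * q`_0).[x] != 0.
    by apply: (@nonroot_nat _ id) => //; rewrite mulf_neq0 // lead_coef_eq0.
  rewrite hornerM mulf_eq0 negb_or => /andP[lx q0x].
  have sz : size (specialize x q) = size q by rewrite size_map_poly_id0.
  have [y /eqP hy] : exists y, root (specialize x q) y.
    by apply/closed_rootP; rewrite sz; case: (size q) sq => [|[]].
  have ev : (specialize x q).[y] = q.[y%:P].[x].
    have := horner_map (horner_eval x) q y%:P.
    by rewrite /= /horner_eval hornerC.
  have y0 : y != 0.
    apply: contraNneq q0x => y0; move: hy; rewrite y0 horner_coef0.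
    by rewrite coef_map /= /horner_eval => ->.
  by have := nz x y x0 y0; rewrite -ev hy eqxx.
have [a [r [eq0 r0]]] := strip _ _ q0.
have eq : q = (q`_0)%:P by apply: size1_polyC.
have rn0 : r != 0 by apply: contraNneq r0 => ->; rewrite coef0.
have sr : (size r <= 1)%N.
  rewrite leqNgt; apply/negP => sr.
  have [x /eqP hx] : exists x, root r x by apply/closed_rootP; case: (size r) sr => [|[]].
  have x0 : x != 0 by apply: contraNneq r0 => x0; rewrite -horner_coef0 -[X in r.[X]]x0 hx.
  by have := nz x 1 x0 (oner_neq0 _); rewrite eq hornerC eq0 hornerM hx mul0r eqxx.
exists r`_0, (a, b); split => //.
by rewrite ef {1}eq eq0 {1}(size1_polyC sr) polyCM mulrA.
Qed.

(** * Monomial valuations *)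

Definition wt (u v : int) (i j : nat) : int := u * i%:Z + v * j%:Z.

(** A lower bound for the valuation of weights [(u, v)]; stated as a relation, it holds for the zero
    polynomial with every [l]. *)
Definition order_ge (u v : int) (f : bipoly) (l : int) : Prop :=
  forall i j, f`_j`_i != 0 -> l <= wt u v i j.

Definition has_order (u v : int) (f : bipoly) (l : int) : Prop :=
  order_ge u v f l /\ exists i j, f`_j`_i != 0 /\ wt u v i j = l.

Lemma order_ge_leq (u v : int) (f : bipoly) (l l' : int) :
  l <= l' -> order_ge u v f l' -> order_ge u v f l.
Proof. by move=> h hf i j /hf; apply: le_trans. Qed.

Lemma order_geD (u v : int) (f g : bipoly) (l : int) :
  order_ge u v f l -> order_ge u v g l -> order_ge u v (f + g) l.
Proof.
move=> hf hg i j; rewrite !coefD; have [->|/hf //] := eqVneq (f`_j`_i) 0.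
by rewrite add0r => /hg.
Qed.

Lemma order_ge_sum (I : Type) (s : seq I) (u v : int) (F : I -> bipoly) (l : int) :
  (forall i, order_ge u v (F i) l) -> order_ge u v (\sum_(i <- s) F i) l.
Proof.
move=> hF; elim: s => [|i s IH]; last by rewrite big_cons; exact: order_geD.
by rewrite big_nil => i j; rewrite !coef0 eqxx.
Qed.

Lemma order_geM (u v : int) (f g : bipoly) (l m : int) :
  order_ge u v f l -> order_ge u v g m -> order_ge u v (f * g) (l + m).
Proof.
move=> hf hg i j; rewrite coefM coef_sum => h.
have [k hk] : exists k : 'I_j.+1, (f`_k * g`_(j - k))`_i != 0.
  apply/existsP; apply: contraNT h => /existsPn h.
  by rewrite big1 // => k _; apply/eqP; have := h k; rewrite negbK.
have [r] : exists r : 'I_i.+1, f`_k`_r * g`_(j - k)`_(i - r) != 0.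
  apply/existsP; apply: contraNT hk => /existsPn h'.
  by rewrite coefM big1 // => r _; apply/eqP; have := h' r; rewrite negbK.
rewrite mulf_eq0 negb_or => /andP[/hf h1 /hg h2].
apply: le_trans (lerD h1 h2) _; rewrite /wt.
have -> : i%:Z = r%:Z + (i - r)%N%:Z by rewrite -PoszD subnKC // -ltnS.
have -> : j%:Z = k%:Z + (j - k)%N%:Z by rewrite -PoszD subnKC // -ltnS.
by rewrite le_eqVlt; apply/orP; left; apply/eqP; ring.
Qed.

Lemma has_order_exists (u v : int) (f : bipoly) : f != 0 -> exists l, has_order u v f l.
Proof.
move=> f0.
(* Weights may be negative; shifting them by [K] allows taking a minimum in [nat]. *)
have [K hK] : exists K : int, order_ge u v f (- K).
  exists (`|u| * (\max_(j < size f) size (f`_j)%R)%N%:Z + `|v| * (size f)%:Z) => i j fij.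
  have jf : (j < size f)%N.
    by rewrite ltnNge; apply: contra fij => h; rewrite (nth_default _ h) coef0.
  have fi : (i < size (f`_j)%R)%N.
    by rewrite ltnNge; apply: contra fij => h; rewrite (nth_default _ h).
  have im : (i <= \max_(j < size f) size (f`_j)%R)%N.
    by apply: leq_trans (ltnW fi) _; exact: (leq_bigmax (Ordinal jf)).
  rewrite /wt opprD lerD // lerNl.
    by apply: le_trans (ler_norm _) _; rewrite normrN normrM ler_wpM2l // ger0_norm.
  by apply: le_trans (ler_norm _) _; rewrite normrN normrM ler_wpM2l // ger0_norm // lez_nat ltnW.
have [i [j fij]] : exists i j, f`_j`_i != 0.
  exists (size (lead_coef f)).-1, (size f).-1.
  by rewrite -!lead_coefE !lead_coef_eq0.
pose P n := `[< exists i j, f`_j`_i != 0 /\ wt u v i j + K = n%:Z >].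
have ex : exists n, P n.
  have := hK i j fij; rewrite -subr_ge0 opprK; case e: (_ + K) => [n|//] _.
  by exists n; apply/asboolP; exists i, j.
have [n /asboolP[i' [j' [h e]]] minn_] := ex_minnP ex.
exists (n%:Z - K); split; last by exists i', j'; rewrite -e addrK.
move=> a b fab; rewrite lerBlDr.
have h' := hK a b fab; rewrite -subr_ge0 opprK in h'.
case e': (_ + K) h' => [l|//] _.
by rewrite lez_nat; apply: minn_; apply/asboolP; exists a, b.
Qed.

Definition initial (u v l : int) (f : bipoly) : bipoly :=
  \poly_(j < size f) \poly_(i < size f`_j) (if wt u v i j == l then f`_j`_i else 0).

Lemma coef_initial (u v l : int) (f : bipoly) (i j : nat) :
  (initial u v l f)`_j`_i = if wt u v i j == l then f`_j`_i else 0.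
Proof.
rewrite coef_poly; case: ltnP => [_|h].
  rewrite coef_poly; case: ltnP => // h; rewrite (nth_default _ h).
  by case: ifP.
by rewrite (nth_default _ h) !coef0; case: ifP.
Qed.

(* The initial parts multiply to a nonzero polynomial and all other products have
   larger weight. *)
Lemma has_orderM (u v : int) (f g : bipoly) (l m : int) :
  has_order u v f l -> has_order u v g m -> has_order u v (f * g) (l + m).
Proof.
move=> [fl [i [j [fij ef]]]] [gm [i' [j' [gij eg]]]].
split; first exact: order_geM.
pose f0 := initial u v l f; pose g0 := initial u v m g.
(* The bound for the opposite weights says that the initial part has no term of weight above [k];
   together the bounds fix the weight of every term of [f0 * g0]. *)
have init (h : bipoly) (k : int) : order_ge u v h k ->
    [/\ order_ge u v (initial u v k h) k, order_ge (- u) (- v) (initial u v k h) (- k)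
      & order_ge u v (h - initial u v k h) (k + 1)].
  move=> hk; split => a b; rewrite ?coefB coef_initial; case: (wt u v a b =P k) => [e|ne]; rewrite ?eqxx //.
  - by rewrite e.
  - by rewrite -e /wt !mulNr -opprD.
  - by rewrite subrr eqxx.
  - by rewrite subr0 => /hk; rewrite le_eqVlt => /predU1P[e|]; [case: ne|rewrite lezD1].
have [f1 f2 f3] := init f l fl; have [g1 g2 g3] := init g m gm.
have fg0 : f0 * g0 != 0.
  rewrite mulf_neq0 //; [apply: contraNneq fij|apply: contraNneq gij] => e.
    by have := coef_initial u v l f i j; rewrite [initial _ _ _ _]e !coef0 ef eqxx => <-.
  by have := coef_initial u v m g i' j'; rewrite [initial _ _ _ _]e !coef0 eg eqxx => <-.
have [a [b fgab]] : exists a b, (f0 * g0)`_b`_a != 0.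
  exists (size (lead_coef (f0 * g0))).-1, (size (f0 * g0)).-1.
  by rewrite -!lead_coefE !lead_coef_eq0.
have wab : wt u v a b = l + m.
  apply: le_anti; rewrite (order_geM f1 g1 fgab) andbT.
  have := order_geM f2 g2 fgab.
  by rewrite /wt !mulNr -!opprD lerN2.
have rest : order_ge u v (f0 * (g - g0) + (f - f0) * g) (l + m + 1).
  apply: order_geD; first by rewrite -addrA; exact: order_geM.
  by rewrite addrAC; exact: order_geM.
exists a, b; split => //.
have -> : f * g = f0 * g0 + (f0 * (g - g0) + (f - f0) * g) by ring.
move: (_ + _ * g) rest => h rest; rewrite coefD coefD.
have [->|/rest] := eqVneq h`_b`_a 0; first by rewrite addr0.
by rewrite wab lezD1 ltxx.
Qed.

Lemma has_orderX (u v : int) (f : bipoly) (l : int) (n : nat) :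
  has_order u v f l -> has_order u v (f ^+ n) (l *+ n).
Proof.
move=> h; elim: n => [|n IH]; last by rewrite exprS mulrS; exact: has_orderM.
split.
  move=> i j; rewrite coef1; case: (j =P 0%N) => [->|_]; last by rewrite coef0 eqxx.
  by rewrite coef1; case: (i =P 0%N) => [->|_]; rewrite ?eqxx // /wt !mulr0.
by exists 0%N, 0%N; rewrite !coef1 /= oner_neq0 /wt !mulr0.
Qed.

End BivariateEval.

(** * Torus polynomials and projective points *)

Section TorusPolynomial.
Variables (C : numClosedFieldType) (n : nat) (p : 'I_n -> nat * nat).
Notation bipoly := {poly {poly C}}.

(** Pullback along the monomial parametrization; the forms in its kernel are those vanishing on the
    toric surface. *)
Definition torus_poly : {mpoly C[n]} -> bipoly :=
  mmap (polyC \o polyC) (fun i => bimono C (p i)).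

HB.instance Definition _ := GRing.RMorphism.on torus_poly.

Lemma torus_poly0 : torus_poly 0 = 0.
Proof. exact: rmorph0. Qed.

Lemma torus_polyD (F G : {mpoly C[n]}) : torus_poly (F + G) = torus_poly F + torus_poly G.
Proof. exact: rmorphD. Qed.

Lemma torus_polyB (F G : {mpoly C[n]}) : torus_poly (F - G) = torus_poly F - torus_poly G.
Proof. exact: rmorphB. Qed.

Lemma torus_polyM (F G : {mpoly C[n]}) : torus_poly (F * G) = torus_poly F * torus_poly G.
Proof. exact: rmorphM. Qed.

Lemma torus_polyXn (F : {mpoly C[n]}) (k : nat) : torus_poly (F ^+ k) = torus_poly F ^+ k.
Proof. exact: rmorphXn. Qed.

Lemma torus_poly_sum (I : Type) (s : seq I) (P : pred I) (F : I -> {mpoly C[n]}) :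
  torus_poly (\sum_(i <- s | P i) F i) = \sum_(i <- s | P i) torus_poly (F i).
Proof. exact: rmorph_sum. Qed.

Lemma bimonoM (u v : nat * nat) :
  bimono C u * bimono C v = bimono C (u.1 + v.1, u.2 + v.2)%N.
Proof. by rewrite /bimono /= !exprD polyCM; ring. Qed.

Lemma torus_poly_monom (m : 'X_{1..n}) :
  torus_poly 'X_[m] = bimono C (mexpw p m).
Proof.
rewrite /torus_poly mmapX /mmap1 /mexpw /bimono /= -!prodrXr rmorph_prod -big_split.
apply: eq_bigr => i _ /=; rewrite exprMn -!exprM -polyC_exp -exprM.
by rewrite ![(m i * _)%N]mulnC.
Qed.

Lemma torus_polyZ (c : C) (F : {mpoly C[n]}) :
  torus_poly (c *: F) = c%:P%:P * torus_poly F.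
Proof. exact: mmapZ. Qed.

Lemma torus_polyE (F : {mpoly C[n]}) :
  torus_poly F = \sum_(m <- msupp F) (F@_m)%:P%:P * bimono C (mexpw p m).
Proof.
rewrite {1}[F]mpolyE torus_poly_sum; apply: eq_bigr => m _.
by rewrite -torus_poly_monom; exact: torus_polyZ.
Qed.

Lemma eval2_torus_poly (x y : C) (F : {mpoly C[n]}) :
  eval2 x y (torus_poly F) = F.@[fun i => x ^+ (p i).1 * y ^+ (p i).2].
Proof.
rewrite torus_polyE mevalE /eval2 !horner_sum; apply: eq_bigr => m _.
rewrite -[LHS]/(eval2 x y ((F@_m)%:P%:P * bimono C (mexpw p m))) eval2M.
rewrite eval2_bimono {1}/eval2 !hornerC; congr (_ * _); rewrite /mexpw /=.
rewrite -!prodrXr -big_split; apply: eq_bigr => i _ /=.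
by rewrite exprMn -!exprM ![(m i * _)%N]mulnC.
Qed.

Lemma coef_torus_poly (F : {mpoly C[n]}) (i j : nat) :
  (torus_poly F)`_j`_i = \sum_(m <- msupp F | mexpw p m == (i, j)) F@_m.
Proof.
rewrite torus_polyE !coef_sum [RHS]big_mkcond; apply: eq_bigr => m _.
by rewrite coefCM coefCM coef_bimono eq_sym; case: eqP; rewrite ?mulr1 ?mulr0.
Qed.

Lemma torus_poly_supp (k : nat) (F : {mpoly C[n]}) (i j : nat) :
  F \is k.-homog -> (torus_poly F)`_j`_i != 0 ->
  exists2 m, mdeg m = k & mexpw p m = (i, j).
Proof.
move=> /dhomogP hF; rewrite coef_torus_poly => h.
have [m [mF /eqP mw]] : exists m, m \in msupp F /\ mexpw p m == (i, j).
  apply: contrapT => hn; move/eqP: h; apply.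
  by rewrite big1_seq // => m /andP[mw mF]; case: hn; exists m.
by exists m => //; apply: hF.
Qed.

Lemma torus_poly_surj (k : nat) (g : bipoly) :
  (forall i j, g`_j`_i != 0 -> exists2 m, mdeg m = k & mexpw p m = (i, j)) ->
  exists2 F, F \is k.-homog & torus_poly F = g.
Proof.
move=> hg.
have mon i j : exists2 F : {mpoly C[n]}, F \is k.-homog &
    torus_poly F = (g`_j`_i)%:P%:P * bimono C (i, j).
  have [->|/hg[m mk mw]] := eqVneq g`_j`_i 0.
    by exists 0; rewrite ?dhomog0 // torus_poly0 polyC0 mul0r.
  exists (g`_j`_i *: 'X_[m]); first by apply: dhomogZ; rewrite dhomogX; apply/eqP.
  by rewrite torus_polyZ torus_poly_monom mw.
have sums (I : Type) (s : seq I) (h : I -> bipoly) :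
    (forall i, exists2 F : {mpoly C[n]}, F \is k.-homog & torus_poly F = h i) ->
    exists2 F : {mpoly C[n]}, F \is k.-homog & torus_poly F = \sum_(i <- s) h i.
  move=> hs; elim: s => [|i s [F hF eF]].
    by exists 0; rewrite ?dhomog0 // torus_poly0 big_nil.
  have [G hG eG] := hs i.
  by exists (G + F); rewrite ?dhomogD // torus_polyD big_cons eF eG.
have [F hF eF] := sums _ (index_iota 0 (size g)) _ (fun j =>
  sums _ (index_iota 0 (size g`_j)) _ (fun i => mon i j)).
exists F => //; rewrite eF -[RHS]coefK poly_def big_mkord; apply: eq_bigr => j _.
rewrite -mul_polyC -[in RHS](coefK g`_j) poly_def big_mkord rmorph_sum mulr_suml.
apply: eq_bigr => i _; rewrite /bimono mulrA /= -mul_polyC polyCM.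
by [].
Qed.

End TorusPolynomial.

Section ProjectivePoints.
Variables (C : fieldType) (n : nat).
Implicit Types (v : 'rV[C]_n.+1) (L : {vspace 'rV[C]_n.+1}).

Lemma proj_space_vpick L : proj_space L -> vpick L != 0 /\ L = <[vpick L]>%VS.
Proof.
move=> h; have v0 : vpick L != 0.
  by rewrite vpick0; apply: contra_eq_neq h => ->; rewrite dimv0.
split=> //; apply/esym/eqP; rewrite eqEdim -memvE memv_pick.
by rewrite dim_vline v0 h.
Qed.

Lemma proj_space_vline v : v != 0 -> proj_space <[v]>%VS.
Proof. by move=> v0; rewrite /proj_space /= dim_vline v0. Qed.

Lemma vlineZ (c : C) v : c != 0 -> <[c *: v]>%VS = <[v]>%VS.
Proof.
move=> c0; apply/eqP; rewrite eqEsubv -!memvE memvZ ?memv_line //=.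
by rewrite -[X in X \in _](scalerK c0) memvZ // memv_line.
Qed.

Lemma hcoord_vline v : v != 0 ->
  exists2 c, c != 0 & hcoord <[v]>%VS =1 (fun i => c * v 0 i).
Proof.
move=> v0; have := memv_pick <[v]>%VS; move/vlineP => [c ec].
exists c; last by move=> i; rewrite /hcoord ec mxE.
have [h _] := proj_space_vpick (proj_space_vline v0).
by apply: contraNneq h => c0; rewrite ec c0 scale0r.
Qed.

Lemma vline_eq L v (c : C) : proj_space L -> c != 0 ->
  (forall i, hcoord L i = c * v 0 i) -> L = <[v]>%VS.
Proof.
move=> /proj_space_vpick[_ eL] c0 h; rewrite {1}eL -(vlineZ v c0); congr (<[_]>)%VS.
by apply/rowP => i; rewrite mxE -h.
Qed.

Lemma hcoord_neq0 L : proj_space L -> exists i, hcoord L i != 0.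
Proof.
move=> /proj_space_vpick[v0 _]; apply: contrapT => h; move/eqP: v0; apply.
apply/rowP => i; rewrite mxE; apply/eqP/negPn/negP => hi; apply: h.
by exists i.
Qed.

Lemma meval_homogZ (k : nat) (F : {mpoly C[n.+1]}) (c : C) (u : 'I_n.+1 -> C) :
  F \is k.-homog -> F.@[fun i => c * u i] = c ^+ k * F.@[u].
Proof.
move=> /dhomogP hF; rewrite !mevalE mulr_sumr; apply: eq_big_seq => m /hF <-.
under eq_bigr do rewrite exprMn; rewrite big_split /= prodrXr -mdegE; ring.
Qed.

Lemma meval_hcoord (k : nat) (F : {mpoly C[n.+1]}) L v (c : C) :
  F \is k.-homog -> (forall i, hcoord L i = c * v 0 i) ->
  F.@[hcoord L] = c ^+ k * F.@[acoord v].
Proof. by move=> hF h; rewrite (meval_eq _ h) (meval_homogZ _ _ hF). Qed.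

Lemma meval_vline_eq0 (k : nat) (F : {mpoly C[n.+1]}) v :
  v != 0 -> F \is k.-homog ->
  (F.@[hcoord <[v]>%VS] == 0) = (F.@[acoord v] == 0).
Proof.
move=> v0 hF; have [c c0 h] := hcoord_vline v0.
by rewrite (meval_hcoord hF h) mulf_eq0 expf_eq0 (negbTE c0) andbF.
Qed.

End ProjectivePoints.

(** * Zariski topology, maps given by forms, affine charts *)

Section ProjectiveTopology.
Variables (C : fieldType) (n : nat).
Notation points := {vspace 'rV[C]_n.+1}.
Implicit Types (X U V Z : set points).

Lemma proj_closureE (E : set points) : E `<=` @proj_space C n ->
  proj_closure E = [set L | proj_space L /\ forall k (F : {mpoly C[n.+1]}),
    F \is k.-homog -> vanishes E F -> F.@[hcoord L] = 0].
Proof.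
move=> hE; apply/seteqP; split=> L.
  move=> /(_ [set L | proj_space L /\ forall k (F : {mpoly C[n.+1]}),
    F \is k.-homog -> vanishes E F -> F.@[hcoord L] = 0]); apply; split.
    exists [set F | (exists k, F \is k.-homog) /\ vanishes E F]; first by move=> F [].
    apply/seteqP; split=> K [hK h]; split=> //.
      by move=> F [[k hF] hv]; apply: (h k).
    by move=> k F hF hv; apply: h; split=> //; exists k.
  by move=> K hK; split=> [|k F _]; [exact: hE|apply].
move=> [hL h] Z [[D hD ->] hZ]; split=> // F DF.
have [k hF] := hD F DF; apply: (h k F hF) => K /hZ [_]; exact.
Qed.

Lemma proj_opensP X U : X `<=` @proj_space C n ->
  proj_opens X U <-> U `<=` X /\ forall L, U L -> exists k (F : {mpoly C[n.+1]}),
    [/\ F \is k.-homog, F.@[hcoord L] != 0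
      & forall K, X K -> F.@[hcoord K] != 0 -> U K].
Proof.
move=> hX; split.
  move=> [Z [E hE ->] ->]; split=> [L []//|L [XL hL]].
  have [F [EF FL]] : exists F, E F /\ F.@[hcoord L] != 0.
    apply: contrapT => hn; apply: hL; split; first exact: hX.
    by move=> F EF; apply/eqP/negPn/negP => h; apply: hn; exists F.
  have [k hF] := hE F EF; exists k, F; split => // K XK FK; split=> // -[_ h].
  by rewrite h // eqxx in FK.
move=> [UX hU]; exists [set L | proj_space L /\ forall F : {mpoly C[n.+1]},
    (exists k, F \is k.-homog) /\ vanishes (X `\` U) F -> F.@[hcoord L] = 0].
  by exists [set F | (exists k, F \is k.-homog) /\ vanishes (X `\` U) F]; first by move=> F [].
apply/seteqP; split=> L.
  move=> UL; split; first exact: UX.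
  have [k [F [hF FL hK]]] := hU L UL; move=> [_ h]; move/eqP: FL; apply.
  apply: h; split; first by exists k.
  by move=> K [XK UK]; apply/eqP/negPn/negP => h; apply: UK; exact: hK.
move=> [XL hL]; apply: contrapT => UL; apply: hL; split; first exact: hX.
by move=> F [_]; apply.
Qed.

Lemma proj_opens_basic X (k : nat) (F : {mpoly C[n.+1]}) :
  X `<=` @proj_space C n -> F \is k.-homog ->
  proj_opens X [set L | X L /\ F.@[hcoord L] != 0].
Proof.
move=> hX hF; apply/proj_opensP => //; split=> [L []//|L [XL FL]].
by exists k, F; split.
Qed.

Lemma proj_opensT X : X `<=` @proj_space C n -> proj_opens X X.
Proof.
move=> hX; apply/proj_opensP => //; split=> // L XL; exists 0%N, 1.
by split; rewrite ?dhomog1 // meval1 oner_neq0.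
Qed.

Lemma proj_opensI X U V : X `<=` @proj_space C n ->
  proj_opens X U -> proj_opens X V -> proj_opens X (U `&` V).
Proof.
move=> hX /(proj_opensP _ hX)[UX hU] /(proj_opensP _ hX)[VX hV].
apply/(proj_opensP _ hX); split=> [L [/UX]//|L [UL VL]].
have [k [F [hF FL FU]]] := hU L UL; have [l [G [hG GL GV]]] := hV L VL.
exists (k + l)%N, (F * G); split; first exact: dhomogM.
  by rewrite mevalM mulf_neq0.
move=> K XK; rewrite mevalM mulf_eq0 negb_or => /andP[FK GK].
by split; [exact: FU|exact: GV].
Qed.

End ProjectiveTopology.

Section FormMaps.
Variables (C : fieldType) (m n : nat).

Definition subst_forms (G : 'I_n -> {mpoly C[m]}) (F : {mpoly C[n]}) : {mpoly C[m]} :=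
  \sum_(e <- msupp F) F@_e *: \prod_i G i ^+ e i.

Lemma meval_subst_forms (G : 'I_n -> {mpoly C[m]}) (F : {mpoly C[n]}) (u : 'I_m -> C) :
  (subst_forms G F).@[u] = F.@[fun i => (G i).@[u]].
Proof.
rewrite /subst_forms raddf_sum mevalE; apply: eq_bigr => e _ /=.
rewrite mevalZ rmorph_prod; congr (_ * _); apply: eq_bigr => i _ /=.
by rewrite rmorphXn.
Qed.

Lemma subst_forms_homog (k l : nat) (G : 'I_n -> {mpoly C[m]}) (F : {mpoly C[n]}) :
  (forall i, G i \is k.-homog) -> F \is l.-homog ->
  subst_forms G F \is (k * l).-homog.
Proof.
move=> hG /dhomogP hF; rewrite /subst_forms big_seq; apply: rpred_sum => e eF.
apply: dhomogZ; rewrite -(hF e eF) /= mdegE big_distrr /=.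
elim/big_rec2: _ => [|i x y _ hx]; first exact: dhomog1.
by rewrite dhomogM // dhomogMn.
Qed.

(** The factor [c] depends on [L], because [hcoord] picks representatives of [L] and of [f L]
    independently. *)
Definition given_by_forms (W : set {vspace 'rV[C]_m.+1})
    (f : {vspace 'rV[C]_m.+1} -> {vspace 'rV[C]_n.+1}) : Prop :=
  exists k (G : 'I_n.+1 -> {mpoly C[m.+1]}), (forall i, G i \is k.-homog) /\
    forall L, W L -> exists2 c, c != 0 &
      forall i, hcoord (f L) i = c * (G i).@[hcoord L].

End FormMaps.

Section FormMorphisms.
Variables (C : fieldType) (m n : nat).
Variables (X W : set {vspace 'rV[C]_m.+1}) (X' : set {vspace 'rV[C]_n.+1}).
Variable f : {vspace 'rV[C]_m.+1} -> {vspace 'rV[C]_n.+1}.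
Hypotheses (hX : X `<=` @proj_space C m) (hX' : X' `<=` @proj_space C n).
Hypotheses (hW : proj_opens X W) (hf : given_by_forms W f).
Hypothesis fW : forall L, W L -> X' (f L).

Lemma form_map_open (V : set {vspace 'rV[C]_n.+1}) :
  proj_opens X' V -> proj_opens X (W `&` f @^-1` V).
Proof.
move=> /(proj_opensP _ hX')[VX' hV].
have /(proj_opensP _ hX)[WX hW'] := hW.
have [k [G [hG fG]]] := hf.
apply/(proj_opensP _ hX); split=> [L [/WX]//|L [WL VL]].
have [l [F [hF FL FV]]] := hV _ VL; have [l' [F' [hF' FL' FW']]] := hW' _ WL.
have sub K : W K -> ((subst_forms G F).@[hcoord K] == 0) = (F.@[hcoord (f K)] == 0).
  move=> WK; have [c c0 h] := fG K WK; rewrite (meval_eq _ h) (meval_homogZ _ _ hF).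
  by rewrite mulf_eq0 expf_eq0 (negbTE c0) andbF meval_subst_forms.
exists (l' + k * l)%N, (F' * subst_forms G F); split.
- by rewrite dhomogM // subst_forms_homog.
- by rewrite mevalM mulf_neq0 // sub.
move=> K XK; rewrite mevalM mulf_eq0 negb_or => /andP[F'K FK].
have WK := FW' K XK F'K; split => //; apply: FV; first exact: fW.
by rewrite -sub.
Qed.

Lemma form_map_regular (V : set {vspace 'rV[C]_n.+1}) (g : {vspace 'rV[C]_n.+1} -> C) :
  locally (proj_opens X') (@proj_frac C n) V g ->
  locally (proj_opens X) (@proj_frac C m) (W `&` f @^-1` V) (g \o f).
Proof.
move=> hg L [WL VL]; have [V' [oV' V'L V'V [l [F [H [hF hH FH]]]]]] := hg _ VL.
exists (W `&` f @^-1` V'); split => //; first exact: form_map_open.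
  by move=> K [WK VK]; split => //; exact: V'V.
have [k [G [hG fG]]] := hf.
exists (k * l)%N, (subst_forms G F), (subst_forms G H).
split; rewrite ?subst_forms_homog // => K [WK VK].
have [c c0 h] := fG K WK; have [H0 e] := FH _ VK.
move: H0 e; rewrite (meval_eq F h) (meval_eq H h) !(meval_homogZ _ _ hF) !(meval_homogZ _ _ hH).
rewrite !meval_subst_forms mulf_eq0 expf_eq0 (negbTE c0) andbF /= => H0 e.
split=> //; rewrite [LHS]e invfM mulrACA divff ?mul1r // expf_neq0 //.
Qed.

Lemma form_map_morphism (W' : set {vspace 'rV[C]_n.+1}) :
  (forall L, W L -> W' (f L)) ->
  @Defs.morphism C (@Defs.restrict C (proj_variety X) W) (@Defs.restrict C (proj_variety X') W') f.
Proof.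
move=> fW'; split=> //.
  move=> V [oV _]; split; first exact: form_map_open.
  by move=> L [].
by move=> V g [oV _]; exact: form_map_regular.
Qed.

End FormMorphisms.

Section AffineTopology.
Variables (C : fieldType) (n : nat).

Lemma affine_opensP (X U : set 'rV[C]_n) :
  affine_opens X U <-> U `<=` X /\ forall v, U v -> exists F : {mpoly C[n]},
    F.@[acoord v] != 0 /\ forall u, X u -> F.@[acoord u] != 0 -> U u.
Proof.
split.
  move=> [Z [E ->] ->]; split=> [v []//|v [Xv hv]].
  have [F [EF Fv]] : exists F, E F /\ F.@[acoord v] != 0.
    apply: contrapT => hn; apply: hv => F EF.
    by apply/eqP/negPn/negP => h; apply: hn; exists F.
  exists F; split=> // u Xu Fu; split=> // h.
  by rewrite h // eqxx in Fu.
move=> [UX hU]; pose E := [set F : {mpoly C[n]} |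
  forall u, (X `\` U) u -> F.@[acoord u] = 0].
exists [set v | forall F, E F -> F.@[acoord v] = 0]; first by exists E.
apply/seteqP; split=> v.
  move=> Uv; split; first exact: UX.
  have [F [Fv hF]] := hU v Uv; move=> h; move/eqP: Fv; apply; apply: h.
  by move=> u [Xu Uu]; apply/eqP/negPn/negP => h; apply: Uu; exact: hF.
move=> [Xv hv]; apply: contrapT => Uv; apply: hv.
by move=> F; apply.
Qed.

End AffineTopology.

(** * Affine charts of a projective variety *)

Section AffineChart.
Variables (C : fieldType) (n : nat) (X : set {vspace 'rV[C]_n.+1}) (j : 'I_n.+1).
Hypothesis hX : X `<=` @proj_space C n.
Hypothesis cX : proj_closed X.

Definition dehomogenize (L : {vspace 'rV[C]_n.+1}) : 'I_n.+1 -> C :=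
  fun i => hcoord L i / hcoord L j.

Definition chart : set {vspace 'rV[C]_n.+1} := [set L | X L /\ hcoord L j != 0].

(** Every large degree is allowed, so that numerator and denominator of a fraction can be brought to
    a common one. *)
Lemma homogenize (F : {mpoly C[n.+1]}) : exists k0, forall k, (k0 <= k)%N ->
  exists2 H : {mpoly C[n.+1]}, H \is k.-homog &
    forall x : 'I_n.+1 -> C, x j != 0 -> H.@[x] = x j ^+ k * F.@[fun i => x i / x j].
Proof.
exists (msize F) => k hk.
exists (\sum_(e <- msupp F) F@_e *: ('X_j ^+ (k - mdeg e) * 'X_[e])).
  rewrite big_seq; apply: rpred_sum => e eF; apply: dhomogZ.
  have ek : (mdeg e <= k)%N by apply: leq_trans hk; apply: ltnW; exact: msize_mdeg_lt.
  rewrite -[X in X.-homog](subnK ek) dhomogM // ?dhomogX //.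
  by rewrite -[X in X.-homog]mul1n dhomogMn // dhomogX /= mdeg1.
move=> x xj; rewrite raddf_sum [in RHS]mevalE mulr_sumr; apply: eq_big_seq => e eF /=.
have ek : (mdeg e <= k)%N by apply: leq_trans hk; apply: ltnW; exact: msize_mdeg_lt.
rewrite mevalZ mevalM rmorphXn /= mevalXU mevalX [RHS]mulrCA; congr (_ * _).
have -> : \prod_i (x i / x j) ^+ e i = \prod_i x i ^+ e i / x j ^+ mdeg e.
  under eq_bigr do rewrite expr_div_n.
  by rewrite prodf_div prodrXr -mdegE.
rewrite -{2}(subnK ek) exprD -mulrA; congr (_ * _).
by rewrite mulrC mulfVK // expf_neq0.
Qed.

Lemma chart_open : proj_opens X chart.
Proof.
have -> : chart = [set L | X L /\ ('X_j : {mpoly C[n.+1]}).@[hcoord L] != 0].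
  by apply/seteqP; split=> L; rewrite /chart /= mevalXU.
by apply: (@proj_opens_basic _ _ _ 1) => //; rewrite dhomogX /= mdeg1.
Qed.

(** The chart is identified with the section [x_j = 1] of the affine cone over [X]; keeping the
    constant coordinate avoids renumbering the others. *)
Lemma chart_affine : affine (@Defs.restrict C (proj_variety X) chart).
Proof.
have [E hE eX] := cX.
pose phi (L : {vspace 'rV[C]_n.+1}) : 'rV[C]_n.+1 := \row_i dehomogenize L i.
pose Z : set 'rV[C]_n.+1 := [set v | forall F : {mpoly C[n.+1]},
  E F \/ F = 'X_j - 1 -> F.@[acoord v] = 0].
have Zj v : Z v -> v 0 j = 1.
  move=> /(_ ('X_j - 1) (or_intror erefl)); rewrite mevalB mevalXU meval1.
  by move/eqP; rewrite subr_eq0 => /eqP.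
have Zn0 v : Z v -> v != 0.
  by move=> /Zj h; apply: contra_eq_neq h => ->; rewrite mxE eq_sym oner_neq0.
have ac L : acoord (phi L) =1 dehomogenize L by move=> i; rewrite /acoord mxE.
have hom L (k : nat) (F : {mpoly C[n.+1]}) : F \is k.-homog ->
    F.@[acoord (phi L)] = (hcoord L j)^-1 ^+ k * F.@[hcoord L].
  move=> hF; rewrite -(meval_homogZ _ _ hF); apply: meval_eq => i.
  by rewrite ac mulrC.
have phiZ L : chart L -> Z (phi L).
  move=> [XL Lj] F [EF | ->].
    have [k hF] := hE F EF; rewrite (hom L k F hF).
    by move: XL; rewrite eX => -[_ ->] //; rewrite mulr0.
  by rewrite mevalB mevalXU meval1 ac /dehomogenize divff ?subrr.
have gch v : Z v -> chart <[v]>%VS.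
  move=> Zv; have v0 := Zn0 v Zv; have [c c0 h] := hcoord_vline v0.
  split; last by rewrite h (Zj v Zv) mulr1.
  rewrite eX; split; first exact: proj_space_vline.
  move=> F EF; have [k hF] := hE F EF; rewrite (meval_hcoord hF h).
  by rewrite Zv ?mulr0 //; left.
have gphi L : chart L -> <[phi L]>%VS = L.
  move=> [XL Lj]; apply: esym; apply: (vline_eq (hX XL) Lj) => i.
  by rewrite mxE /dehomogenize mulrC divfK.
have phig v : Z v -> phi <[v]>%VS = v.
  move=> Zv; have [c c0 h] := hcoord_vline (Zn0 v Zv).
  apply/rowP => i; rewrite mxE /dehomogenize !h (Zj v Zv) mulr1.
  by rewrite mulrC mulKf.
have homog2 (F G : {mpoly C[n.+1]}) : exists k (F' G' : {mpoly C[n.+1]}),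
    [/\ F' \is k.-homog, G' \is k.-homog & forall L, hcoord L j != 0 ->
      F'.@[hcoord L] = hcoord L j ^+ k * F.@[acoord (phi L)] /\
      G'.@[hcoord L] = hcoord L j ^+ k * G.@[acoord (phi L)]].
  have [k1 h1] := homogenize F; have [k2 h2] := homogenize G.
  have [F' hF eF] := h1 _ (leq_maxl k1 k2); have [G' hG eG] := h2 _ (leq_maxr k1 k2).
  exists (maxn k1 k2), F', G'; split=> // L Lj; split.
    by rewrite eF // (meval_eq _ (ac L)).
  by rewrite eG // (meval_eq _ (ac L)).
have op1 V : affine_opens Z V -> proj_opens X (chart `&` phi @^-1` V).
  move=> /affine_opensP[VZ hV]; apply/(proj_opensP _ hX); split; first by move=> L [[]].
  move=> L [[XL Lj] VL]; have [F [FL hF]] := hV _ VL.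
  have [k [F' [G' [hF' _ eF]]]] := homog2 F F.
  exists (1 + k)%N, ('X_j * F'); split.
  - by rewrite dhomogM // dhomogX /= mdeg1.
  - by rewrite mevalM mevalXU (eF L Lj).1 !mulf_neq0 // expf_neq0.
  move=> K XK; rewrite mevalM mevalXU mulf_eq0 negb_or => /andP[Kj].
  rewrite (eF K Kj).1 mulf_eq0 negb_or => /andP[_ FK].
  by split=> //; apply: hF => //; apply: phiZ.
have op2 V : proj_opens X V -> affine_opens Z (Z `&` (fun v => <[v]>%VS) @^-1` V).
  move=> /(proj_opensP _ hX)[VX hV]; apply/affine_opensP; split; first by move=> v [].
  move=> v [Zv Vv]; have [k [F [hF FL FV]]] := hV _ Vv; exists F.
  rewrite (meval_vline_eq0 (Zn0 v Zv) hF) in FL; split=> // u Zu Fu.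
  split=> //; apply: FV; first by case: (gch u Zu).
  by rewrite (meval_vline_eq0 (Zn0 u Zu) hF).
exists n.+1, Z, phi; split.
  by exists [set F | E F \/ F = 'X_j - 1].
split.
  split=> //=.
    by move=> V oV; split; [exact: op1 | move=> L []].
  move=> V g oV hg L [cL VL]; have [V' [oV' V'L V'V [F [G FG]]]] := hg _ VL.
  exists (chart `&` phi @^-1` V'); split=> //; first exact: op1.
    by move=> K [cK VK]; split=> //; exact: V'V.
  have [k [F' [G' [hF hG e]]]] := homog2 F G.
  exists k, F', G'; split=> // K [[XK Kj] VK].
  have [G0 eg] := FG _ VK; have [-> ->] := e K Kj.
  split; first by rewrite mulf_neq0 // expf_neq0.
  by rewrite [LHS]eg invfM mulrACA divff ?mul1r // expf_neq0.
exists (fun v => <[v]>%VS); split=> //.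
split=> //=; first by move=> V [oV _]; exact: op2.
move=> V g [oV _] hg v [Zv Vv]; have [V' [oV' V'v V'V [k [F [G [hF hG FG]]]]]] := hg _ Vv.
exists (Z `&` (fun v => <[v]>%VS) @^-1` V'); split=> //; first exact: op2.
  by move=> u [Zu Vu]; split=> //; exact: V'V.
exists F, G => u [Zu Vu]; have [G0 eg] := FG _ Vu.
split; first by rewrite -(meval_vline_eq0 (Zn0 u Zu) hG).
have [c c0 h] := hcoord_vline (Zn0 u Zu).
rewrite [LHS]eg (meval_hcoord hF h) (meval_hcoord hG h) invfM mulrACA.
by rewrite divff ?mul1r // expf_neq0.
Qed.

Lemma chart_regular (F : {mpoly C[n.+1]}) :
  locally (proj_opens X) (@proj_frac C n) chart (fun L => F.@[dehomogenize L]).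
Proof.
move=> L cL; exists chart; split=> //; first exact: chart_open.
have [k hk] := homogenize F; have [H hH eH] := hk k (leqnn k).
exists k, H, ('X_j ^+ k); split=> //.
  by rewrite -[X in X.-homog]mul1n dhomogMn // dhomogX /= mdeg1.
move=> K [XK Kj]; rewrite rmorphXn /= mevalXU expf_neq0 // eH //; split=> //.
by rewrite mulrC mulKf // expf_neq0.
Qed.

End AffineChart.

(** * Toric surfaces *)

Section Toric.
Variables (C : numClosedFieldType) (n : nat) (p : 'I_n.+1 -> nat * nat).
Notation points := {vspace 'rV[C]_n.+1}.
Notation torus_poly := (@torus_poly C n.+1 p).

Definition toric : set points :=
  [set L | proj_space L /\ forall k (F : {mpoly C[n.+1]}),
     F \is k.-homog -> torus_poly F = 0 -> F.@[hcoord L] = 0].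

Definition torus_point (x y : C) : 'rV[C]_n.+1 :=
  \row_i (x ^+ (p i).1 * y ^+ (p i).2).

Lemma toric_sub : toric `<=` @proj_space C n.
Proof. by move=> L []. Qed.

Lemma meval_torus_point (x y : C) (F : {mpoly C[n.+1]}) :
  F.@[acoord (torus_point x y)] = eval2 x y (torus_poly F).
Proof. by rewrite eval2_torus_poly; apply: meval_eq => i; rewrite /acoord mxE. Qed.

Lemma torus_point_neq0 (x y : C) : x != 0 -> y != 0 -> torus_point x y != 0.
Proof.
move=> x0 y0; have h : torus_point x y 0 0 != 0.
  by rewrite mxE mulf_neq0 // expf_neq0.
by apply: contraNneq h => ->; rewrite mxE.
Qed.

Lemma torus_point_toric (x y : C) : x != 0 -> y != 0 -> toric <[torus_point x y]>%VS.
Proof.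
move=> x0 y0; have t0 := torus_point_neq0 x0 y0; split; first exact: proj_space_vline.
move=> k F hF F0; apply/eqP; rewrite (meval_vline_eq0 t0 hF).
by rewrite meval_torus_point F0 /eval2 !horner0.
Qed.

(** Both sets are cut out by the same forms: a nonzero polynomial in two variables is nonzero at
    some point of the torus. *)
Lemma toric_varietyE (A : 'M[int]_(1 + 2, n.+1)) :
  (forall j, dsubmx A 0 j = (p j).1%:Z /\ dsubmx A 1 j = (p j).2%:Z) ->
  toric_variety C A = toric.
Proof.
move=> hA; have eA (t : 'rV[C]_2) : monomial_map A t = torus_point (t 0 0) (t 0 1).
  apply/rowP => j; rewrite [LHS]mxE [RHS]mxE big_ord_recl big_ord1.
  have [e0 e1] := hA j; have -> : lift ord0 ord0 = 1 :> 'I_2 by apply: val_inj.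
  by rewrite [dsubmx A ord0 j]e0 e1.
rewrite /toric_variety; set E := (X in proj_closure X).
have mE x y : x != 0 -> y != 0 -> E <[torus_point x y]>%VS.
  move=> x0 y0; exists (\row_i (if i == 0 then x else y)); last by rewrite eA !mxE.
  by move=> i; rewrite mxE; case: ifP.
have hE : E `<=` @proj_space C n.
  move=> _ [t ht <-]; rewrite eA; apply: proj_space_vline.
  exact: torus_point_neq0.
rewrite proj_closureE //; apply/seteqP; split=> L [hL h]; split=> // k F hF.
  move=> F0; apply: (h k) => // _ [t ht <-]; rewrite eA.
  by have [_ h'] := torus_point_toric (ht 0) (ht 1); apply: (h' k).
move=> hv; apply: (h k) => //; apply/eqP/negPn/negP => /eval2_nonzero[x [y [x0 y0]]].
rewrite -meval_torus_point -(meval_vline_eq0 (torus_point_neq0 x0 y0) hF).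
by rewrite hv ?eqxx //; exact: mE.
Qed.

Lemma vanishes_toric (k : nat) (F : {mpoly C[n.+1]}) : F \is k.-homog ->
  vanishes toric F <-> torus_poly F = 0.
Proof.
move=> hF; split=> [h|h L [_ hL]]; last exact: (hL k).
apply/eqP/negPn/negP => /eval2_nonzero[x [y [x0 y0]]].
rewrite -meval_torus_point -(meval_vline_eq0 (torus_point_neq0 x0 y0) hF).
by rewrite h ?eqxx //; exact: torus_point_toric.
Qed.

Lemma toric_open_torus (U : set points) : proj_opens toric U -> U !=set0 ->
  exists k (H : {mpoly C[n.+1]}), [/\ H \is k.-homog, torus_poly H != 0
    & forall L, toric L -> H.@[hcoord L] != 0 -> U L].
Proof.
move=> /(proj_opensP _ toric_sub)[UX hU] [L UL].
have [k [F [hF FL FU]]] := hU L UL; exists k, F; split => //.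
apply: contraNneq FL => F0; have [_ h] := UX _ UL; exact/eqP/(h k).
Qed.

Lemma toric_dense (U : set points) (k : nat) (F : {mpoly C[n.+1]}) :
  proj_opens toric U -> U !=set0 -> F \is k.-homog ->
  (forall L, U L -> F.@[hcoord L] = 0) -> torus_poly F = 0.
Proof.
move=> oU U0 hF h; have [l [H [hH H0 HU]]] := toric_open_torus oU U0.
have : torus_poly (F * H) = 0.
  apply/(@vanishes_toric (k + l)); first exact: dhomogM.
  move=> L XL; rewrite mevalM; have [->|HL] := eqVneq H.@[hcoord L] 0.
    by rewrite mulr0.
  by rewrite (h L) ?mul0r //; exact: HU.
by rewrite torus_polyM => /eqP; rewrite mulf_eq0 (negbTE H0) orbF => /eqP.
Qed.

Lemma toric_dense_eq (U : set points) (k : nat) (F G : {mpoly C[n.+1]}) :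
  proj_opens toric U -> U !=set0 -> F \is k.-homog -> G \is k.-homog ->
  (forall L, U L -> F.@[hcoord L] = G.@[hcoord L]) -> torus_poly F = torus_poly G.
Proof.
move=> oU U0 hF hG h; apply/eqP; rewrite -subr_eq0 -torus_polyB; apply/eqP.
apply: (@toric_dense U k) => //; first by rewrite rpredB.
by move=> L UL; rewrite mevalB h ?subrr.
Qed.

Lemma toric_eq (k : nat) (F G : {mpoly C[n.+1]}) L : toric L ->
  F \is k.-homog -> G \is k.-homog -> torus_poly F = torus_poly G ->
  F.@[hcoord L] = G.@[hcoord L].
Proof.
move=> [_ h] hF hG e; apply/eqP; rewrite -subr_eq0 -mevalB; apply/eqP/(h k).
  by rewrite rpredB.
by rewrite torus_polyB e subrr.
Qed.

Lemma toric_openI (U V : set points) : proj_opens toric U -> proj_opens toric V ->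
  U !=set0 -> V !=set0 ->
  exists L, [/\ U L, V L, proj_opens toric (U `&` V)
    & exists x y, [/\ x != 0, y != 0 & L = <[torus_point x y]>%VS]].
Proof.
move=> oU oV U0 V0.
have [k [F [hF F0 FU]]] := toric_open_torus oU U0.
have [l [G [hG G0 GV]]] := toric_open_torus oV V0.
have := mulf_neq0 F0 G0; move/eval2_nonzero => [x [y [x0 y0]]].
rewrite eval2M mulf_eq0 negb_or -!meval_torus_point => /andP[Fx Gx].
have t0 := torus_point_neq0 x0 y0.
exists <[torus_point x y]>%VS; split.
- by apply: FU; [exact: torus_point_toric|rewrite (meval_vline_eq0 t0 hF)].
- by apply: GV; [exact: torus_point_toric|rewrite (meval_vline_eq0 t0 hG)].
- exact: proj_opensI toric_sub oU oV.
by exists x, y.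
Qed.

Lemma toric_irreducible : irreducible (proj_variety toric).
Proof.
split.
  exists <[torus_point 1 1]>%VS; apply: torus_point_toric; exact: oner_neq0.
move=> U V oU oV U0 V0; have [L [UL VL _ _]] := toric_openI oU oV U0 V0.
by exists L.
Qed.

(** The limit for [t -> 0] of the point with coordinates [t ^ (u a + v b + c) x ^ a y ^ b], when
    these exponents are nonnegative: only the coordinates on the face survive. *)
Definition face_point (u v c : int) (x y : C) : 'rV[C]_n.+1 :=
  \row_i (if wt u v (p i).1 (p i).2 + c == 0 then x ^+ (p i).1 * y ^+ (p i).2 else 0).

Lemma wt_mexpw (u v c : int) (m : 'X_{1..n.+1}) :
  wt u v (mexpw p m).1 (mexpw p m).2 + c * (mdeg m)%:Z =
  \sum_i (m i)%:Z * (wt u v (p i).1 (p i).2 + c).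
Proof.
rewrite /wt /mexpw mdegE /= !(big_morph Posz PoszD (erefl 0)) !mulr_sumr -!big_split /=.
by apply: eq_bigr => i _; rewrite !PoszM; ring.
Qed.

(* On a face of the polygon a form restricts to the part of its torus
   polynomial supported on the dilated face. *)
Lemma meval_face_point (u v c : int) (x y : C) (k : nat) (F : {mpoly C[n.+1]}) :
  (forall i, 0 <= wt u v (p i).1 (p i).2 + c) -> F \is k.-homog ->
  F.@[acoord (face_point u v c x y)] =
  eval2 x y (initial u v (- (c * k%:Z)) (torus_poly F)).
Proof.
move=> pos /dhomogP hF.
have -> : initial u v (- (c * k%:Z)) (torus_poly F) =
    \sum_(m <- msupp F | wt u v (mexpw p m).1 (mexpw p m).2 + c * k%:Z == 0)
      (F@_m)%:P%:P * bimono C (mexpw p m).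
  apply/polyP => j; apply/polyP => i; rewrite coef_initial coef_torus_poly !coef_sum.
  rewrite big_mkcond [RHS]big_mkcond.
  case: ifP => h.
    apply: eq_bigr => m _; rewrite coefCM coefCM coef_bimono [(i, j) == _]eq_sym.
    case: (mexpw p m =P (i, j)) => [->|_]; last by rewrite mulr0; case: ifP.
    by rewrite /= (eqP h) addNr eqxx mulr1.
  rewrite big1 // => m _; rewrite coefCM coefCM coef_bimono [(i, j) == _]eq_sym.
  case: (mexpw p m =P (i, j)) => [->|_]; last by rewrite mulr0; case: ifP.
  by rewrite /= addr_eq0 h.
rewrite mevalE /eval2 !horner_sum [RHS]big_mkcond; apply: eq_big_seq => m mF.
rewrite -[X in if _ then X else _]/(eval2 x y ((F@_m)%:P%:P * bimono C (mexpw p m))).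
rewrite eval2M eval2_bimono {1}/eval2 !hornerC.
have em := hF m mF; rewrite /= in em; rewrite -em wt_mexpw.
have pos' i : 0 <= (m i)%:Z * (wt u v (p i).1 (p i).2 + c) by rewrite mulr_ge0.
case: ifP => h.
  congr (_ * _); rewrite /mexpw /= -!prodrXr -big_split; apply: eq_bigr => i _ /=.
  have : (m i)%:Z * (wt u v (p i).1 (p i).2 + c) == 0.
    by move: h; rewrite psumr_eq0 // => /allP/(_ i (mem_index_enum _))/implyP; apply.
  rewrite mulf_eq0 => /orP[/eqP mi0|h'].
    by move: mi0 => [->]; rewrite !mul0n !expr0 mulr1.
  by rewrite /acoord mxE h' exprMn -!exprM ![(m i * _)%N]mulnC.
have [i hi] : exists i, (m i)%:Z * (wt u v (p i).1 (p i).2 + c) != 0.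
  apply/existsP; apply: contraFT h => /existsPn h; apply/eqP/big1 => i _.
  by apply/eqP; have := h i; rewrite negbK.
move: hi; rewrite mulf_eq0 negb_or => /andP[mi ci].
have {}mi : m i != 0%N by apply: contraNneq mi => ->.
by rewrite (bigD1 i) //= /acoord mxE (negbTE ci) expr0n (negbTE mi) mul0r mulr0.
Qed.

Lemma face_point_toric (u v c : int) (x y : C) :
  (forall i, 0 <= wt u v (p i).1 (p i).2 + c) ->
  face_point u v c x y != 0 -> toric <[face_point u v c x y]>%VS.
Proof.
move=> pos f0; split; first exact: proj_space_vline.
move=> k F hF F0; apply/eqP; rewrite (meval_vline_eq0 f0 hF).
rewrite (meval_face_point _ _ pos hF) F0.
rewrite (_ : initial _ _ _ _ = 0) /eval2 ?horner0 //.
by apply/polyP => j; apply/polyP => i; rewrite coef_initial !coef0; case: ifP.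
Qed.

End Toric.

(** * Normality *)

Section Facets.

(** An entry [(u, v, c)] stands for the edge on the line [u a + v b + c = 0], with [(u, v)] pointing
    inwards. *)
Definition facets (d : nat) : seq (int * int * int) :=
  (d.-1%:Z, - 2, 0) :: [seq (- (2 * j)%N%:Z, 2, (j * j.+1)%N%:Z) | j <- iota 0 d].

Definition facet_value (e : int * int * int) (k : nat) (w : nat * nat) : int :=
  wt e.1.1 e.1.2 w.1 w.2 + e.2 * k%:Z.

Lemma in_dilate_facets (d k : nat) (w : nat * nat) :
  in_dilate d k w <-> forall e, e \in facets d -> 0 <= facet_value e k w.
Proof.
case: w => a b; split.
  move=> [top low] e; rewrite inE => /predU1P[->|/mapP[j]].
    by rewrite /facet_value /wt /=; move: top => /=; lia.
  rewrite mem_iota add0n /= => jd ->; have := low j jd.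
  by rewrite /facet_value /wt /=; lia.
move=> h; split.
  by have := h _ (mem_head _ _); rewrite /facet_value /wt /=; lia.
move=> j jd; have := h (- (2 * j)%N%:Z, 2, (j * j.+1)%N%:Z).
rewrite inE map_f ?orbT ?mem_iota // => /(_ isT).
by rewrite /facet_value /wt /=; lia.
Qed.

End Facets.

Section Regular.
Variables (C : fieldType) (n : nat) (X : set {vspace 'rV[C]_n.+1}).
Hypothesis hX : X `<=` @proj_space C n.

(** It lets an integral equation between germs be rewritten as an identity between forms of one
    degree. *)
Lemma common_denominator (I : finType) (f : I -> {vspace 'rV[C]_n.+1} -> C)
    (U : set {vspace 'rV[C]_n.+1}) L : proj_opens X U -> U L ->
  (forall i, locally (proj_opens X) (@proj_frac C n) U (f i)) ->
  exists V k (G : {mpoly C[n.+1]}) (F : I -> {mpoly C[n.+1]}),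
    [/\ proj_opens X V, V L, V `<=` U, G \is k.-homog &
    [/\ forall i, F i \is k.-homog, forall K, V K -> G.@[hcoord K] != 0
      & forall i K, V K -> f i K = (F i).@[hcoord K] / G.@[hcoord K]]].
Proof.
move=> oU UL hf.
suff [V [k [G [F [oV VL VU hG [hF G0 FG]]]]]] : exists V k (G : {mpoly C[n.+1]}) (F : I -> {mpoly C[n.+1]}),
    [/\ proj_opens X V, V L, V `<=` U, G \is k.-homog &
    [/\ forall i, F i \is k.-homog, forall K, V K -> G.@[hcoord K] != 0
      & forall i K, i \in enum I -> V K -> f i K = (F i).@[hcoord K] / G.@[hcoord K]]].
  exists V, k, G, F; split=> //; split=> // i K; apply: FG.
  by rewrite mem_enum.
elim: (enum I) => [|i s [V [k [G [F [oV VL VU hG [hF G0 FG]]]]]]].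
  exists U, 0%N, 1, (fun=> 0); split=> //; first exact: dhomog1.
  by split=> // [i|K _]; rewrite ?dhomog0 // meval1 oner_neq0.
have [W [oW WL WU [l [P [Q [hP hQ PQ]]]]]] := hf i L UL.
exists (V `&` W), (k + l)%N, (G * Q), (fun j => if j == i then G * P else F j * Q).
split.
- exact: proj_opensI.
- by [].
- by move=> K [/VU].
- exact: dhomogM.
split.
- by move=> j; case: ifP => _; exact: dhomogM.
- by move=> K [VK WK]; rewrite mevalM mulf_neq0 ?G0 //; case: (PQ K WK).
move=> j K; rewrite inE => hj [VK WK]; have [Q0 e] := PQ K WK.
have GK := G0 K VK; rewrite mevalM; case: eqP hj => [-> _|_ /= hj].
  by rewrite e mevalM -mulf_div divff ?mul1r.
by rewrite (FG j K hj VK) mevalM -mulf_div divff ?mulr1.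
Qed.

End Regular.

Section Saturated.
Variables (C : numClosedFieldType) (n d : nat) (p : 'I_n.+1 -> nat * nat).
Hypothesis d1 : (1 < d)%N.
Hypothesis hp : forall w, in_polygon d w <-> exists i, p i = w.
Notation X := (@toric C n p).
Notation torus_poly := (@torus_poly C n.+1 p).

Lemma dilate_monomial (k : nat) (w : nat * nat) :
  in_dilate d k w <-> exists2 m, mdeg m = k & mexpw p m = w.
Proof.
have hs u : u \in polygon_seq d <-> exists i, p i = u by rewrite mem_polygon_seq.
split=> [h|/(sumset_mexpw _ _ hs)]; last exact: sumset_in_dilate.
exact/(sumset_mexpw _ _ hs)/in_dilate_sumset.
Qed.

Lemma form_of_dilate (k : nat) (g : {poly {poly C}}) :
  (forall i j, g`_j`_i != 0 -> in_dilate d k (i, j)) ->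
  exists2 F, F \is k.-homog & torus_poly F = g.
Proof. by move=> h; apply: torus_poly_surj => i j /h/dilate_monomial. Qed.

Lemma form_order (k : nat) (F : {mpoly C[n.+1]}) (e : int * int * int) :
  F \is k.-homog -> e \in facets d ->
  order_ge e.1.1 e.1.2 (torus_poly F) (- (e.2 * k%:Z)).
Proof.
move=> hF he i j /(torus_poly_supp hF)/dilate_monomial/in_dilate_facets/(_ e he) h.
by rewrite -subr_ge0 opprK.
Qed.

(* The Newton polygon of [q] lies in the [k]-fold dilate: a vertex of it beyond
   a facet would give an uncancelled term of [q ^+ m]. *)
Lemma integral_dilate (k m : nat) (q : {poly {poly C}}) (c : 'I_m -> {poly {poly C}}) :
  q ^+ m + \sum_(i < m) c i * q ^+ i = 0 ->
  (forall e i, e \in facets d -> order_ge e.1.1 e.1.2 (c i) (- (e.2 * k%:Z) *+ (m - i))) ->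
  forall i j, q`_j`_i != 0 -> in_dilate d k (i, j).
Proof.
move=> eq hc i j qij; apply/in_dilate_facets => e he.
have q0 : q != 0 by apply: contraNneq qij => ->; rewrite !coef0.
have [l hl] := has_order_exists e.1.1 e.1.2 q0.
suff le : - (e.2 * k%:Z) <= l.
  by rewrite /facet_value -[_ * _]opprK subr_ge0 (le_trans le) // (hl.1 _ _ qij).
rewrite leNgt; apply/negP => lt.
have [_ [a [b [qab ab]]]] := has_orderX m hl.
have : order_ge e.1.1 e.1.2 (\sum_(i < m) c i * q ^+ i) (l *+ m + 1).
  apply: order_ge_sum => r; apply: order_ge_leq (order_geM (hc e r he) (has_orderX r hl).1).
  have -> : l *+ m = l *+ (m - r) + l *+ r by rewrite -mulrnDr subnK // ltnW.
  rewrite addrAC lerD2r -subnSK // mulrSr mulrSr -addrA lerD //.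
    by rewrite lerMn2r ltW ?orbT.
  by rewrite lezD1.
have -> : \sum_(i < m) c i * q ^+ i = - q ^+ m.
  by apply/eqP; rewrite -addr_eq0 addrC eq.
move=> /(_ a b); rewrite !coefN oppr_eq0 ab => /(_ qab).
by rewrite lezD1 ltxx.
Qed.

Theorem toric_normal : normal (proj_variety X).
Proof.
split; first exact: toric_irreducible.
move=> L XL U a b m c oU UL ha hb hc nb eqn.
pose f (o : option (option 'I_m)) := match o with
  None => a | Some None => b | Some (Some i) => c i end.
have hf o : locally (proj_opens X) (@proj_frac C n) U (f o) by case: o => [[i|]|]; [exact: hc|exact: hb|exact: ha].
have hX := @toric_sub C n p.
have [V [k [G [F [oV VL VU hG [hF G0 FG]]]]]] := common_denominator hX oU UL hf.
have V0 : V !=set0 by exists L.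
pose Fa := F None; pose Fb := F (Some None); pose Fc i := F (Some (Some i)).
have hG0 : torus_poly G != 0.
  apply: contraNneq (G0 L VL) => h; apply/eqP.
  by have [_] := XL; apply; [exact: hG|].
have Fb0 : torus_poly Fb != 0.
  apply/eqP => h; apply: nb; exists V; split=> // K VK.
  rewrite [b K](FG (Some None) K VK) (_ : (F _).@[_] = 0) ?mul0r //.
  have [VX _] := (proj_opensP _ hX).1 oV.
  by have [_ h'] := VX K VK; apply: (h' k).
(* The integral equation multiplied by [G ^+ m.+1], a form of degree [k (m + 1)]. *)
pose Phi := G * Fa ^+ m + \sum_(i < m) Fc i * Fa ^+ i * Fb ^+ (m - i).
have hPhi : torus_poly Phi = 0.
  apply: (@toric_dense _ _ _ V (k * m.+1)) => //.
    apply: rpredD; first by rewrite mulnS dhomogM ?dhomogMn // hF.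
    apply: rpred_sum => i _.
    have -> : (k * m.+1 = k + k * i + k * (m - i))%N.
      by rewrite -addnA -mulnDr subnKC ?mulnS // ltnW.
    by rewrite !dhomogM ?dhomogMn // hF.
  move=> K VK; have GK := G0 K VK; rewrite mevalD mevalM rmorphXn raddf_sum /=.
  apply: (mulfI (invr_neq0 (expf_neq0 m.+1 GK))); rewrite mulr0.
  have := eqn K (VU K VK).
  rewrite [a K](FG None K VK) [b K](FG (Some None) K VK) => {2}<-.
  rewrite mulrDr mulr_sumr; congr (_ + _).
    by rewrite expr_div_n exprS invfM mulrACA mulVf // mul1r mulrC.
  apply: eq_bigr => i _; rewrite [c i K](FG (Some (Some i)) K VK).
  rewrite !mevalM !rmorphXn /= !expr_div_n.
  have -> : (m.+1 = (i + (m - i)).+1)%N by rewrite subnKC // ltnW.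
  by rewrite exprS exprD !invfM; ring.
(* [psi] is [G a / b]: the factor [G] turns the coefficients of its integral equation into the
   polynomials of [Fc i * G ^+ (m - i.+1)]. *)
have [psi epsi] : exists q, torus_poly G * torus_poly Fa = torus_poly Fb * q.
  apply: (@integral_quotient _ m _ _
    (fun i => torus_poly (Fc i) * torus_poly G ^+ (m - i.+1))) => //.
  apply: (mulfI hG0); rewrite mulr0 mulrDr [_ * (\sum_(i < m) _)]mulr_sumr.
  rewrite -[RHS](mulr0 (torus_poly G ^+ m)) -[X in _ = _ * X]hPhi /Phi torus_polyD torus_polyM.
  rewrite torus_polyXn torus_poly_sum mulrDr [_ * (\sum_(i < m) _)]mulr_sumr; congr (_ + _).
    by rewrite exprMn; ring.
  apply: eq_bigr => i _; rewrite !torus_polyM !torus_polyXn exprMn.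
  have -> : torus_poly G ^+ m = torus_poly G ^+ i * (torus_poly G * torus_poly G ^+ (m - i.+1)).
    by rewrite -exprS -exprD subnSK // subnKC // ltnW.
  ring.
(* Those coefficients come from forms of degree [k (m - i)], so [psi] has its exponents in the
   [k]-fold dilate and [a / b = Psi / G] is regular near [L]. *)
have [|Psi hPsi ePsi] := @form_of_dilate k psi.
  apply: (@integral_dilate k m psi (fun i => torus_poly (Fc i) * torus_poly G ^+ (m - i.+1))).
    apply: (mulfI hG0); apply: (mulfI (expf_neq0 m Fb0)).
    rewrite !mulr0 !mulrDr ![_ * (\sum_(i < m) _)]mulr_sumr -[RHS](mulr0 (torus_poly G ^+ m)).
    rewrite -[X in _ = _ * X]hPhi /Phi torus_polyD torus_polyM torus_polyXn torus_poly_sum.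
    rewrite mulrDr [_ * (\sum_(i < m) _)]mulr_sumr; congr (_ + _).
      transitivity (torus_poly G * (torus_poly Fb * psi) ^+ m).
        by rewrite exprMn; ring.
      by rewrite -epsi exprMn; ring.
    apply: eq_bigr => i _; rewrite !torus_polyM !torus_polyXn.
    have -> : torus_poly Fb ^+ m = torus_poly Fb ^+ i * torus_poly Fb ^+ (m - i).
      by rewrite -exprD subnKC // ltnW.
    transitivity (torus_poly G * torus_poly G ^+ (m - i.+1) *
        (torus_poly Fb * psi) ^+ i * torus_poly Fb ^+ (m - i) * torus_poly (Fc i)).
      by rewrite exprMn; ring.
    have -> : torus_poly G ^+ m = torus_poly G ^+ i * (torus_poly G * torus_poly G ^+ (m - i.+1)).
      by rewrite -exprS -exprD subnSK // subnKC // ltnW.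
    by rewrite -epsi exprMn; ring.
  move=> e i he.
  have oG : order_ge e.1.1 e.1.2 (torus_poly G ^+ (m - i.+1)) (- (e.2 * k%:Z) *+ (m - i.+1)).
    elim: (m - i.+1)%N => [|r IH]; last by rewrite exprS mulrS; apply: order_geM => //; exact: form_order.
    move=> x y; rewrite coef1; case: (y =P 0%N) => [->|_]; last by rewrite coef0 eqxx.
    by rewrite coef1; case: (x =P 0%N) => [->|_]; rewrite ?eqxx // /wt !mulr0.
  have -> : (m - i = (m - i.+1).+1)%N by rewrite subnSK.
  rewrite mulrS; apply: order_geM => //.
  by apply: form_order => //; exact: hF.
exists V, (fun K => Psi.@[hcoord K] / G.@[hcoord K]); split=> //.
  move=> K VK; exists V; split=> //; exists k, Psi, G; split=> // K' VK'.
  by split=> //; exact: G0.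
move=> K VK; have GK := G0 K VK.
have [VX _] := (proj_opensP _ hX).1 oV.
have e : (G * Fa).@[hcoord K] = (Fb * Psi).@[hcoord K].
  apply: (toric_eq (VX K VK) (k := k + k)); rewrite ?dhomogM // ?hF //.
  by rewrite !torus_polyM ePsi.
rewrite [a K](FG None K VK) [b K](FG (Some None) K VK) mulf_div.
move: e; rewrite !mevalM => <-; rewrite -mulf_div divff ?mul1r //.
Qed.

End Saturated.

(** * Regular functions on the charts *)

Section MonomialDivision.
Variable C : numClosedFieldType.
Notation bipoly := {poly {poly C}}.

Lemma coefM_bimono (f : bipoly) (w : nat * nat) (i j : nat) :
  (f * bimono C w)`_j`_i =
  if (w.1 <= i)%N && (w.2 <= j)%N then f`_(j - w.2)`_(i - w.1) else 0.
Proof.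
rewrite /bimono mulrA coefMXn; case: ltnP => [_|jw]; first by rewrite coef0 andbF.
by rewrite coefMC coefMXn; case: ltnP.
Qed.

Lemma bimono_div (f : bipoly) (w : nat * nat) :
  (forall i j, f`_j`_i != 0 -> (w.1 <= i)%N && (w.2 <= j)%N) ->
  exists2 g, f = g * bimono C w & forall i j, g`_j`_i = f`_(j + w.2)`_(i + w.1).
Proof.
move=> hf; pose g : bipoly := \poly_(j < size f) \poly_(i < size (f`_(j + w.2))%R)
  f`_(j + w.2)`_(i + w.1).
have eg i j : g`_j`_i = f`_(j + w.2)`_(i + w.1).
  rewrite coef_poly; case: ltnP => [_|h]; last first.
    by rewrite [f`_(_ + _)]nth_default ?coef0 // (leq_trans h) // leq_addr.
  rewrite coef_poly; case: ltnP => // h; rewrite nth_default //.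
  by rewrite (leq_trans h) // leq_addr.
exists g => //; apply/polyP => j; apply/polyP => i; rewrite coefM_bimono.
case: ifP => [/andP[h1 h2]|h]; first by rewrite eg !subnK.
by apply/eqP/negPn/negP => /hf; rewrite h.
Qed.

End MonomialDivision.

Section ChartFunctions.
Variables (C : numClosedFieldType) (n d : nat) (p : 'I_n.+1 -> nat * nat).
Hypothesis d1 : (1 < d)%N.
Hypothesis hp : forall w, in_polygon d w <-> exists i, p i = w.
Notation X := (@toric C n p).
Notation torus_poly := (@torus_poly C n.+1 p).

Lemma facet_pos (e : int * int * int) (i : 'I_n.+1) :
  e \in facets d -> 0 <= wt e.1.1 e.1.2 (p i).1 (p i).2 + e.2.
Proof.
move=> he; have /in_polygon_dilate/in_dilate_facets/(_ e he) : in_polygon d (p i).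
  by apply/hp; exists i.
by rewrite /facet_value mulr1.
Qed.

Lemma torus_point_chart (v : 'I_n.+1) (x y : C) : x != 0 -> y != 0 ->
  chart X v <[torus_point p x y]>%VS.
Proof.
move=> x0 y0; split; first exact: torus_point_toric.
have [c c0 ->] := hcoord_vline (torus_point_neq0 p x0 y0).
by rewrite mxE mulf_neq0 // mulf_neq0 // expf_neq0.
Qed.

(* A function regular on the chart is a Laurent polynomial, because it is regular
   on the torus; its exponents satisfy the inequalities of the facets through
   [p v], because it is regular at a point of each of these facets. *)
Lemma chart_functions (v : 'I_n.+1) (h : {vspace 'rV[C]_n.+1} -> C) :
  locally (proj_opens X) (@proj_frac C n) (chart X v) h ->
  exists k (Psi : {mpoly C[n.+1]}), Psi \is k.-homog /\
    forall L, chart X v L -> h L = Psi.@[hcoord L] / hcoord L v ^+ k.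
Proof.
have hX := @toric_sub C n p; have one0 := oner_neq0 C.
move=> hreg; have c1 := torus_point_chart v one0 one0.
have [V0 [oV0 V0L V0c [k0 [F0 [G0 [hF0 hG0 FG0]]]]]] := hreg _ c1.
have V00 : V0 !=set0 by exists <[torus_point p 1 1]>%VS.
have G0n : torus_poly G0 != 0.
  apply/eqP => h0; have [+ _] := FG0 _ V0L; apply/negP; rewrite negbK; apply/eqP.
  by have [[_ +] _] := c1; apply; [exact: hG0|].
have [f1 [f2 [f20 ef red]]] := reduced_fraction (torus_poly F0) G0n.
(* By irreducibility all local expressions of [h] represent the single reduced fraction
   [f1 / f2]. *)
have cross V k F G : proj_opens X V -> V !=set0 -> F \is k.-homog -> G \is k.-homog ->
    (forall K, V K -> G.@[hcoord K] != 0 /\ h K = F.@[hcoord K] / G.@[hcoord K]) ->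
    torus_poly F * f2 = torus_poly G * f1.
  move=> oV Vn hF hG FG; have [K [VK V0K oVV _]] := toric_openI oV oV0 Vn V00.
  have e : torus_poly (F * G0) = torus_poly (F0 * G).
    apply: (@toric_dense_eq _ _ _ (V `&` V0) (k + k0)) => //.
    - by exists K.
    - exact: dhomogM.
    - by rewrite addnC dhomogM.
    move=> K' [VK' V0K']; have [g0 e1] := FG K' VK'; have [g0' e2] := FG0 K' V0K'.
    rewrite !mevalM; apply/eqP; rewrite -eqr_div //; apply/eqP.
    by rewrite -e1 -e2.
  rewrite !torus_polyM in e; apply: (mulIf G0n).
  by rewrite mulrAC e mulrAC ef; ring.
(* At each torus point some local denominator is nonzero, and it is a multiple of [f2]; so [f2] has
   no zero on the torus. *)
have [c [w0 [c0 ef2]]] : exists c w, c != 0 /\ f2 = c%:P%:P * bimono C w.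
  apply: no_torus_zero => x y x0 y0.
  have cx := torus_point_chart v x0 y0.
  have [V [oV VL Vc [k [F [G [hF hG FG]]]]]] := hreg _ cx.
  have Vn : V !=set0 by exists <[torus_point p x y]>%VS.
  have [q eq] := red _ _ (cross V k F G oV Vn hF hG FG).
  have [+ _] := FG _ VL; rewrite (meval_vline_eq0 (torus_point_neq0 p x0 y0) hG).
  by rewrite meval_torus_point eq eval2M mulf_eq0 negb_or => /andP[].
have order_through e : e \in facets d -> wt e.1.1 e.1.2 (p v).1 (p v).2 + e.2 = 0 ->
    order_ge e.1.1 e.1.2 f1 (wt e.1.1 e.1.2 w0.1 w0.2).
  move=> he ev; have [->|f10] := eqVneq f1 0; first by move=> i j; rewrite !coef0 eqxx.
  have [l hl] := has_order_exists e.1.1 e.1.2 f10.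
  suff le : wt e.1.1 e.1.2 w0.1 w0.2 <= l by apply: order_ge_leq hl.1.
  have pos i := facet_pos i he.
  pose fp : 'rV[C]_n.+1 := face_point p e.1.1 e.1.2 e.2 1 1.
  have fpv : fp 0 v = 1 by rewrite mxE ev eqxx !expr1n mulr1.
  have fp0 : fp != 0 by apply: contra_eq_neq fpv => ->; rewrite mxE eq_sym.
  have cfp : chart X v <[fp]>%VS.
    split; first exact: face_point_toric.
    by have [b b0 ->] := hcoord_vline fp0; rewrite fpv mulr1.
  have [V [oV VL Vc [k [F [G [hF hG FG]]]]]] := hreg _ cfp.
  have Vn : V !=set0 by exists <[fp]>%VS.
  have eFG := cross V k F G oV Vn hF hG FG.
  have [+ _] := FG _ VL; rewrite (meval_vline_eq0 fp0 hG) (meval_face_point 1 1 pos hG) => Gfp.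
  (* Being nonzero at the face point, [G] has a term on the face, hence exactly the least order
     possible in its degree. Comparing orders in [F f2 = G f1] then bounds [f1]. *)
  have hordG : has_order e.1.1 e.1.2 (torus_poly G) (- (e.2 * k%:Z)).
    split; first exact: (form_order d1 hp).
    apply: contrapT => hn; move/eqP: Gfp; apply.
    rewrite (_ : initial _ _ _ _ = 0) /eval2 ?horner0 //.
    apply/polyP => j; apply/polyP => i; rewrite coef_initial !coef0.
    case: eqP => // ewt; apply/eqP/negPn/negP => hne; apply: hn.
    by exists i, j.
  have [_ [a [b [hab eab]]]] := has_orderM hordG hl.
  have : order_ge e.1.1 e.1.2 (torus_poly F * f2) (- (e.2 * k%:Z) + wt e.1.1 e.1.2 w0.1 w0.2).
    apply: order_geM; first exact: (form_order d1 hp).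
    rewrite ef2 => i j; rewrite coefCM coefCM coef_bimono; case: ((i, j) =P w0) => [<- //|_].
    by rewrite mulr0 eqxx.
  by rewrite eFG => /(_ a b hab); rewrite eab lerD2l.
(* An edge not through [p v] has value at least 1 there, so a large power of the coordinate [v]
   compensates any pole along it. *)
have [k hk] : exists k : nat, forall e, e \in facets d ->
    order_ge e.1.1 e.1.2 f1 (wt e.1.1 e.1.2 w0.1 w0.2 -
      k%:Z * (wt e.1.1 e.1.2 (p v).1 (p v).2 + e.2)).
  have : forall e, e \in facets d -> e \in facets d by [].
  elim: {1 3}(facets d) => [|e s IH] hs; first by exists 0%N.
  have [|k hk] := IH; first by move=> e' he'; apply: hs; rewrite inE he' orbT.
  have he := hs e (mem_head _ _).
  have [k' hk'] : exists k' : nat, order_ge e.1.1 e.1.2 f1 (wt e.1.1 e.1.2 w0.1 w0.2 -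
      k'%:Z * (wt e.1.1 e.1.2 (p v).1 (p v).2 + e.2)).
    have [ev|ev] := eqVneq (wt e.1.1 e.1.2 (p v).1 (p v).2 + e.2) 0.
      by exists 0%N; rewrite mul0r subr0; exact: order_through.
    have [->|f10] := eqVneq f1 0; first by exists 0%N => i j; rewrite !coef0 eqxx.
    have [l hl] := has_order_exists e.1.1 e.1.2 f10.
    exists `|wt e.1.1 e.1.2 w0.1 w0.2 - l|%N; apply: order_ge_leq hl.1.
    have : 1 <= wt e.1.1 e.1.2 (p v).1 (p v).2 + e.2.
      by rewrite -gtz0_ge1 lt_def ev facet_pos.
    move: (wt _ _ (p v).1 _ + _) (wt _ _ w0.1 _) => z z' z1.
    rewrite lerBlDr -lerBlDl; apply: le_trans (ler_norm _) _.
    by rewrite -abszE ler_peMr.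
  exists (k + k')%N => e'; rewrite inE => /predU1P[->|he'].
    apply: order_ge_leq hk'; rewrite lerD2l lerN2 ler_wpM2r ?facet_pos //.
    by rewrite lez_nat leq_addl.
  apply: order_ge_leq (hk e' he'); rewrite lerD2l lerN2 ler_wpM2r //.
    by apply: facet_pos; apply: hs; rewrite inE he' orbT.
  by rewrite lez_nat leq_addr.
pose f := f1 * bimono C (k * (p v).1, k * (p v).2)%N.
have suppf i j : f`_j`_i != 0 -> forall e, e \in facets d ->
    0 <= wt e.1.1 e.1.2 i j - wt e.1.1 e.1.2 w0.1 w0.2 + e.2 * k%:Z.
  rewrite coefM_bimono; case: ifP; last by rewrite eqxx.
  move=> /andP[/= h1 h2] hf e he; have := hk e he _ _ hf.
  rewrite -subr_ge0 => /le_trans; apply; rewrite /wt /=.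
  have -> : i%:Z = (i - k * (p v).1)%N%:Z + k%:Z * (p v).1%:Z by rewrite -PoszM -PoszD subnK.
  have -> : j%:Z = (j - k * (p v).2)%N%:Z + k%:Z * (p v).2%:Z by rewrite -PoszM -PoszD subnK.
  by rewrite le_eqVlt; apply/orP; left; apply/eqP; ring.
(* The two edges through [(0, 0)] have constant term 0: the lower one bounds [j] below by [w0.2],
   and then the upper one bounds [i] below by [w0.1]. *)
have [|g eg coefg] := @bimono_div C f w0.
  move=> i j hf; have := suppf i j hf _ (mem_head _ _).
  have := suppf i j hf (- (2 * 0)%N%:Z, 2, (0 * 0.+1)%N%:Z).
  rewrite inE (@map_f _ _ (fun j => (- (2 * j)%N%:Z, 2, (j * j.+1)%N%:Z))) ?orbT; last first.
    by rewrite mem_iota /=; exact: ltnW.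
  move=> /(_ isT); rewrite /wt /= => a1 a2; have hj : (w0.2 <= j)%N by lia.
  rewrite hj andbT.
  have : 0 <= (d.-1)%:Z * (i%:Z - w0.1%:Z) by lia.
  rewrite pmulr_rge0; last by move: d1; lia.
  by rewrite subr_ge0 lez_nat.
have [Psi hPsi ePsi] : exists2 F, F \is k.-homog & torus_poly F = (c^-1)%:P%:P * g.
  apply: (form_of_dilate d1 hp) => i j; rewrite coefCM coefCM mulf_eq0 negb_or coefg.
  move=> /andP[_ hf]; apply/in_dilate_facets => e he; have := suppf _ _ hf e he.
  by rewrite /facet_value /wt !PoszD /=; congr (0 <= _); ring.
have key : torus_poly Psi * f2 = torus_poly ('X_v ^+ k) * f1.
  rewrite ePsi ef2 torus_polyXn torus_poly_monom mexpwU.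
  have -> : bimono C (p v) ^+ k = bimono C (k * (p v).1, k * (p v).2)%N.
    by rewrite /bimono exprMn -polyC_exp -!exprM ![(_ * k)%N]mulnC.
  have cc : (c^-1)%:P%:P * c%:P%:P = 1 :> {poly {poly C}} by rewrite -!polyCM mulVf.
  rewrite [RHS]mulrC -/f eg.
  transitivity ((c^-1)%:P%:P * c%:P%:P * (g * bimono C w0)); first by ring.
  by rewrite cc mul1r.
exists k, Psi; split=> // L cL.
have [V [oV VL Vc [l [F [G [hF hG FG]]]]]] := hreg _ cL.
have Vn : V !=set0 by exists L.
have eFG := cross V l F G oV Vn hF hG FG.
have hXk : ('X_v ^+ k : {mpoly C[n.+1]}) \is k.-homog.
  by rewrite -[X in X.-homog]mul1n dhomogMn // dhomogX /= mdeg1.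
have e : (F * 'X_v ^+ k).@[hcoord L] = (Psi * G).@[hcoord L].
  apply: (toric_eq cL.1 (k := l + k)); first exact: dhomogM.
    by rewrite addnC dhomogM.
  apply: (mulIf f20); rewrite !torus_polyM mulrAC eFG mulrAC [RHS]mulrAC key.
  by ring.
have [GL ->] := FG L VL.
apply/eqP; rewrite eqr_div ?expf_neq0 //; last exact: cL.2.
by move: e; rewrite !mevalM rmorphXn /= mevalXU => ->.
Qed.

End ChartFunctions.

(** * The projection *)

Section BigTorus.
Variables (C : numClosedFieldType) (n : nat) (p : 'I_n.+1 -> nat * nat).
Variables i0 i1 i2 : 'I_n.+1.
Hypotheses (p0 : p i0 = (0, 0)%N) (p1 : p i1 = (1, 0)%N) (p2 : p i2 = (2, 1)%N).

Definition big_torus : set {vspace 'rV[C]_n.+1} :=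
  [set L | toric p L /\ ('X_i0 * 'X_i1 * 'X_i2 : {mpoly C[n.+1]}).@[hcoord L] != 0].

Lemma big_torus_open : proj_opens (toric p) big_torus.
Proof.
apply: (@proj_opens_basic _ _ _ 3); first exact: toric_sub.
by rewrite (@dhomogM _ _ _ 2 _ 1) ?(@dhomogM _ _ _ 1 _ 1) // dhomogX /= mdeg1.
Qed.

Lemma big_torusP (L : {vspace 'rV[C]_n.+1}) :
  big_torus L <-> exists x y, [/\ x != 0, y != 0 & L = <[torus_point p x y]>%VS].
Proof.
split; last first.
  move=> [x [y [x0 y0 ->]]]; split; first exact: torus_point_toric.
  have [c c0 h] := hcoord_vline (torus_point_neq0 p x0 y0).
  by rewrite !mevalM !mevalXU !h !mxE !mulf_neq0 // expf_neq0.
move=> [XL]; rewrite !mevalM !mevalXU !mulf_eq0 !negb_or => /andP[/andP[y0 y1] y2].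
set z := hcoord L in y0 y1 y2.
have x0 : z i1 / z i0 != 0 by rewrite mulf_neq0 // invr_neq0.
have w0 : z i0 * z i2 / z i1 ^+ 2 != 0 by rewrite !mulf_neq0 // invr_neq0 // expf_neq0.
exists (z i1 / z i0), (z i0 * z i2 / z i1 ^+ 2); split=> //.
apply: (vline_eq XL.1 y0) => i; rewrite mxE -/z; case ep: (p i) => [a b] /=.
(* The binomial relation from [(a, b) + 2 b (1, 0) = b (2, 1) + a (1, 0)], with powers of the
   coordinate of [(0, 0)] equalizing the degrees. *)
have e : z i * z i1 ^+ (2 * b) * z i0 ^+ a = z i2 ^+ b * z i1 ^+ a * z i0 ^+ b.+1.
  have hom (j : 'I_n.+1) k : ('X_j ^+ k : {mpoly C[n.+1]}) \is k.-homog.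
    by rewrite -[X in X.-homog]mul1n dhomogMn // dhomogX /= mdeg1.
  have := @toric_eq C n p (1 + 2 * b + a)%N ('X_i * 'X_i1 ^+ (2 * b) * 'X_i0 ^+ a)
    ('X_i2 ^+ b * 'X_i1 ^+ a * 'X_i0 ^+ b.+1) L XL.
  rewrite !mevalM !rmorphXn /= !mevalXU; apply.
  - by rewrite !dhomogM // dhomogX /= mdeg1.
  - by rewrite (_ : 1 + 2 * b + a = b + a + b.+1)%N ?dhomogM //; lia.
  rewrite !torus_polyM !torus_polyXn !torus_poly_monom !mexpwU ep p0 p1 p2.
  by rewrite /bimono /= !expr0 !expr1 !polyC1 !mulr1 !expr1n !mulr1 !polyC_exp exprMn -!exprM; ring.
apply: (mulIf (expf_neq0 a y0)); apply: (mulIf (expf_neq0 (2 * b) y1)).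
rewrite mulrAC e !exprMn !exprVn exprS -exprM.
have a0 := expf_neq0 a y0; have b0 := expf_neq0 b y0; have b1 := expf_neq0 (2 * b) y1.
by field; rewrite a0 b1.
Qed.

End BigTorus.

Section Projection.
Variables (C : numClosedFieldType) (d n : nat) (p : 'I_n.+1 -> nat * nat).
Variable s : 'I_d.+1 -> 'I_n.+1.
Hypothesis d2 : (2 < d)%N.
Hypothesis hp : forall w, in_polygon d w <-> exists i, p i = w.
Hypothesis hs : forall j, p (s j) = osc j.
Notation XA := (@toric C d (@osc d)).
Notation XB := (@toric C n p).
Notation proj := (@coord_projection C n d s).

Let d1 : (1 < d)%N. Proof. exact: ltnW. Qed.

Definition lift_form : {mpoly C[d.+1]} -> {mpoly C[n.+1]} :=
  subst_forms (fun j => 'X_(s j)).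

Lemma lift_form_homog (k : nat) (F : {mpoly C[d.+1]}) :
  F \is k.-homog -> lift_form F \is k.-homog.
Proof.
move=> hF; rewrite -[X in X.-homog]mul1n; apply: subst_forms_homog => // i.
by rewrite dhomogX /= mdeg1.
Qed.

Lemma meval_lift_form (F : {mpoly C[d.+1]}) (u : 'I_n.+1 -> C) :
  (lift_form F).@[u] = F.@[u \o s].
Proof. by rewrite meval_subst_forms; apply: meval_eq => i; rewrite mevalXU. Qed.

Lemma torus_poly_lift (F : {mpoly C[d.+1]}) :
  torus_poly p (lift_form F) = torus_poly (@osc d) F.
Proof.
rewrite /lift_form /subst_forms torus_poly_sum torus_polyE; apply: eq_bigr => e _.
rewrite torus_polyZ -torus_poly_monom mpolyXE_id; congr (_ * _).
rewrite [LHS]rmorph_prod [RHS]rmorph_prod; apply: eq_bigr => i _.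
by rewrite [LHS]torus_polyXn [RHS]torus_polyXn !torus_poly_monom !mexpwU hs.
Qed.

(** These relations keep the surface away from the centre of the projection, and they are also the
    integral equations behind finiteness. *)
Lemma multiple_monomial : exists2 M, (0 < M)%N &
  forall i, exists2 e : 'X_{1..d.+1}, mdeg e = M &
    forall L, XB L -> hcoord L i ^+ M = \prod_j hcoord L (s j) ^+ e j.
Proof.
have [M M0 hM] := polygon_multiple d1; exists M => // i.
have hi : in_polygon d (p i) by apply/hp; exists i.
have [e eM ew] := (sumset_mexpw _ _ (@mem_oscs d)).1 (hM _ hi).
exists e => // L XL.
have hX : ('X_i ^+ M : {mpoly C[n.+1]}) \is M.-homog.
  by rewrite -[X in X.-homog]mul1n dhomogMn // dhomogX /= mdeg1.
have := @toric_eq C n p M ('X_i ^+ M) (lift_form 'X_[e]) L XL hX.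
rewrite meval_lift_form mevalX [('X_i ^+ M).@[_]]rmorphXn /= mevalXU; apply.
  by apply: lift_form_homog; rewrite dhomogX /= eM.
rewrite torus_poly_lift torus_polyXn !torus_poly_monom ew mexpwU.
by rewrite /bimono exprMn -polyC_exp -!exprM ![(_ * M)%N]mulnC.
Qed.

Lemma proj_vline (v : 'rV[C]_n.+1) : proj <[v]>%VS = <[colsub s v]>%VS.
Proof. by rewrite /coord_projection limg_line lfunE. Qed.

Lemma hcoord_base L : XB L -> exists j, hcoord L (s j) != 0.
Proof.
move=> XL; have [M M0 hM] := multiple_monomial.
have [i hi] := hcoord_neq0 XL.1; have [e eM he] := hM i.
apply: contrapT => hn; move: (expf_neq0 M hi); rewrite he //; apply/negP; rewrite negbK.
have [j ej] : exists j, e j != 0%N.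
  apply/existsP; apply: contraTT M0 => /existsPn h.
  by rewrite -eM mdegE big1 // => j _; apply/eqP; have := h j; rewrite negbK.
rewrite (bigD1 j) //= mulf_eq0 expf_eq0 lt0n ej /=.
by apply/orP; left; apply/negPn/negP => h; apply: hn; exists j.
Qed.

Lemma hcoord_proj L : XB L -> exists2 c, c != 0 &
  forall j, hcoord (proj L) j = c * hcoord L (s j).
Proof.
move=> XL; have [v0 eL] := proj_space_vpick XL.1.
have [j hj] := hcoord_base XL.
have w0 : colsub s (vpick L) != 0.
  by apply: contraNneq hj => h; have := congr1 (fun w : 'rV[C]_d.+1 => w 0 j) h; rewrite !mxE /hcoord => ->.
have [c c0 h] := hcoord_vline w0; exists c => // i.
by rewrite {1}eL proj_vline h mxE.
Qed.

Lemma proj_forms W : W `<=` XB -> given_by_forms W proj.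
Proof.
move=> hW; exists 1%N, (fun j => 'X_(s j)); split=> [j|L /hW/hcoord_proj[c c0 h]].
  by rewrite dhomogX /= mdeg1.
by exists c => // j; rewrite h mevalXU.
Qed.

Lemma proj_toric L : XB L -> XA (proj L).
Proof.
move=> XL; have [c c0 h] := hcoord_proj XL; split.
  have [j hj] := hcoord_base XL; have [v0 eL] := proj_space_vpick XL.1.
  rewrite eL proj_vline; apply: proj_space_vline.
  by apply: contraNneq hj => h'; have := congr1 (fun w : 'rV[C]_d.+1 => w 0 j) h'; rewrite !mxE /hcoord => ->.
move=> k F hF F0; rewrite (meval_eq _ h) (meval_homogZ _ _ hF) -meval_lift_form.
have [_ hL] := XL; rewrite (hL _ _ (lift_form_homog hF)) ?mulr0 //.
by rewrite torus_poly_lift.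
Qed.

Lemma proj_torus_point (x y : C) :
  proj <[torus_point p x y]>%VS = <[torus_point (@osc d) x y]>%VS.
Proof.
by rewrite proj_vline; congr (<[_]>)%VS; apply/rowP => j; rewrite !mxE hs.
Qed.

Lemma proj_morphism : @Defs.morphism C (proj_variety XB) (proj_variety XA) proj.
Proof.
have hB := @toric_sub C n p; have hA := @toric_sub C d (@osc d).
have oB := proj_opensT hB; have fB := proj_forms (fun L (h : XB L) => h).
split=> /=; first exact: proj_toric.
- by move=> V oV; exact: (form_map_open hB hA oB fB proj_toric).
- by move=> V g oV; exact: (form_map_regular hB hA oB fB proj_toric).
Qed.

Let o0 : 'I_d.+1 := inord 0.
Let o1 : 'I_d.+1 := inord 1.
Let o2 : 'I_d.+1 := inord 2.

Lemma osc_inord (k : nat) : (k <= d)%N -> osc (inord k : 'I_d.+1) = (k, 'C(k, 2)).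
Proof. by move=> kd; rewrite /osc inordK. Qed.

Let q0 : osc o0 = (0, 0)%N. Proof. exact: osc_inord. Qed.
Let q1 : osc o1 = (1, 0)%N. Proof. by apply: osc_inord; exact: ltnW. Qed.
Let q2 : osc o2 = (2, 1)%N. Proof. by apply: osc_inord; exact: ltnW. Qed.
Let r0 : p (s o0) = (0, 0)%N. Proof. by rewrite hs. Qed.
Let r1 : p (s o1) = (1, 0)%N. Proof. by rewrite hs. Qed.
Let r2 : p (s o2) = (2, 1)%N. Proof. by rewrite hs. Qed.

(* The torus coordinates of a point of the surface are [x1 / x0] and
   [x0 x2 / x1 ^ 2]; the monomial of weight [p i] in them is made polynomial by
   the factor [x0 ^ d * x1 ^ (d * d)]. *)
Definition inverse_form (i : 'I_n.+1) : {mpoly C[d.+1]} :=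
  'X_o0 ^+ (d + (p i).2 - (p i).1) * 'X_o1 ^+ (d * d + (p i).1 - 2 * (p i).2)
    * 'X_o2 ^+ (p i).2.

Lemma inverse_form_exponents (i : 'I_n.+1) :
  ((p i).1 <= d + (p i).2)%N /\ (2 * (p i).2 <= d * d + (p i).1)%N.
Proof.
have /and3P[h1 h2 h3] : in_polygon d (p i) by apply/hp; exists i.
split; first by apply: leq_trans h1 _; exact: leq_addr.
apply: leq_trans h3 _; apply: leq_trans (leq_addr _ _).
by apply: leq_mul => //; exact: leq_pred.
Qed.

Definition inverse_map (L : {vspace 'rV[C]_d.+1}) : {vspace 'rV[C]_n.+1} :=
  <[\row_i (inverse_form i).@[hcoord L]]>%VS.

Lemma inverse_row (x y : C) : x != 0 -> y != 0 ->
  exists2 c, c != 0 & \row_i (inverse_form i).@[hcoord <[torus_point (@osc d) x y]>%VS] =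
    c *: torus_point p x y.
Proof.
move=> x0 y0; have [c c0 h] := hcoord_vline (torus_point_neq0 (@osc d) x0 y0).
exists (c ^+ (d + d * d) * x ^+ (d * d)); first by rewrite mulf_neq0 // expf_neq0.
apply/rowP => i; rewrite !mxE !mevalM !rmorphXn /= !mevalXU !h !mxE q0 q1 q2 /=.
have [e1 e2] := inverse_form_exponents i.
move: (p i) e1 e2 => [a b] /= e1 e2.
rewrite !expr0 !expr1 !mulr1 !exprMn.
have -> : (d + d * d = (d + b - a) + (d * d + a - 2 * b) + b)%N by lia.
have -> : x ^+ (d * d + a - 2 * b) = x ^+ (d * d) * x ^+ a / (x ^+ b * x ^+ b).
  by rewrite -!exprD -{2}(subnK e2) exprD addnn -mul2n mulfK // expf_neq0.
by rewrite !exprD; field; rewrite expf_neq0.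
Qed.

Lemma proj_birational : @birational C (proj_variety XB) (proj_variety XA) proj.
Proof.
have hB := @toric_sub C n p; have hA := @toric_sub C d (@osc d).
have one0 := oner_neq0 C.
pose U := @big_torus C n p (s o0) (s o1) (s o2); pose V := @big_torus C d (@osc d) o0 o1 o2.
have oU : proj_opens XB U by exact: big_torus_open.
have oV : proj_opens XA V by exact: big_torus_open.
have UP := @big_torusP C n p _ _ _ r0 r1 r2; have VP := @big_torusP C d (@osc d) _ _ _ q0 q1 q2.
have fU L : U L -> V (proj L).
  by move=> /UP[x [y [x0 y0 ->]]]; rewrite proj_torus_point; apply/VP; exists x, y.
have inv x y : x != 0 -> y != 0 ->
    inverse_map <[torus_point (@osc d) x y]>%VS = <[torus_point p x y]>%VS.
  by move=> x0 y0; rewrite /inverse_map; have [c c0 ->] := inverse_row x0 y0; rewrite vlineZ.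
have gV L : V L -> U (inverse_map L).
  by move=> /VP[x [y [x0 y0 ->]]]; rewrite inv //; apply/UP; exists x, y.
exists U, V; split=> //.
- by exists <[torus_point p 1 1]>%VS; apply/UP; exists 1, 1.
- by exists <[torus_point (@osc d) 1 1]>%VS; apply/VP; exists 1, 1.
split.
  apply: form_map_morphism => //; first by apply: proj_forms => L [].
  by move=> L /fU[].
exists inverse_map; split.
- apply: form_map_morphism => //; last by move=> L /gV[].
  exists (d + d * d)%N, inverse_form; split.
    move=> i; have [e1 e2] := inverse_form_exponents i; rewrite /inverse_form.
    have hom (j : 'I_d.+1) k : ('X_j ^+ k : {mpoly C[d.+1]}) \is k.-homog.
      by rewrite -[X in X.-homog]mul1n dhomogMn // dhomogX /= mdeg1.
    have -> : (d + d * d = (d + (p i).2 - (p i).1) +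
      (d * d + (p i).1 - 2 * (p i).2) + (p i).2)%N by lia.
    by rewrite !dhomogM.
  move=> L /VP[x [y [x0 y0 ->]]]; have [c c0 e] := inverse_row x0 y0.
  have row0 : \row_i (inverse_form i).@[hcoord <[torus_point (@osc d) x y]>%VS] != 0.
    by rewrite e scaler_eq0 negb_or c0 torus_point_neq0.
  have [c' c'0 h] := hcoord_vline row0; exists c' => // i.
  by rewrite h mxE.
- by move=> L /UP[x [y [x0 y0 ->]]]; rewrite proj_torus_point inv.
- by move=> L /VP[x [y [x0 y0 ->]]]; rewrite inv // proj_torus_point.
Qed.

End Projection.

(** * Surjectivity and finiteness of the projection *)

Section ProjectionImage.
Variables (C : numClosedFieldType) (d n : nat) (p : 'I_n.+1 -> nat * nat).
Variable s : 'I_d.+1 -> 'I_n.+1.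
Hypothesis d2 : (2 < d)%N.
Hypothesis hp : forall w, in_polygon d w <-> exists i, p i = w.
Hypothesis hs : forall j, p (s j) = osc j.
Notation XA := (@toric C d (@osc d)).
Notation XB := (@toric C n p).
Notation proj := (@coord_projection C n d s).

(** By [far_points_interior] a power of [x_i x_l] equals a monomial divisible by [x_0 x_1 x_2] on
    the surface. *)
Lemma toric_far_points L (i l : 'I_d.+1) : XA L ->
  (i.+1 < l)%N -> ~~ ((nat_of_ord i == 0) && (nat_of_ord l == d))%N ->
  hcoord L i != 0 -> hcoord L l != 0 ->
  (@big_torus C d (@osc d) (inord 0) (inord 1) (inord 2)) L.
Proof.
move=> XL il ne zi zl; have ld : (l <= d)%N by rewrite -ltnS.
have hil : (i.+1 < l <= d)%N by rewrite il.
have [M [N [k [w [N0 hw e1 e2 e3]]]]] := far_points_interior d2 hil ne.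
have [e ek ew] := (sumset_mexpw k w (@mem_oscs d)).1 hw.
split=> //; set Y := 'X_(inord 0) * 'X_(inord 1) * 'X_(inord 2).
have hX (j : 'I_d.+1) : ('X_j : {mpoly C[d.+1]}) \is 1.-homog by rewrite dhomogX /= mdeg1.
have hY : Y \is 3.-homog by rewrite (@dhomogM _ _ _ 2 _ 1) ?(@dhomogM _ _ _ 1 _ 1).
have := @toric_eq C d (@osc d) (2 * M) (('X_i * 'X_l) ^+ M) (Y ^+ N * 'X_[e]) L XL.
have -> : (('X_i * 'X_l : {mpoly C[d.+1]}) ^+ M).@[hcoord L] = (hcoord L i * hcoord L l) ^+ M.
  by rewrite rmorphXn /= mevalM !mevalXU.
rewrite mevalM (_ : (Y ^+ N).@[_] = Y.@[hcoord L] ^+ N); last by rewrite rmorphXn.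
move=> h; have : (hcoord L i * hcoord L l) ^+ M != 0 by rewrite expf_neq0 // mulf_neq0.
rewrite h; first by rewrite mulf_eq0 negb_or expf_eq0 N0 /= => /andP[].
- by rewrite dhomogMn // (@dhomogM _ _ _ 1 _ 1).
- rewrite (_ : 2 * M = 3 * N + k)%N ?dhomogM ?dhomogMn ?dhomogX /= ?ek //; lia.
rewrite torus_polyXn !torus_polyM torus_polyXn !torus_polyM !torus_poly_monom !mexpwU ew.
have d1 : (1 < d)%N by exact: ltnW.
have d0 : (0 < d)%N by exact: ltnW.
rewrite !osc_inord //.
have bX (u : nat * nat) (m : nat) : bimono C u ^+ m = bimono C (m * u.1, m * u.2)%N.
  by rewrite /bimono exprMn -polyC_exp -!exprM ![(_ * m)%N]mulnC.
rewrite !bimonoM !bX bimonoM /=; congr (bimono C (_, _)); first by rewrite e2.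
by rewrite e3 muln1.
Qed.

(** With the scalar [c0] free, [x] alone reaches every ratio of the two end coordinates of an edge,
    so [y = 1] is enough. *)
Lemma proj_face (u v c : int) (x c0 : C) L :
  (forall i, 0 <= wt u v (p i).1 (p i).2 + c) -> XA L -> c0 != 0 ->
  (forall j : 'I_d.+1, hcoord L j =
    c0 * (if wt u v j 'C(j, 2) + c == 0 then x ^+ j else 0)) ->
  exists2 K, XB K & proj K = L.
Proof.
move=> pos XL c00 h.
have ec : colsub s (face_point p u v c x 1) =
    \row_(j < d.+1) (if wt u v j 'C(j, 2) + c == 0 then x ^+ j else 0).
  by apply/rowP => j; rewrite !mxE hs /= expr1n mulr1.
have [j hj] := hcoord_neq0 XL.1.
have f0 : face_point p u v c x 1 != 0.
  apply: contraNneq hj => f0; have := congr1 (fun r : 'rV[C]_d.+1 => r 0 j) ec.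
  by rewrite f0 !mxE h => <-; rewrite mulr0.
exists <[face_point p u v c x 1]>%VS; first exact: face_point_toric.
rewrite proj_vline ec; apply/esym/(vline_eq XL.1 c00) => i.
by rewrite mxE.
Qed.

Lemma polygon_low (i : 'I_n.+1) : ((p i).1 * (p i).1.-1 <= 2 * (p i).2)%N.
Proof. by have /and3P[] : in_polygon d (p i) by apply/hp; exists i. Qed.

Lemma osc_double (j : nat) : 2 * 'C(j, 2)%:Z = j%:Z * (j%:Z - 1).
Proof. by have := double_bin2 j; case: j => [|j] /= h; lia. Qed.

(* The support of a point of the surface outside the big torus is contained in an
   edge; on it the point is the projection of a point of the same face. *)
Lemma proj_surjective L : XA L -> exists2 K, XB K & proj K = L.
Proof.
move=> XL; set z := hcoord L.
have d1 : (1 < d)%N by exact: ltnW.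
have [tL|ntL] := pselect (@big_torus C d (@osc d) (inord 0) (inord 1) (inord 2) L).
  have e0 : osc (inord 0 : 'I_d.+1) = (0, 0)%N by exact: osc_inord.
  have e1 : osc (inord 1 : 'I_d.+1) = (1, 0)%N by apply: osc_inord; exact: ltnW.
  have e2 : osc (inord 2 : 'I_d.+1) = (2, 1)%N by apply: osc_inord; exact: ltnW.
  have [x [y [x0 y0 ->]]] := (big_torusP e0 e1 e2 L).1 tL.
  exists <[torus_point p x y]>%VS; first exact: torus_point_toric.
  exact: proj_torus_point.
have far (i l : 'I_d.+1) : (i.+1 < l)%N ->
    ~~ ((nat_of_ord i == 0) && (nat_of_ord l == d))%N -> z i != 0 -> z l = 0.
  move=> il ne zi; apply/eqP/negPn/negP => zl; apply: ntL.
  exact: (toric_far_points XL il ne zi zl).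
have [j0 hj0] := hcoord_neq0 XL.1.
have [i zi mini] := @arg_minnP _ j0 (fun j => z j != 0) (fun j => nat_of_ord j) hj0.
have [l zl maxl] := @arg_maxnP _ j0 (fun j => z j != 0) (fun j => nat_of_ord j) hj0.
have out (j : 'I_d.+1) : (j < i)%N || (l < j)%N -> z j = 0.
  move=> h; apply/eqP/negPn/negP => zj; have := mini j zj; have := maxl j zj.
  by move=> /= h1 h2; move: h; rewrite ltnNge h2 ltnNge h1.
have il : (i <= l)%N := mini l zl.
have [eil | nil] := eqVneq (i : nat) l.
  (* A line touching the polygon only at the vertex [i]: its value at [(a, b)] is at least
     [(a - i) ^ 2]. *)
  apply: (@proj_face (1 - 2 * i%:Z) 2 (i%:Z ^+ 2) 1 (z i)) => //.
    move=> k; have := polygon_low k; case: (p k) => a b /= h; rewrite /wt.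
    have : 0 <= (a%:Z - i%:Z) ^+ 2 by exact: sqr_ge0.
    by case: a h => [|a] h /=; nia.
  move=> j; rewrite expr1n; have e := osc_double j; have [ej|ne] := eqVneq j i.
    rewrite ej in e *; rewrite (_ : _ + _ = 0) ?eqxx ?mulr1 //.
    by rewrite /wt e; ring.
  have nj : (j != i :> nat) by [].
  rewrite (_ : _ + _ = (j%:Z - i%:Z) ^+ 2); last by rewrite /wt e; ring.
  rewrite expf_eq0 /= subr_eq0 eqz_nat (negbTE nj) mulr0; apply: out.
  by rewrite -eil -neq_ltn.
have ltil : (i < l)%N by rewrite ltn_neqAle nil.
have [eli | nli] := eqVneq (l : nat) i.+1.
  have id : (i < d)%N by rewrite -ltnS -eli.
  pose x := z l / z i; have x0 : x != 0 by rewrite mulf_neq0 // invr_eq0.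
  apply: (@proj_face (- (2 * i)%N%:Z) 2 (i * i.+1)%N%:Z x (z i / x ^+ i)) => //.
  - move=> k; apply: (facet_pos hp (e := (- (2 * i)%N%:Z, 2, (i * i.+1)%N%:Z))).
    by rewrite inE map_f ?orbT // mem_iota.
  - by rewrite mulf_neq0 // invr_eq0 expf_neq0.
  move=> j; have e := osc_double j.
  rewrite (_ : _ + _ = (j%:Z - i%:Z) * (j%:Z - l%:Z)); last first.
    by rewrite /wt e eli; lia.
  rewrite mulf_eq0 !subr_eq0 !eqz_nat.
  have [ej|nj] := eqVneq (j : nat) i.
    by rewrite -/z ej /= (_ : z j = z i) ?divfK ?expf_neq0 //; congr (z _); apply: val_inj.
  have [ej'|nj'] := eqVneq (j : nat) l.
    rewrite -/z ej' eli /= (_ : z j = z l); last by congr (z _); apply: val_inj.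
    by rewrite exprS mulrCA divfK ?expf_neq0 // /x divfK.
  rewrite mulr0; apply: out; move: nj nj'; rewrite eli; lia.
have farl : (i.+1 < l)%N by rewrite ltn_neqAle eq_sym nli.
have [/andP[/eqP ei /eqP el] | ne] := boolP ((nat_of_ord i == 0) && (nat_of_ord l == d))%N; last first.
  by move: zl; rewrite (far i l farl ne zi) eqxx.
have d0 : (0 < d)%N by exact: ltnW.
have mid (j : 'I_d.+1) : (0 < j < d)%N -> z j = 0.
  move=> /andP[j0' jd]; have [j1 | j1] := ltnP 1 j.
    by apply: (far i j) => //; rewrite ?ei // negb_and; apply/orP; right; rewrite neq_ltn jd.
  apply/eqP/negPn/negP => zj; have ej : nat_of_ord j = 1%N by apply/eqP; rewrite eqn_leq j1.
  by move: zl; rewrite (far j l _ _ zj) ?eqxx // ?ej ?el.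
(* On the upper edge only the coordinates 0 and [d] are nonzero, so only [x ^+ d] is prescribed. *)
pose x := d.-root (z l / z i).
have xd : x ^+ d = z l / z i by rewrite /x rootCK.
apply: (@proj_face d.-1%:Z (- 2) 0 x (z i)) => //.
  move=> k; apply: (facet_pos hp (e := (d.-1%:Z, - 2, 0))).
  exact: mem_head.
move=> j; have e := osc_double j.
rewrite (_ : _ + _ = j%:Z * (d%:Z - j%:Z)); last first.
  by have -> : d.-1%:Z = d%:Z - 1; [lia|rewrite /wt mulNr e; ring].
rewrite mulf_eq0 subr_eq0 !eqz_nat.
have [ej|nj] := eqVneq (j : nat) 0%N.
  by rewrite ej /= mulr1; congr (z _); apply: val_inj; rewrite /= ej ei.
have [ej'|nj'] := eqVneq (d : nat) j.
  have -> : x ^+ j = z l / z i by rewrite -xd; congr (x ^+ _).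
  rewrite mulrC divfK //; congr (z _); apply: val_inj.
  exact: etrans (esym ej') (esym el).
rewrite mulr0; apply: mid; rewrite lt0n nj /= ltn_neqAle eq_sym nj' /=.
by rewrite -ltnS.
Qed.

Lemma toric_closed (m : nat) (q : 'I_m.+1 -> nat * nat) : proj_closed (@toric C m q).
Proof.
exists [set F | (exists k, F \is k.-homog) /\ torus_poly q F = 0]; first by move=> F [].
apply/seteqP; split=> L [hL h]; split=> //.
  by move=> F [[k hF] F0]; apply: (h k).
by move=> k F hF F0; apply: h; split=> //; exists k.
Qed.

Lemma preim_chart (j : 'I_d.+1) :
  @Defs.preim C (proj_variety XB) (proj_variety XA) proj (chart XA j) = chart XB (s j).
Proof.
apply/seteqP; split=> L /=.
  move=> [XL [_ hj]]; split=> //; have [c c0 h] := hcoord_proj d2 hp hs XL.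
  by move: hj; rewrite h mulf_eq0 negb_or => /andP[].
move=> [XL hj]; split=> //; split; first exact: (proj_toric d2 hp hs).
by have [c c0 h] := hcoord_proj d2 hp hs XL; rewrite h mulf_neq0.
Qed.

Lemma dehomogenize_proj (j l : 'I_d.+1) L : XB L ->
  dehomogenize j (proj L) l = dehomogenize (s j) L (s l).
Proof.
move=> XL; have [c c0 h] := hcoord_proj d2 hp hs XL.
by rewrite /dehomogenize !h invfM mulrACA divff ?mul1r.
Qed.

(* The [M]-th power of each coordinate ratio upstairs is a monomial in ratios from
   downstairs, so monomials with exponents below [M] generate. *)
Lemma proj_finite_sections (j : 'I_d.+1) :
  @finite_sections C (proj_variety XB) (proj_variety XA) proj (chart XA j).
Proof.
have hA := @toric_sub C d (@osc d); have hB := @toric_sub C n p.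
have d1 : (1 < d)%N by exact: ltnW.
have [[//|M'] _ hM] := @multiple_monomial C d n p s d2 hp hs; set M := M'.+1 in hM.
have /choice[e he] : forall i, exists e : 'X_{1..d.+1}, mdeg e = M /\
    forall L, XB L -> hcoord L i ^+ M = \prod_l hcoord L (s l) ^+ e l.
  by move=> i; have [e e1 e2] := hM i; exists e.
pose T := {ffun 'I_n.+1 -> 'I_M}.
pose gen (r : T) : {mpoly C[n.+1]} := \prod_i 'X_i ^+ r i.
rewrite /finite_sections preim_chart.
exists #|T|, (fun i L => (gen (enum_val i)).@[dehomogenize (s j) L]); split.
  by move=> i; apply: chart_regular => //; exact: hB.
move=> h /(chart_functions d1 hp)[k [Psi [hPsi ePsi]]].
(* Exponents are divided by [M]: the remainders select the generator, the quotients become monomials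
   in the ratios downstairs, collected in [a]. *)
pose rem (m : 'X_{1..n.+1}) : T := [ffun i => inord (m i %% M)].
pose a (r : T) : {mpoly C[d.+1]} := \sum_(m <- msupp Psi | rem m == r)
  Psi@_m *: \prod_i 'X_[e i] ^+ (m i %/ M).
exists (fun i L => (a (enum_val i)).@[dehomogenize j L]); split.
  by move=> i; exact: chart_regular.
move=> L cL; have [XL Lj] := cL; rewrite ePsi //.
transitivity (Psi.@[dehomogenize (s j) L]).
  transitivity (((hcoord L (s j))^-1) ^+ k * Psi.@[hcoord L]).
    by rewrite exprVn mulrC.
  by rewrite -(meval_homogZ _ _ hPsi); apply: meval_eq => i; rewrite mulrC.
rewrite -(big_enum_val (A := T) (fun r : T => (a r).@[dehomogenize j (proj L)] *
  (gen r).@[dehomogenize (s j) L])) /=.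
rewrite mevalE (partition_big rem xpredT) //=; apply: eq_bigr => r _.
rewrite /a raddf_sum mulr_suml; apply: eq_bigr => m /eqP hr /=.
rewrite mevalZ -mulrA; congr (_ * _).
rewrite [X in _ = X * _]rmorph_prod [X in _ = _ * X]rmorph_prod -big_split.
apply: eq_bigr => i _ /=.
have -> : ('X_[e i] ^+ (m i %/ M)).@[dehomogenize j (proj L)] =
    dehomogenize (s j) L i ^+ (M * (m i %/ M)).
  rewrite rmorphXn /= mevalX exprM; congr (_ ^+ _).
  have [eM hE] := he i; rewrite /dehomogenize expr_div_n hE // -eM mdegE -prodrXr -prodf_div.
  apply: eq_bigr => l _; rewrite -expr_div_n; congr (_ ^+ _).
  exact: dehomogenize_proj.
by rewrite rmorphXn /= mevalXU -exprD -hr ffunE inordK ?ltn_mod // mulnC -divn_eq.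
Qed.

Lemma proj_finite : @finite_morphism C (proj_variety XB) (proj_variety XA) proj.
Proof.
have hA := @toric_sub C d (@osc d); have hB := @toric_sub C n p.
split; first exact: (@proj_morphism C d n p s d2 hp hs).
move=> L XL; have [j hj] := hcoord_neq0 XL.1.
exists (chart XA j); split=> //.
- exact: chart_open.
- by apply: chart_affine => //; exact: toric_closed.
- by rewrite preim_chart; apply: chart_affine => //; exact: toric_closed.
- exact: proj_finite_sections.
Qed.

Lemma proj_normalization :
  @normalization C (proj_variety XB) (proj_variety XA) proj.
Proof.
split; first exact: toric_irreducible.
- exact: (@toric_normal C n d p (ltnW d2) hp).
- exact: proj_finite.
- exact: (@proj_birational C d n p s d2 hp hs).
Qed.

Lemma proj_image : proj @` XB = XA.
Proof.
apply/seteqP; split=> L.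
  by move=> [K XK <-]; exact: (proj_toric d2 hp hs).
by move=> /proj_surjective[K XK <-]; exists K.
Qed.

End ProjectionImage.

(** * Degree and conclusion *)

Section HilbertFunction.
Variables (C : numClosedFieldType) (n : nat) (p : 'I_n.+1 -> nat * nat).

(** [torus_poly] embeds the degree [k] part of the coordinate ring onto the span of the
    [x ^ a y ^ b] with [(a, b)] in the sumset; the basis takes one monomial above each. *)
Lemma toric_hilbert_function (s : seq (nat * nat)) (k : nat) :
  (forall u, u \in s <-> exists i, p i = u) ->
  hilbert_function (@toric C n p) k (size (sumset s k)).
Proof.
move=> hs; set S := sumset s k.
pose w (i : 'I_(size S)) := nth (0, 0)%N S i.
have wS i : w i \in S by rewrite mem_nth.
have winj : injective w.
  move=> i j /eqP; rewrite nth_uniq ?sumset_uniq // => /eqP h; exact: val_inj.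
have /choice[m hm] : forall i, exists m : 'X_{1..n.+1}, mdeg m = k /\ mexpw p m = w i.
  by move=> i; have [m m1 m2] := (sumset_mexpw k (w i) hs).1 (wS i); exists m.
have homm i : ('X_[m i] : {mpoly C[n.+1]}) \is k.-homog.
  by rewrite dhomogX; apply/eqP; case: (hm i).
exists (fun i => 'X_[m i]); split=> // F hF.
have homs (c : 'rV[C]_(size S)) : (\sum_i c 0 i *: 'X_[m i] : {mpoly C[n.+1]}) \is k.-homog.
  by apply: rpred_sum => i _; exact: dhomogZ.
have tp (c : 'rV[C]_(size S)) a b :
    (torus_poly p (\sum_i c 0 i *: 'X_[m i]))`_b`_a = \sum_i c 0 i * ((a, b) == w i)%:R.
  rewrite torus_poly_sum !coef_sum; apply: eq_bigr => i _.
  by rewrite torus_polyZ torus_poly_monom (hm i).2 coefCM coefCM coef_bimono.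
have tpw (c : 'rV[C]_(size S)) i :
    (torus_poly p (\sum_i c 0 i *: 'X_[m i]))`_(w i).2`_(w i).1 = c 0 i.
  rewrite tp -surjective_pairing (bigD1 i) //= eqxx mulr1 big1 ?addr0 // => j ji.
  by rewrite (inj_eq winj) eq_sym (negbTE ji) mulr0.
have van (c : 'rV[C]_(size S)) : vanishes (@toric C n p) (F - \sum_i c 0 i *: 'X_[m i]) <->
    torus_poly p F = torus_poly p (\sum_i c 0 i *: 'X_[m i]).
  have hv := @vanishes_toric C n p k _ (rpredB hF (homs c)).
  rewrite torus_polyB in hv; split=> [/hv/eqP|e]; first by rewrite subr_eq0 => /eqP.
  by apply/hv; rewrite e subrr.
exists (\row_i (torus_poly p F)`_(w i).2`_(w i).1); split.
  apply/van/polyP => b; apply/polyP => a; rewrite tp.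
  have [hab|hab] := boolP ((a, b) \in S).
    pose i := Ordinal (etrans (index_mem (a, b) S) hab).
    have ei : w i = (a, b) by rewrite /w nth_index.
    rewrite (bigD1 i) //= ei eqxx mulr1 mxE ei big1 ?addr0 // => j ji.
    by rewrite -ei (inj_eq winj) eq_sym (negbTE ji) mulr0.
  rewrite big1 => [|i _]; last first.
    by case: eqP hab => [->|]; rewrite ?wS // mulr0.
  apply/eqP/negPn/negP => /(torus_poly_supp hF)[e ek ew].
  by move/negP: hab; apply; apply/(sumset_mexpw k _ hs); exists e.
move=> c /van e; apply/rowP => i; rewrite mxE e; exact: tpw.
Qed.

End HilbertFunction.

Lemma toric_osc_degree (C : numClosedFieldType) (d : nat) : (1 < d)%N ->
  dimension_degree (@toric C d (@osc d)) 2 'C(d.+1, 3).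
Proof.
move=> d1; have [a [b [k0 h]]] := sumset_growth d1.
set l := _ / _ in h.
have l0 : l != 0 by rewrite mulf_neq0 ?pnatr_eq0 // -lt0n bin_gt0.
pose P : {poly rat} := l *: 'X^2 + (a *: 'X + b%:P).
have sz : size P = 3%N.
  rewrite size_polyDl size_scale ?size_polyXn // ltnS.
  apply: leq_trans (size_polyD _ _) _; rewrite geq_max.
  rewrite (leq_trans (size_scale_leq _ _)) ?size_polyX //=.
  by rewrite (leq_trans (size_polyC_leq1 _)).
exists P; split=> //.
  exists k0 => k hk; exists (size (sumset (oscs d) k)).
    exact: toric_hilbert_function (@mem_oscs d).
  by rewrite h // /P hornerD hornerZ hornerXn hornerD hornerZ hornerX hornerC addrA.
rewrite lead_coefE sz /= !coefD !coefZ coefXn coefX coefC /= mulr1 mulr0 !addr0.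
by rewrite /l mulrC divfK.
Qed.

(** * The matrices of lattice points of the polygon *)

Section LatticePoints.
Variables (R : realType) (d : nat).
Hypothesis d1 : (1 < d)%N.

Lemma lattice_point_matrix_exists :
  exists (N : nat) (B : 'M[int]_(1 + 2, N.+1)), lattice_point_matrix R d B.
Proof.
pose S := polygon_seq d.
have S0 : (0 < size S)%N.
  have : (0, 0)%N \in S by rewrite mem_polygon_seq /in_polygon.
  by case: S.
exists (size S).-1.
pose w (j : 'I_(size S).-1.+1) := nth (0, 0)%N S j.
have wS j : in_polygon d (w j) by rewrite -mem_polygon_seq mem_nth // -[X in (_ < X)%N](prednK S0).
pose B : 'M[int]_(1 + 2, (size S).-1.+1) :=
  \matrix_(i, j) (col_mx (const_mx 1) (int_point (w j)) : 'M[int]_(1 + 2, 1)) i 0.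
have colB j : col j B = col_mx (const_mx 1) (int_point (w j)).
  by apply/matrixP => i k; rewrite ord1 !mxE.
exists B; split.
  move=> i j /=; rewrite !colB => /eq_col_mx[_ /int_point_inj/eqP].
  rewrite nth_uniq ?polygon_seq_uniq -1?[X in (_ < X)%N](prednK S0) // => /eqP h.
  exact: val_inj.
apply/seteqP; split=> x.
  move=> [j _ <-]; rewrite colB; exists (int_point (w j)) => //.
  by apply/osc_polygonP => //; exists (w j).
move=> [b /(osc_polygonP _ _ d1)[u hu ->] <-].
have uS : u \in S by rewrite mem_polygon_seq.
have hi : (index u S < (size S).-1.+1)%N by rewrite prednK // index_mem.
by exists (Ordinal hi) => //; rewrite colB /w nth_index.
Qed.

Variables (N : nat) (B : 'M[int]_(1 + 2, N.+1)).
Hypothesis hB : lattice_point_matrix R d B.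

Lemma lattice_point_matrix_points : exists p : 'I_N.+1 -> nat * nat,
  [/\ injective p, forall w, in_polygon d w <-> exists i, p i = w
    & forall j, col j B = col_mx (const_mx 1) (int_point (p j))].
Proof.
have [injB rangeB] := hB.
have /choice[p hp] : forall j, exists w, in_polygon d w /\
    col j B = col_mx (const_mx 1) (int_point w).
  move=> j; have : range (fun j => col j B) (col j B) by exists j.
  by rewrite rangeB => -[b /(osc_polygonP _ _ d1)[w hw ->] <-]; exists w.
exists p; split.
- by move=> i j e; apply: injB; rewrite (hp i).2 (hp j).2 e.
- move=> w; split=> [hw|[i <-]]; last by case: (hp i).
  have : range (fun j => col j B) (col_mx (const_mx 1) (int_point w)).
    by rewrite rangeB; exists (int_point w) => //; apply/osc_polygonP => //; exists w.
  move=> [i _]; rewrite (hp i).2 => /eq_col_mx[_ /int_point_inj]; by exists i.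
- by move=> j; case: (hp j).
Qed.

End LatticePoints.

Lemma col_dsubmx (m : nat) (A : 'M[int]_(1 + 2, m)) (j : 'I_m) (w : nat * nat) :
  col j A = col_mx (const_mx 1) (int_point w) ->
  dsubmx A 0 j = w.1%:Z /\ dsubmx A 1 j = w.2%:Z.
Proof.
move=> h; have e i : dsubmx A i j = int_point w i 0.
  by rewrite -[int_point w](@col_mxKd _ 1 2 1 (const_mx 1)) -h !mxE.
by rewrite !e !mxE.
Qed.

Lemma osc_in_polygon (d : nat) (j : 'I_d.+1) : in_polygon d (osc j).
Proof.
have jd : (j <= d)%N by rewrite -ltnS.
rewrite /in_polygon /osc [X in (X <= d)%N]/= jd [X in (X * _ <= _)%N]/=.
rewrite [X in (2 * X)%N]/= double_bin2 leqnn leq_mul2l.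
by rewrite -!subn1 leq_sub2r // orbT.
Qed.

Lemma col_osc_matrix (d : nat) (j : 'I_d.+1) :
  col j (osc_matrix d) = col_mx (const_mx 1) (int_point (osc j)).
Proof.
apply/colP => i; rewrite !mxE; case: splitP => k _; rewrite !mxE //.
Qed.

Unset Implicit Arguments.
Set Strict Implicit.

Theorem proposition4p1 (R : realType) (d : nat) (hd : (3 <= d)%N) :
  dimension_degree (toric_variety R[i] (osc_matrix d)) 2 'C(d.+1, 3) /\
  (exists (N : nat) (B : 'M[int]_(1 + 2, N.+1)), lattice_point_matrix R d B) /\
  forall (N : nat) (B : 'M[int]_(1 + 2, N.+1)), lattice_point_matrix R d B ->
    N%:R = (if odd d then d%:R * (d%:R ^+ 2 + 11) / 12
            else d%:R * (d%:R ^+ 2 + 8) / 12) :> rat /\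
    exists s : 'I_d.+1 -> 'I_N.+1,
      [/\ forall j, col (s j) B = col j (osc_matrix d),
          coord_projection s @` toric_variety R[i] B
            = toric_variety R[i] (osc_matrix d)
        & @normalization R[i] (proj_variety (toric_variety R[i] B))
            (proj_variety (toric_variety R[i] (osc_matrix d)))
            (coord_projection s)].
Proof.
have d1 : (1 < d)%N by exact: ltnW.
have eA : toric_variety R[i] (osc_matrix d) = @toric R[i] d (@osc d).
  by apply: toric_varietyE => j; apply: col_dsubmx; exact: col_osc_matrix.
rewrite eA; split; first exact: toric_osc_degree.
split; first exact: lattice_point_matrix_exists.
move=> N B hB; have [p [pinj hp colB]] := lattice_point_matrix_points d1 hB.
have -> : toric_variety R[i] B = @toric R[i] N p.
  by apply: toric_varietyE => j; exact: col_dsubmx.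
split.
  have szN : size (polygon_seq d) = N.+1.
    rewrite -[RHS]card_ord cardE -(size_map p); apply/perm_size/uniq_perm.
    - exact: polygon_seq_uniq.
    - by rewrite map_inj_uniq ?enum_uniq.
    move=> w; rewrite mem_polygon_seq; apply/idP/mapP => [/hp[i <-]|[i _ ->]].
      by exists i => //; rewrite mem_enum.
    by apply/hp; exists i.
  have := size_polygon_seq (ltnW d1); rewrite szN -natr1 => /addIr.
  exact.
have /choice[s hs] : forall j : 'I_d.+1, exists i, p i = osc j.
  by move=> j; apply/hp; exact: osc_in_polygon.
exists s; split.
- by move=> j; rewrite colB hs col_osc_matrix.
- exact: (@proj_image R[i] d N p s hd hp hs).
- exact: (@proj_normalization R[i] d N p s hd hp hs).
Qed.
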